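(* Let $(\mathcal{A},\varphi)$ be a $W^*$-probability space. Let $\mathbb{X},\mathbb{Y}\in\mathcal{A}$ be self-adjoint, positive (with $\mathbb{X}$ and $\mathbb{Y}$ invertible), free, compactly supported and non-degenerate random variables. Define $\mathbb{U}=(\mathbb{X}+\mathbb{Y})^{-1}$ and $\mathbb{V}=\mathbb{X}^{-1}-(\mathbb{X}+\mathbb{Y})^{-1}$. Assume that $$\varphi(\mathbb{V}\,|\,\mathbb{U})=c\,\mathbb{I},\qquad \varphi(\mathbb{V}^{-1}\,|\,\mathbb{U})=d\,\mathbb{I},$$ for some real constants $c,d$. Then there exists $\delta_0>0$ such that, with $$\lambda=\frac{cd}{cd-1},\qquad \alpha=\frac{\delta_0}{cd-1},\qquad \beta=\frac{d}{cd-1},$$ $\mathbb{Y}$ has the free Poisson distribution with rate $\lambda$ and jump size $1/\alpha$, and $\mathbb{X}$ has the free GIG distribution $\mu(-\lambda,\alpha,\beta)$.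
   Context: A $W^*$-probability space is a pair $(\mathcal{A},\varphi)$ with $\mathcal{A}$ a von Neumann algebra with unit $\mathbb{I}$ and $\varphi:\mathcal{A}\to\mathbb{C}$ a linear functional with $\varphi(\mathbb{I})=1$ that is faithful, normal, tracial and positive. The distribution of a self-adjoint $\mathbb{X}\in\mathcal{A}$ is the compactly supported probability measure $\mu$ on $\mathbb{R}$ with $\varphi(\mathbb{X}^n)=\int t^n\,d\mu(t)$ for all $n$; $\mathbb{X}$ is non-degenerate if it is not a scalar multiple of $\mathbb{I}$. Freeness is in the sense of Voiculescu: two elements are free if the unital algebras they generate are free with respect to $\varphi$. For $\mathbb{U}\in\mathcal{A}$, $\varphi(\cdot\,|\,\mathbb{U})$ denotes the $\varphi$-preserving faithful normal conditional expectation (projection) from $\mathcal{A}$ onto the von Neumann subalgebra generated by $\mathbb{U}$ and $\mathbb{I}$. Under the stated invertibility, $\mathbb{V}$ is invertible with $\mathbb{V}^{-1}=\mathbb{X}+\mathbb{X}\mathbb{Y}^{-1}\mathbb{X}$. Free GIG distribution: for $\lambda\in\mathbb{R}$, $\alpha,\beta>0$, $\mu(\lambda,\alpha,\beta)$ is the probability measure supported on $[a,b]$ with density $$\frac{1}{2\pi}\sqrt{(x-a)(b-x)}\left(\frac{\alpha}{x}+\frac{\beta}{\sqrt{ab}\,x^2}\right),$$ where $0<a<b$ are the solution of $$1-\lambda+\alpha\sqrt{ab}-\beta\frac{a+b}{2ab}=0,\qquad 1+\lambda+\frac{\beta}{\sqrt{ab}}-\alpha\frac{a+b}{2}=0.$$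 Free Poisson (Marchenko--Pastur) distribution with rate $\lambda\ge 0$ and jump size $\gamma>0$: the measure $\max\{0,1-\lambda\}\,\delta_0+\tilde\nu$ (here $\delta_0$ denotes the Dirac mass at $0$, not the constant in the claim), where $\tilde\nu$ is supported on $(\gamma(1-\sqrt\lambda)^2,\gamma(1+\sqrt\lambda)^2)$ with density $\frac{1}{2\pi\gamma x}\sqrt{4\lambda\gamma^2-(x-\gamma(1+\lambda))^2}$. Equivalently, its free cumulants are $\mathcal{R}_n=\lambda\gamma^n$, $n\ge1$, i.e. its $r$-transform is $\frac{\lambda\gamma}{1-\gamma z}$. *)

(* Defs.v *)
From HB Require Import structures.
From mathcomp Require Import all_boot all_order all_algebra.
From mathcomp Require Import all_classical all_reals all_analysis.
From mathcomp Require Import complex.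

Set Implicit Arguments.
Unset Strict Implicit.
Unset Printing Implicit Defensive.

Import Order.TTheory GRing.Theory Num.Theory.
Import numFieldNormedType.Exports.

Local Open Scope classical_set_scope.
Local Open Scope ring_scope.
Local Open Scope complex_scope.

Record hilbert_space (R : realType) := HilbertSpace {
  hs_space :> completeNormedModType R[i];
  (* linear in the first argument, antilinear in the second *)
  hs_dot : {dot hs_space for Num.conj};
  hs_normE : forall x : hs_space, `|x| ^+ 2 = hs_dot x x
}.

(* Limit, in the weak operator topology, of a family of operators indexed by
   I along a filter F on I. *)
Definition wot_lim (R : realType) (H : hilbert_space R) (I : Type)
    (op : I -> H -> H) (F : set_system I) (T : H -> H) : Prop :=
  forall x y : H, hs_dot H (op i x) y @[i --> F] --> hs_dot H (T x) y.

(* A von Neumann algebra, that is, a unital *-algebra of bounded operators on a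
   Hilbert space which is closed in the weak operator topology. The algebra is
   kept as a type of its own, identified with an algebra of operators by the
   injection vn_op, so that the ring theory applies to its elements. In a
   unitAlgType, x^-1 is the inverse when x has a two-sided inverse in the
   algebra, and x otherwise. *)
Record von_neumann_algebra (R : realType) := VonNeumannAlgebra {
  vn_sort :> unitAlgType R[i];
  vn_space : hilbert_space R;
  vn_op : vn_sort -> {linear vn_space -> vn_space};
  vn_star : vn_sort -> vn_sort;
  vn_op_continuous : forall a, continuous (vn_op a);
  vn_opD : forall a b x, vn_op (a + b) x = vn_op a x + vn_op b x;
  vn_opZ : forall k a x, vn_op (k *: a) x = k *: vn_op a x;
  vn_op1 : forall x, vn_op 1 x = x;
  vn_opM : forall a b x, vn_op (a * b) x = vn_op a (vn_op b x);
  vn_op_inj : forall a b, vn_op a =1 vn_op b -> a = b;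
  vn_starP : forall a x y,
    hs_dot vn_space (vn_op a x) y = hs_dot vn_space x (vn_op (vn_star a) y);
  vn_op_closed : forall (F : set_system vn_sort)
      (T : {linear vn_space -> vn_space}),
    ProperFilter F -> continuous T -> wot_lim vn_op F T ->
    exists a, vn_op a =1 T
}.

Section VonNeumannAlgebras.
Context {R : realType} {A : von_neumann_algebra R}.
Implicit Types (a b : A) (B : set A).

Definition selfadjoint a : Prop := vn_star a = a.

Definition vn_positive a : Prop :=
  forall x, 0 <= hs_dot (vn_space A) (vn_op a x) x.

Definition vn_le a b : Prop := vn_positive (b - a).

Definition vn_nondegenerate a : Prop := ~ exists k : R[i], a = k%:A.

Definition unital_subalgebra B : Prop :=
  [/\ B 1,
      forall a b, B a -> B b -> B (a + b),
      forall (k : R[i]) a, B a -> B (k *: a) &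
      forall a b, B a -> B b -> B (a * b)].

Definition vn_subalgebra B : Prop :=
  [/\ unital_subalgebra B,
      forall a, B a -> B (vn_star a) &
      forall (F : set_system A) a,
        ProperFilter F -> F B -> wot_lim (@vn_op R A) F (vn_op a) -> B a].

Definition algebra_generated a : set A := smallest unital_subalgebra [set a].

Definition vn_generated a : set A := smallest vn_subalgebra [set a].

End VonNeumannAlgebras.

Definition is_lub (T : Type) (le : T -> T -> Prop) (D : set T) (s : T) : Prop :=
  (forall a, D a -> le a s) /\
  (forall t, (forall a, D a -> le a t) -> le s t).

Definition upward_directed (T : Type) (le : T -> T -> Prop) (D : set T) : Prop :=
  D !=set0 /\ forall a b, D a -> D b -> exists2 c, D c & le a c /\ le b c.

(* Preservation of suprema of increasing nets of self-adjoint elements (such a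
   net and its range, a directed set, have the same supremum). *)
Definition vn_normal (R : realType) (A : von_neumann_algebra R) (T : Type)
    (le : T -> T -> Prop) (f : A -> T) : Prop :=
  forall (D : set A) (s : A), D `<=` selfadjoint ->
    upward_directed vn_le D -> is_lub vn_le D s -> is_lub le (f @` D) (f s).

Record wstar_probability_space (R : realType) := WstarProbabilitySpace {
  wps_algebra :> von_neumann_algebra R;
  wps_state : {scalar wps_algebra};
  wps_state1 : wps_state 1 = 1;
  wps_state_positive : forall a : wps_algebra, 0 <= wps_state (vn_star a * a);
  wps_state_faithful : forall a : wps_algebra,
    wps_state (vn_star a * a) = 0 -> a = 0;
  wps_state_tracial : forall a b : wps_algebra,
    wps_state (a * b) = wps_state (b * a);
  wps_state_normal :
    vn_normal (fun z w : R[i] => (z <= w : Prop)) wps_state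
}.

Section FreeProbability.
Context {R : realType} {A : wstar_probability_space R}.
Local Notation phi := (wps_state A).

Definition free_subalgebras (I : Type) (B : I -> set A) : Prop :=
  forall (n : nat) (i : nat -> I) (a : nat -> A),
    (forall k, (k <= n)%N -> B (i k) (a k) /\ phi (a k) = 0) ->
    (forall k, (k < n)%N -> i k <> i k.+1) ->
    phi (\prod_(0 <= k < n.+1) a k) = 0.

Definition freely_independent (X Y : A) : Prop :=
  free_subalgebras
    (fun b : bool => if b then algebra_generated X else algebra_generated Y).

(* E is the phi-preserving faithful normal conditional expectation of A onto
   the von Neumann subalgebra N. *)
Record is_cond_exp (N : set A) (E : {linear A -> A}) : Prop := IsCondExp {
  cond_exp_range : forall a, N (E a);
  cond_exp_id : forall a, N a -> E a = a;
  cond_exp_bimodule : forall a b c, N a -> N c -> E (a * b * c) = a * E b * c;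
  cond_exp_positive : forall a, vn_positive (E (vn_star a * a));
  cond_exp_faithful : forall a, E (vn_star a * a) = 0 -> a = 0;
  cond_exp_normal : vn_normal vn_le E;
  cond_exp_state : forall a, phi (E a) = phi a
}.

Definition has_distribution (X : A)
    (mu : probability (measurableTypeR R) R) : Prop :=
  (exists2 K : set R, compact K & mu (~` K) = 0%E) /\
  (forall n : nat, phi (X ^+ n) = (\int[mu]_t (t ^+ n))%:C).

Definition compactly_supported (X : A) : Prop :=
  exists mu, has_distribution X mu.

Definition distributed_as (X : A)
    (law : probability (measurableTypeR R) R -> Prop) : Prop :=
  exists2 mu, law mu & has_distribution X mu.

End FreeProbability.

Section Laws.
Context {R : realType}.
Local Notation leb := (@lebesgue_measure R).

Definition free_poisson_density (lam gam x : R) : R :=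
  (2 * pi * gam * x)^-1 *
  Num.sqrt (4 * lam * gam ^+ 2 - (x - gam * (1 + lam)) ^+ 2).

Definition free_poisson_interval (lam gam : R) : set R :=
  `]gam * (1 - Num.sqrt lam) ^+ 2, gam * (1 + Num.sqrt lam) ^+ 2[.

Definition free_poisson (lam gam : R)
    (mu : probability (measurableTypeR R) R) : Prop :=
  [/\ 0 <= lam, 0 < gam &
    forall S : set (measurableTypeR R), measurable S ->
      mu S = ((Num.max 0 (1 - lam))%R%:E * dirac (0 : R)%R S +
        \int[leb]_(x in S `&` free_poisson_interval lam gam)
          (free_poisson_density lam gam x)%:E)%E].

Definition free_gig_endpoints (lam alpha beta a b : R) : Prop :=
  [/\ 0 < a, a < b,
    1 - lam + alpha * Num.sqrt (a * b) - beta * ((a + b) / (2 * a * b)) = 0 &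
    1 + lam + beta / Num.sqrt (a * b) - alpha * ((a + b) / 2) = 0].

Definition free_gig_density (alpha beta a b x : R) : R :=
  (2 * pi)^-1 * Num.sqrt ((x - a) * (b - x)) *
  (alpha / x + beta / (Num.sqrt (a * b) * x ^+ 2)).

(* The system determines a and b uniquely, hence also mu. *)
Definition free_gig (lam alpha beta : R)
    (mu : probability (measurableTypeR R) R) : Prop :=
  [/\ 0 < alpha, 0 < beta &
    exists a b : R, free_gig_endpoints lam alpha beta a b /\
      forall S : set (measurableTypeR R), measurable S ->
        mu S = (\int[leb]_(x in S `&` `[a, b]%classic)
                  (free_gig_density alpha beta a b x)%:E)%E].

End Laws.

(* Main.v *)
From HB Require Import structures.
Require Import Defs.
From mathcomp Require Import all_boot all_order all_algebra.
From mathcomp Require Import all_classical all_reals all_analysis.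
From mathcomp Require Import complex measurable_realfun.
From mathcomp Require Import ring lra zify.

(** Put S = X + Y and U = S^-1. Since X^-1 = V + U and V^-1 = S Y^-1 S - S, the
    two hypotheses on V say that, in the mean against the algebra of S, X^-1 acts
    as c + S^-1 and Y^-1 acts as S^-1 + d S^-2 (regression_X, regression_Y).
    Freeness turns these two regressions into algebraic equations.

    The equations live in formal power series in u, where u stands for the
    Cauchy transform of S at a point z. For an element Z let k_Z(u) = u z, with z
    the point where the Cauchy transform of Z takes the value u; this is
    1 + u times the r-transform. It is the only series with constant coefficient
    1 for which the inverse of k_Z(u) - u Z has mean 1, which defines it
    recursively with no analysis (pencil_exists). Freeness gives
    k_S = k_X + k_Y - 1 and makes (k_X(u) - u X)^-1 the conditional expectation
    of (k_S(u) - u S)^-1 on the algebra of X, and likewise for Y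
    (subordination). The inverse X^-1 is a limit of polynomials in X, so the
    regressions may be tested on these resolvents. What comes out is linear in
    four auxiliary series, and eliminating them (regression_quadratic) leaves
      k_Y(u) (q - kappa u) = q + u,  kappa = c d - 1,  q = phi(Y^-1),
    which is the relation of a free Poisson law, with delta_0 = q, and a
    quadratic equation for k_X that involves one more constant, phi(U).
    The signs 0 < kappa and 0 < d follow from the first coefficients, as the
    mean and the variance of Y are positive (moment_equations).

    The unknown phi(U) is fixed by the position of the spectrum. The moment
    series of X is a convergent real series at every point w < 0, so that the
    discriminant D(w) of the quadratic is a square there and is nonnegative. Its
    square root changes sign between 0 and minus infinity, hence D vanishes at
    some -r < 0, and -r is a double root of D (discriminant_root_ge0). A
    quartic of this shape with a negative double root has two other roots a, b
    which solve the system that defines the endpoints of the free GIG law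
    (gig_endpoints).

    It remains to see that the explicit densities have the moments that the
    equations prescribe. Both have the form
      sqrt ((x - a) (b - x)) (A / x + B / x^2) / (2 pi),
    with B = 0 for the free Poisson law. Integration by parts gives a
    three-term recurrence for the moments of the square root (root_moment_rec).
    It says that a certain generating series E solves 2 Q E' = Q' E with
    Q = (1 - a u) (1 - b u), so that E^2 = Q (root_series_sq). Hence the moment
    series of the density solves the quadratic equation, whose solution among
    power series is unique (segment_moments_unique). *)

Set Implicit Arguments.
Unset Strict Implicit.
Unset Printing Implicit Defensive.

Import Order.TTheory GRing.Theory Num.Theory.
Import numFieldNormedType.Exports.

Local Open Scope classical_set_scope.
Local Open Scope ring_scope.
Local Open Scope complex_scope.

(** * Formal power series *)

(** Coefficients may lie in a noncommutative ring: resolvents are series over the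
    algebra of operators. *)
Record fps (R : Type) : Type := Fps { fps_coef :> nat -> R }.

Lemma fpsP (R : Type) (f g : fps R) : f =1 g -> f = g.
Proof. by case: f g => [f] [g] /= /funext ->. Qed.

HB.instance Definition _ (R : nzRingType) := gen_eqMixin (fps R).
HB.instance Definition _ (R : nzRingType) := gen_choiceMixin (fps R).

Section FpsRing.
Variable R : nzRingType.
Implicit Types f g h : fps R.

Definition fps_add f g : fps R := Fps (fun n => f n + g n).
Definition fps_opp f : fps R := Fps (fun n => - f n).
Definition fps_zero : fps R := Fps (fun=> 0).
Definition fps_one : fps R := Fps (fun n => (n == 0)%:R).
Definition fps_mul f g : fps R := Fps (fun n => \sum_(i < n.+1) f i * g (n - i)%N).

Fact fps_addA : associative fps_add.
Proof. by move=> f g h; apply: fpsP => n; rewrite /= addrA. Qed.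
Fact fps_addC : commutative fps_add.
Proof. by move=> f g; apply: fpsP => n; rewrite /= addrC. Qed.
Fact fps_add0 : left_id fps_zero fps_add.
Proof. by move=> f; apply: fpsP => n; rewrite /= add0r. Qed.
Fact fps_addN : left_inverse fps_zero fps_opp fps_add.
Proof. by move=> f; apply: fpsP => n; rewrite /= addNr. Qed.

HB.instance Definition _ := GRing.isZmodule.Build (fps R)
  fps_addA fps_addC fps_add0 fps_addN.

(** Up to degree n a product of series is a product of polynomials, from which
    associativity is inherited. *)
Definition fps_trunc n f : {poly R} := \poly_(i < n.+1) f i.

Lemma fps_mul_trunc f g n m :
  (m <= n)%N -> fps_mul f g m = (fps_trunc n f * fps_trunc n g)`_m.
Proof.
move=> mn; rewrite coefM; apply: eq_bigr => i _; rewrite !coef_poly.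
have im : (i <= m)%N by rewrite -ltnS.
by rewrite !ltnS (leq_trans im mn) (leq_trans (leq_subr _ _) mn).
Qed.

Fact fps_mulA : associative fps_mul.
Proof.
move=> f g h; apply: fpsP => n.
transitivity ((fps_trunc n f * (fps_trunc n g * fps_trunc n h))`_n).
  rewrite coefM; apply: eq_bigr => i _.
  by rewrite (@fps_mul_trunc _ _ n) ?leq_subr // coef_poly ltn_ord.
rewrite mulrA coefM; apply: eq_bigr => i _.
have im : (i <= n)%N by rewrite -ltnS.
by rewrite (@fps_mul_trunc _ _ n) // coef_poly ltnS leq_subr.
Qed.
Fact fps_mul1l : left_id fps_one fps_mul.
Proof.
move=> f; apply: fpsP => n; rewrite /= big_ord_recl /= mul1r subn0.
by rewrite big1 ?addr0 // => i _; rewrite /= mul0r.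
Qed.
Fact fps_mul1r : right_id fps_one fps_mul.
Proof.
move=> f; apply: fpsP => n; rewrite /= big_ord_recr /= subnn mulr1.
rewrite big1 ?add0r // => i _.
by rewrite subn_eq0 leqNgt ltn_ord mulr0.
Qed.
Fact fps_mulDl : left_distributive fps_mul fps_add.
Proof.
move=> f g h; apply: fpsP => n; rewrite /= -big_split /=.
by apply: eq_bigr => i _; rewrite mulrDl.
Qed.
Fact fps_mulDr : right_distributive fps_mul fps_add.
Proof.
move=> f g h; apply: fpsP => n; rewrite /= -big_split /=.
by apply: eq_bigr => i _; rewrite mulrDr.
Qed.
Fact fps_one_neq0 : fps_one != fps_zero.
Proof. by apply/eqP => /(congr1 (fun f : fps R => f 0%N)) /eqP; rewrite oner_eq0. Qed.

HB.instance Definition _ := GRing.Zmodule_isNzRing.Build (fps R)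
  fps_mulA fps_mul1l fps_mul1r fps_mulDl fps_mulDr fps_one_neq0.

End FpsRing.

Section ComFps.
Variable R : comNzRingType.
Fact fps_mulC : commutative (@fps_mul R).
Proof.
move=> f g; apply: fpsP => n; rewrite /= (reindex_inj rev_ord_inj) /=.
apply: eq_bigr => i _; rewrite mulrC; congr (g _ * f _).
by rewrite subSS subKn // -ltnS.
Qed.
HB.instance Definition _ := GRing.PzRing_hasCommutativeMul.Build (fps R) fps_mulC.
End ComFps.

Definition fps_X {R : nzRingType} : fps R := Fps (fun n => (n == 1)%:R).
Definition fps_C {R : nzRingType} (c : R) : fps R :=
  Fps (fun n => c *+ (n == 0)).
Definition fps_shift {R : Type} (f : fps R) : fps R := Fps (fun n => f n.+1).

Section FpsTheory.
Variable R : nzRingType.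
Implicit Types (f g h : fps R) (c : R).

Lemma fps1E n : (1 : fps R) n = (n == 0)%:R. Proof. by []. Qed.
Lemma fpsDE f g n : (f + g) n = f n + g n. Proof. by []. Qed.
Lemma fpsNE f n : (- f) n = - f n. Proof. by []. Qed.
Lemma fpsME f g n : (f * g) n = \sum_(i < n.+1) f i * g (n - i)%N.
Proof. by []. Qed.

Lemma fpsM0E f g : (f * g) 0%N = f 0%N * g 0%N.
Proof. by rewrite fpsME big_ord1 subnn. Qed.

Lemma fps_sumE I (r : seq I) (P : pred I) (F : I -> fps R) n :
  (\sum_(i <- r | P i) F i) n = \sum_(i <- r | P i) F i n.
Proof. by elim/big_rec2: _ => // i x y _ <-. Qed.

Lemma fps_XM0 f : (fps_X * f) 0%N = 0.
Proof. by rewrite fpsM0E /= mul0r. Qed.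

Lemma fps_XMS f n : (fps_X * f) n.+1 = f n.
Proof.
rewrite fpsME big_ord_recl mul0r add0r big_ord_recl /= mul1r subSS subn0.
by rewrite big1 ?addr0 // => i _; rewrite /bump /= mul0r.
Qed.

Lemma fps_XC f : fps_X * f = f * fps_X.
Proof.
apply: fpsP => -[|n]; first by rewrite !fpsM0E /= mul0r mulr0.
rewrite fps_XMS fpsME big_ord_recr /= subnn mulr0 addr0 big_ord_recr /=.
rewrite subSnn mulr1 big1 ?add0r // => i _.
by rewrite subSn ?(ltnW (ltn_ord i)) //= eqSS subn_eq0 leqNgt ltn_ord mulr0.
Qed.

Lemma fps_CM c f n : (fps_C c * f) n = c * f n.
Proof.
rewrite fpsME big_ord_recl /= mulr1n subn0.
by rewrite big1 ?addr0 // => i _; rewrite /= mulr0n mul0r.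
Qed.

Lemma fps_MC f c n : (f * fps_C c) n = f n * c.
Proof.
rewrite fpsME big_ord_recr /= subnn mulr1n.
rewrite big1 ?add0r // => i _.
by rewrite subn_eq0 leqNgt ltn_ord mulr0n mulr0.
Qed.

Lemma fps_decomp f : f = fps_C (f 0%N) + fps_X * fps_shift f.
Proof.
apply: fpsP => -[|n]; rewrite fpsDE ?fps_XM0 ?fps_XMS /=.
  by rewrite mulr1n addr0.
by rewrite mulr0n add0r.
Qed.

Lemma fps_XM_inj f g : fps_X * f = fps_X * g -> f = g.
Proof.
move=> e; apply: fpsP => n; rewrite -[f n](fps_XMS f) e; exact: fps_XMS.
Qed.

Lemma fps_exp_small f n m : f 0%N = 0 -> (m < n)%N -> (f ^+ n) m = 0.
Proof.
move=> f0; elim: n m => // n IHn m mn; rewrite exprS fpsME big_ord_recl /=.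
rewrite f0 mul0r add0r big1 // => i _; rewrite IHn ?mulr0 //.
rewrite /bump /=; have := ltn_ord i; lia.
Qed.

Fact fps_C_zmod : zmod_morphism (@fps_C R).
Proof. by move=> x y; apply: fpsP => n; rewrite fpsDE fpsNE /= mulrnBl. Qed.
Fact fps_C_monoid : monoid_morphism (@fps_C R).
Proof.
split=> [|x y]; first by apply: fpsP.
by apply: fpsP => n; rewrite fps_CM /= mulrnAr.
Qed.
HB.instance Definition _ :=
  GRing.isZmodMorphism.Build R (fps R) (@fps_C R) fps_C_zmod.
HB.instance Definition _ :=
  GRing.isMonoidMorphism.Build R (fps R) (@fps_C R) fps_C_monoid.

(** The inverse of 1 - h is the geometric series of h, whose coefficients
    stabilize because h has no constant term. *)
Lemma fps_inv_exists f : f 0%N = 1 -> exists g, f * g = 1 /\ g * f = 1.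
Proof.
move=> f0; pose h := 1 - f.
have h0 : h 0%N = 0 by rewrite fpsDE fpsNE f0 subrr.
have fE : f = 1 - h by rewrite /h opprB addrC subrK.
pose gN N := \sum_(i < N) h ^+ i.
have gNE N : f * gN N = 1 - h ^+ N.
  by rewrite /gN fE -opprB mulNr -subrX1 opprB.
have gNE' N : gN N * f = 1 - h ^+ N.
  rewrite -gNE; apply: commr_sym; rewrite /gN; apply: commr_sum => i _.
  by rewrite fE; apply/commrX/commr_sym/commrB; [exact: commr1|].
pose g := Fps (fun n => gN n.+1 n).
have gE N m : (m < N)%N -> g m = gN N m.
  move=> mN; rewrite /g /gN /= !fps_sumE.
  rewrite (big_ord_widen_cond N xpredT (fun i => (h ^+ i) m)) //=.
  rewrite [RHS](bigID (fun i : 'I_N => (i < m.+1)%N)) /= [X in _ = _ + X]big1 ?addr0 //.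
  by move=> i; rewrite -leqNgt => mi; rewrite fps_exp_small.
exists g; split; apply: fpsP => n.
  transitivity ((f * gN n.+1) n); last first.
    by rewrite gNE fpsDE fpsNE fps_exp_small // oppr0 addr0.
  by rewrite !fpsME; apply: eq_bigr => i _; rewrite (gE n.+1) // ltnS leq_subr.
transitivity ((gN n.+1 * f) n); last first.
  by rewrite gNE' fpsDE fpsNE fps_exp_small // oppr0 addr0.
by rewrite !fpsME; apply: eq_bigr => i _; rewrite (gE n.+1).
Qed.

End FpsTheory.

Section FpsMap.
Variables (R S : nzRingType).

Definition fps_map (phi : R -> S) (f : fps R) : fps S :=
  Fps (fun n => phi (f n)).

Variable phi : {rmorphism R -> S}.
Fact fps_map_zmod : zmod_morphism (fps_map phi).
Proof. by move=> x y; apply: fpsP => n /=; rewrite rmorphB. Qed.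
Fact fps_map_monoid : monoid_morphism (fps_map phi).
Proof.
split=> [|x y]; apply: fpsP => n /=; first by rewrite rmorph_nat.
by rewrite rmorph_sum; apply: eq_bigr => i _; rewrite rmorphM.
Qed.
HB.instance Definition _ :=
  GRing.isZmodMorphism.Build (fps R) (fps S) (fps_map phi) fps_map_zmod.
HB.instance Definition _ :=
  GRing.isMonoidMorphism.Build (fps R) (fps S) (fps_map phi) fps_map_monoid.

Lemma fps_map_C c : fps_map phi (fps_C c) = fps_C (phi c).
Proof. by apply: fpsP => n /=; rewrite rmorphMn. Qed.
Lemma fps_map_X : fps_map phi fps_X = fps_X.
Proof. by apply: fpsP => n /=; rewrite rmorph_nat. Qed.
End FpsMap.

Lemma fps_cancel (K : idomainType) (f g h : fps K) :
  f 0%N != 0 -> f * g = f * h -> g = h.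
Proof.
move=> f0 e; apply/eqP; rewrite -subr_eq0; apply/eqP.
have {e} : f * (g - h) = 0 by rewrite mulrBr e subrr.
move: (g - h) => D fD; apply: fpsP => n.
elim/ltn_ind: n => n IHn.
have /eqP := congr1 (fun x : fps K => x n) fD.
rewrite fpsME big_ord_recl subn0 big1 => [|i _].
  by rewrite addr0 mulf_eq0 (negPf f0) => /eqP.
by rewrite IHn ?mulr0 //= /bump /=; have := ltn_ord i; lia.
Qed.

(** * Substitution of series *)
Section Comp.
Variables (K : comNzRingType) (th : fps K).
Hypothesis th0 : th 0%N = 0.
Implicit Types f g : fps K.

Definition fps_comp f : fps K := Fps (fun n => \sum_(i < n.+1) f i * (th ^+ i) n).

Lemma fps_comp_widen f m N :
  (m < N)%N -> fps_comp f m = \sum_(i < N) f i * (th ^+ i) m.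
Proof.
move=> mN; rewrite /= (big_ord_widen_cond N xpredT (fun i => f i * (th ^+ i) m)) //=.
rewrite [RHS](bigID (fun i : 'I_N => (i < m.+1)%N)) /= [X in _ = _ + X]big1 ?addr0 //.
by move=> i; rewrite -leqNgt => mi; rewrite fps_exp_small ?mulr0.
Qed.

Lemma fps_compE f : fps_comp f = fps_C (f 0%N) + th * fps_comp (fps_shift f).
Proof.
apply: fpsP => n.
rewrite fpsDE fpsME /= big_ord_recl /= mulr_natr; congr (_ + _).
transitivity (\sum_(i < n) \sum_(j < n.+1) th j * (f i.+1 * (th ^+ i) (n - j)%N)).
  apply: eq_bigr => i _; rewrite /bump add1n exprS fpsME mulr_sumr.
  by apply: eq_bigr => j _; rewrite mulrCA.
rewrite exchange_big /=; apply: eq_bigr => j _; rewrite -mulr_sumr.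
case: j => -[|j] jn /=; first by rewrite th0 !mul0r.
congr (_ * _); rewrite -(@fps_comp_widen (fps_shift f) (n - j.+1)%N n) //.
by rewrite ltn_subrL; lia.
Qed.

Fact fps_comp_zmod : zmod_morphism fps_comp.
Proof.
move=> f g; apply: fpsP => n /=; rewrite -sumrB.
by apply: eq_bigr => i _; rewrite mulrBl.
Qed.
HB.instance Definition _ :=
  GRing.isZmodMorphism.Build (fps K) (fps K) fps_comp fps_comp_zmod.

(** Infinite descent: such an e 0 is divisible by every power of th. Identities
    about substitution follow by applying this to the successive shifts of a
    series. *)
Lemma fps_comp_unique (e : nat -> fps K) :
  (forall j, e j = th * e j.+1) -> e 0%N = 0.
Proof.
move=> eE; have eN N : e 0%N = th ^+ N * e N.
  by elim: N => [|N ->]; rewrite ?mul1r // exprSr -mulrA -eE.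
apply: fpsP => n; rewrite (eN n.+1) fpsME big1 // => i _.
by rewrite fps_exp_small ?mul0r.
Qed.

Lemma fps_compC c : fps_comp (fps_C c) = fps_C c.
Proof.
rewrite fps_compE; have -> : fps_shift (fps_C c) = 0 by apply: fpsP.
by rewrite raddf0 mulr0 addr0 /= mulr1n.
Qed.

Lemma fps_compXM f : fps_comp (fps_X * f) = th * fps_comp f.
Proof.
rewrite fps_compE; have -> : fps_shift (fps_X * f) = f.
  by apply: fpsP => n; rewrite -(fps_XMS f).
by rewrite fps_XM0 raddf0 add0r.
Qed.

Lemma fps_compCM c f : fps_comp (fps_C c * f) = fps_C c * fps_comp f.
Proof.
apply: fpsP => n; rewrite fps_CM /= mulr_sumr; apply: eq_bigr => i _.
by have /= -> := fps_CM c f i; rewrite mulrA.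
Qed.

Fact fps_comp_monoid : monoid_morphism fps_comp.
Proof.
split=> [|f g]; first by rewrite -(rmorph1 (@fps_C K)) fps_compC.
apply/eqP; rewrite -subr_eq0; apply/eqP.
pose s j := iter j (@fps_shift K) f.
apply: (@fps_comp_unique (fun j => fps_comp (s j * g) - fps_comp (s j) * fps_comp g)).
move=> j; rewrite [s j]fps_decomp -/(s j.+1) mulrDl !raddfD /= -mulrA.
rewrite !fps_compXM fps_compCM fps_compC -/(s j.+1).
ring.
Qed.
HB.instance Definition _ :=
  GRing.isMonoidMorphism.Build (fps K) (fps K) fps_comp fps_comp_monoid.

Lemma fps_compX : fps_comp fps_X = th.
Proof. by rewrite -[fps_X]mulr1 fps_compXM rmorph1 mulr1. Qed.

End Comp.

(** A series that becomes 0 after substituting u t has constant coefficient 0,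
    and u t may be cancelled, so that its shift becomes 0 as well. *)
Lemma fps_comp_inj (K : idomainType) (t : fps K) :
  t 0%N != 0 -> injective (fps_comp (fps_X * t)).
Proof.
move=> t0; have th0 := fps_XM0 t.
suff inj0 f : fps_comp (fps_X * t) f = 0 -> f = 0.
  move=> f g e; apply/eqP; rewrite -subr_eq0; apply/eqP/inj0.
  by rewrite raddfB /= e subrr.
move=> f0; apply: fpsP => n.
have : fps_comp (fps_X * t) (iter n (@fps_shift K) f) = 0.
  elim: n => //= n; rewrite fps_compE //.
  move: (iter _ _ _) => g e.
  have g0 : g 0%N = 0.
    have := congr1 (fun x : fps K => x 0%N) e.
    by rewrite fpsDE fpsM0E fps_XM0 mul0r addr0 /= mulr1n.
  move: e; rewrite g0 raddf0 add0r -mulrA -[RHS](mulr0 fps_X) => /fps_XM_inj.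
  by rewrite -[RHS](mulr0 t) => /(fps_cancel t0).
have -> : f n = (iter n (@fps_shift K) f) 0%N.
  by elim: n (f) => [|n IHn] g; rewrite ?iterSr -?IHn.
move=> /(congr1 (fun x : fps K => x 0%N)) /=.
by rewrite big_ord1 expr0 /= mulr1.
Qed.

(** * Operators on the Hilbert space *)
Lemma discriminant_le (R : realType) (p q r : R) :
  (forall t, 0 <= p + 2 * t * q + t ^+ 2 * r) -> q ^+ 2 <= p * r.
Proof.
move=> h; have p0 : 0 <= p by have := h 0; lra.
case: (ltgtP r 0) => [r0|r0|r0].
- have := h ((2 * `|q| + p + 1) / - r + 1).
  set s := (2 * `|q| + p + 1) / - r + 1.
  have s1 : 1 <= s by rewrite lerDr divr_ge0 //; have := normr_ge0 q; lra.
  have sr : s * r = - (2 * `|q| + p + 1) + r.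
    by rewrite /s mulrDl mul1r invrN mulrN mulNr mulfVK // lt_eqF.
  have -> : s ^+ 2 * r = s * (s * r) by ring.
  rewrite sr; have := ler_norm q; have := normr_ge0 q; nra.
- have := h (- (q / r)).
  have -> : p + 2 * - (q / r) * q + (- (q / r)) ^+ 2 * r = p - q ^+ 2 / r.
    by field; rewrite gt_eqF.
  by rewrite subr_ge0 ler_pdivrMr.
rewrite r0 mulr0; case: (eqVneq q 0) => [->|q0]; first by rewrite expr0n.
have := h (- ((p + 1) / (2 * q))).
have -> : p + 2 * - ((p + 1) / (2 * q)) * q + (- ((p + 1) / (2 * q))) ^+ 2 * r = -1.
  by rewrite r0 mulr0; field.
lra.
Qed.

Section ComplexRe.
Variable R : realType.
Implicit Types z w : R[i].

Lemma ReD z w : complex.Re (z + w) = complex.Re z + complex.Re w.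
Proof. by case: z; case: w. Qed.
Lemma ReB z w : complex.Re (z - w) = complex.Re z - complex.Re w.
Proof. by case: z; case: w. Qed.
Lemma ReZ (k : R) z : complex.Re (k%:C * z) = k * complex.Re z.
Proof. by case: z => a b /=; rewrite mul0r subr0. Qed.
Lemma ReJ z : complex.Re z^* = complex.Re z.
Proof. by case: z. Qed.
Lemma eq_realC z : complex.Im z = 0 -> z = (complex.Re z)%:C.
Proof. by case: z => a b /= ->. Qed.

End ComplexRe.

Section Hilbert.
Variables (R : realType) (H : hilbert_space R).
Implicit Types x y z : H.
Local Notation dot := (hs_dot H).

(** Real parts of inner products carry all the inequalities that are needed, and
    stay in the real field, where linear arithmetic decides. *)
Definition rdot x y : R := complex.Re (dot x y).

Lemma dotC x y : dot x y = (dot y x)^*.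
Proof. by rewrite hermC expr0 mul1r. Qed.
Lemma rdotC x y : rdot x y = rdot y x.
Proof. by rewrite /rdot dotC ReJ. Qed.
Lemma rdotDl x y z : rdot (x + y) z = rdot x z + rdot y z.
Proof. by rewrite /rdot linearDl ReD. Qed.
Lemma rdotBl x y z : rdot (x - y) z = rdot x z - rdot y z.
Proof. by rewrite /rdot linearBl ReB. Qed.
Lemma rdotZl (k : R) x z : rdot (k%:C *: x) z = k * rdot x z.
Proof. by rewrite /rdot linearZl_LR ReZ. Qed.
Lemma rdotDr x y z : rdot z (x + y) = rdot z x + rdot z y.
Proof. by rewrite !(rdotC z) rdotDl. Qed.
Lemma rdotBr x y z : rdot z (x - y) = rdot z x - rdot z y.
Proof. by rewrite !(rdotC z) rdotBl. Qed.
Lemma rdotZr (k : R) x z : rdot z (k%:C *: x) = k * rdot z x.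
Proof. by rewrite !(rdotC z) rdotZl. Qed.
Lemma rdot0l x : rdot 0 x = 0.
Proof. by have := rdotBl 0 0 x; rewrite subrr => ->; rewrite subrr. Qed.

Definition rsq x : R := rdot x x.

Lemma dot_rsq x : dot x x = (rsq x)%:C.
Proof. by apply: eq_realC; have := dnorm_ge0 dot x; exact: ger0_Im. Qed.
Lemma rsq_ge0 x : 0 <= rsq x.
Proof. by have := dnorm_ge0 dot x; rewrite dot_rsq ler0c. Qed.
Lemma rsq_eq0 x : rsq x = 0 -> x = 0.
Proof.
by move=> h; apply/eqP; rewrite -(dnorm_eq0 dot) dot_rsq h.
Qed.
Lemma rsqZ (k : R) x : rsq (k%:C *: x) = k ^+ 2 * rsq x.
Proof. by rewrite /rsq rdotZl rdotZr mulrA. Qed.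
Lemma rsqB x y : rsq (x - y) = rsq x - 2 * rdot x y + rsq y.
Proof. rewrite /rsq !rdotBl !rdotBr (rdotC y x); ring. Qed.
Lemma rsqD x y : rsq (x + y) = rsq x + 2 * rdot x y + rsq y.
Proof. rewrite /rsq !rdotDl !rdotDr (rdotC y x); ring. Qed.
Lemma norm_rsq x : `|x| = (Num.sqrt (rsq x))%:C.
Proof.
apply/eqP; rewrite -(eqrXn2 (n:=2)) //; last by rewrite ler0c sqrtr_ge0.
by rewrite hs_normE dot_rsq -rmorphXn /= sqr_sqrtr // rsq_ge0.
Qed.

Lemma rdot_CS x y : rdot x y ^+ 2 <= rsq x * rsq y.
Proof.
apply: discriminant_le => t.
have := rsq_ge0 (x + t%:C *: y).
by rewrite rsqD rdotZr rsqZ mulrA.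
Qed.

Lemma dot_eqP x y : (forall z, dot z x = dot z y) -> x = y.
Proof.
move=> h; apply/eqP; rewrite -subr_eq0; apply/eqP/rsq_eq0.
by rewrite /rsq rdotBr /rdot h subrr.
Qed.

Lemma dot_norm_le x y : `|dot x y| <= (Num.sqrt (2 * rsq x * rsq y))%:C.
Proof.
rewrite normc_def lecR ler_wsqrtr //.
have h1 := rdot_CS x y; have h2 := rdot_CS ('i *: x) y.
have e : rsq ('i *: x) = rsq x.
  rewrite /rsq /rdot linearZl_LR linearZr_LR /= mulrA.
  by rewrite [_ * Num.conj _](_ : _ = 1) ?mul1r //; apply/eqP; rewrite eq_complex /=; apply/andP; split; apply/eqP; ring.
rewrite e {1}/rdot linearZl_LR /= mulrC ReiNIm sqrrN in h2.
by rewrite -mulrA mulrDl mul1r lerD.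
Qed.

End Hilbert.

Section Operators.
Variables (R : realType) (A : von_neumann_algebra R).
Local Notation H := (vn_space A).
Local Notation dot := (hs_dot H).
Local Notation op := (@vn_op R A).
Local Notation star := (@vn_star R A).
Implicit Types (a b : A) (x y : H).

Lemma op0 x : op 0 x = 0.
Proof. by rewrite -(scale0r (0 : A)) vn_opZ scale0r. Qed.
Lemma opN a x : op (- a) x = - op a x.
Proof. by rewrite -scaleN1r vn_opZ scaleN1r. Qed.
Lemma opB a b x : op (a - b) x = op a x - op b x.
Proof. by rewrite vn_opD opN. Qed.

Lemma star_unique a b :
  (forall x y, dot (op a x) y = dot x (op b y)) -> star a = b.
Proof.
move=> h; apply: vn_op_inj => y; apply: (@dot_eqP _ H) => x.
by rewrite -vn_starP.
Qed.
Lemma starK a : star (star a) = a.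
Proof. by apply: star_unique => x y; rewrite dotC -vn_starP -dotC. Qed.
Lemma starD a b : star (a + b) = star a + star b.
Proof.
by apply: star_unique => x y; rewrite !vn_opD linearDl linearD /= !vn_starP.
Qed.
Lemma starZ (k : R[i]) a : star (k *: a) = k^* *: star a.
Proof.
apply: star_unique => x y.
by rewrite !vn_opZ linearZl_LR linearZr_LR /= vn_starP; congr (_ * _); rewrite [RHS]conjcK.
Qed.
Lemma starM a b : star (a * b) = star b * star a.
Proof. by apply: star_unique => x y; rewrite !vn_opM !vn_starP. Qed.
Lemma star1 : star 1 = 1.
Proof. by apply: star_unique => x y; rewrite !vn_op1. Qed.
Lemma starB a b : star (a - b) = star a - star b.
Proof. by rewrite -scaleN1r starD starZ rmorphN1 scaleN1r. Qed.

Lemma sa1 : selfadjoint (1 : A). Proof. exact: star1. Qed.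
Lemma saD a b : selfadjoint a -> selfadjoint b -> selfadjoint (a + b).
Proof. by rewrite /selfadjoint starD => -> ->. Qed.
Lemma saB a b : selfadjoint a -> selfadjoint b -> selfadjoint (a - b).
Proof. by rewrite /selfadjoint starB => -> ->. Qed.
Lemma saZ (k : R) a : selfadjoint a -> selfadjoint (k%:C *: a).
Proof. rewrite /selfadjoint starZ. by rewrite [Num.conj _]conjc_real => ->. Qed.
Lemma saX a n : selfadjoint a -> selfadjoint (a ^+ n).
Proof.
move=> sa; elim: n => [|n IHn]; first by rewrite expr0; exact: sa1.
by rewrite /selfadjoint exprS starM IHn sa -exprSr -exprS.
Qed.
Lemma saV a : a \is a GRing.unit -> selfadjoint a -> selfadjoint a^-1.
Proof.
move=> ua sa; rewrite /selfadjoint; apply: (mulrI ua).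
by rewrite divrr // -{1}sa -starM mulVr // star1.
Qed.
Lemma sa_conj a b : selfadjoint b -> selfadjoint (star a * b * a).
Proof. by move=> sb; rewrite /selfadjoint !starM starK sb mulrA. Qed.

Lemma sa_rdot a x y : selfadjoint a -> rdot (op a x) y = rdot x (op a y).
Proof. by move=> sa; rewrite /rdot vn_starP sa. Qed.

(** A self-adjoint operator has real diagonal coefficients. *)
Lemma posP a : selfadjoint a -> (forall x, 0 <= rdot (op a x) x) -> vn_positive a.
Proof.
move=> sa h x; rewrite [dot _ _]eq_realC ?ler0c ?h //.
have : dot (op a x) x = (dot (op a x) x)^* by rewrite -dotC vn_starP sa.
by case: (dot _ _) => u v /= [] /eqP; rewrite -addr_eq0 -mulr2n mulrn_eq0 => /eqP.
Qed.
Lemma pos_rdot a x : vn_positive a -> 0 <= rdot (op a x) x.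
Proof. by move=> /(_ x); rewrite lecE => /andP[]. Qed.

Lemma op_bounded a : exists2 C : R, 0 < C & forall x, rsq (op a x) <= C * rsq x.
Proof.
have /linear_boundedP [M [Mr hM]] :=
  continuous_linear_bounded 0 (@vn_op_continuous _ _ a 0).
pose m : R := `|complex.Re M| + 1.
have m0 : 0 < m by rewrite ltr_wpDl.
exists (m ^+ 2); first by rewrite exprn_gt0.
move=> x; have := hM m%:C.
have -> : M < m%:C.
  by rewrite -(RRe_real Mr) ltcR /m (le_lt_trans (ler_norm _)) // ltrDl.
move=> /(_ isT x); rewrite !norm_rsq -rmorphM lecR => h.
rewrite -[leLHS]sqr_sqrtr ?rsq_ge0 // -[rsq x]sqr_sqrtr ?rsq_ge0 // -exprMn.
by rewrite lerXn2r // nnegrE ?sqrtr_ge0 // mulr_ge0 ?sqrtr_ge0 // ltW.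
Qed.

End Operators.

Lemma geometric_small (R : realType) (C q e : R) :
  0 <= q < 1 -> 0 < e -> exists N, forall n, (N <= n)%N -> C * q ^+ n < e.
Proof.
move=> /andP[q0 q1] e0.
have q1' : `|q| < 1 by rewrite ger0_norm.
have /cvgrPdist_lt /(_ e e0) [N _ hN] := cvg_geometric C q1'.
exists N => n Nn; have := hN n Nn.
by rewrite /= sub0r normrN; apply: le_lt_trans; exact: ler_norm.
Qed.

Lemma geometric_cvg (R : realType) (V : normedModType R[i]) (C q : R)
    (f : nat -> V) (l : V) : 0 <= q < 1 ->
  (forall n, `|l - f n| ^+ 2 <= (C * q ^+ n)%:C) -> f @ \oo --> l.
Proof.
move=> q01 h; apply/cvgrPdist_lt => e e0.
have er : e = (complex.Re e)%:C by rewrite RRe_real ?gtr0_real.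
have re0 : 0 < complex.Re e by move: e0; rewrite er ltcR.
have [N hN] := geometric_small C q01 (exprn_gt0 2 re0).
exists N => // n /= Nn; rewrite -(ltr_pXn2r (n:=2)) // ?nnegrE ?normr_ge0 ?ltW //.
by apply: le_lt_trans (h n) _; rewrite er -rmorphXn /= ltcR hN.
Qed.

(** * Inverses of positive elements *)
Section Neumann.
Variables (R : realType) (A : von_neumann_algebra R).
Local Notation H := (vn_space A).
Local Notation dot := (hs_dot H).
Local Notation op := (@vn_op R A).
Implicit Types (a b T : A) (x y : H).

(** The bound is on squared norms, so that q is the square of the norm of T. *)
Definition sa_contraction (q : R) T : Prop :=
  [/\ 0 <= q < 1, selfadjoint T & forall x, rsq (op T x) <= q * rsq x].

Lemma sa_contraction_exp q T n x : sa_contraction q T ->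
  rsq (op (T ^+ n) x) <= q ^+ n * rsq x.
Proof.
move=> [/andP[q0 _] _ hT]; elim: n => [|n IHn].
  by rewrite !expr0 vn_op1 mul1r.
rewrite !exprS vn_opM (le_trans (hT _)) // -mulrA ler_wpM2l //.
Qed.

Lemma sa_contraction_lower q T x : sa_contraction q T ->
  ((1 - q) / 2) * rsq x <= rdot (op (1 - T) x) x.
Proof.
move=> [_ _ hT]; rewrite opB vn_op1 rdotBl -/(rsq x).
have := rsq_ge0 (op T x - x); rewrite rsqB.
have := hT x; lra.
Qed.

Lemma sa_contraction_bound q T x : sa_contraction q T ->
  ((1 - q) / 2) ^+ 2 * rsq x <= rsq (op (1 - T) x).
Proof.
move=> cT; have h := sa_contraction_lower x cT.
case: cT => /andP[q0 q1] _ _.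
have := rdot_CS (op (1 - T) x) x.
have := rsq_ge0 x; rewrite le_eqVlt => /predU1P[<-|x0].
  by move=> _; rewrite mulr0 rsq_ge0.
have e0 : 0 < (1 - q) / 2 by lra.
move: h; move: ((1 - q) / 2) e0 => e e0 h1 h2.
rewrite -(ler_pM2r x0); apply: le_trans h2.
have -> : e ^+ 2 * rsq x * rsq x = (e * rsq x) ^+ 2 by ring.
by rewrite lerXn2r // nnegrE ?(le_trans _ h1) // mulr_ge0 // ltW.
Qed.

(** The partial sums of the powers of T converge pointwise, hence weakly, to a
    bounded operator that inverts 1 - T. Weak closure puts the limit in the
    algebra, and in every von Neumann subalgebra that contains T. *)
Lemma neumann q T : sa_contraction q T ->
  exists a, [/\ (1 - T) * a = 1, a * (1 - T) = 1 &
    forall N, vn_subalgebra N -> N T -> N a].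
Proof.
move=> cT; have [q01 saT hT] := cT.
have /andP[q0 q1] := q01.
pose e := ((1 - q) / 2) ^+ 2.
have e0 : 0 < e by rewrite exprn_gt0 //; lra.
have low x : rsq x <= e^-1 * rsq (op (1 - T) x).
  by rewrite ler_pdivlMl //; exact: sa_contraction_bound.
pose s n : A := \sum_(k < n) T ^+ k.
have sE n : (1 - T) * s n = 1 - T ^+ n.
  by rewrite /s -opprB mulNr -subrX1 opprB.
have sE' n : s n * (1 - T) = 1 - T ^+ n.
  rewrite -sE; apply: commr_sym; rewrite /s; apply: commr_sum => i _.
  by apply/commrX/commr_sym/commrB; [exact: commr1|].
have sTE n x : op (1 - T) (op (s n) x) = x - op (T ^+ n) x.
  by rewrite -vn_opM sE opB vn_op1.
have scauchy x : cauchy ((fun n => op (s n) x) @ \oo).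
  apply: cauchy_exP => eps eps0.
  have er : eps = (complex.Re eps)%:C by rewrite RRe_real ?gtr0_real.
  have re0 : 0 < complex.Re eps by move: eps0; rewrite er ltcR.
  have [N hN] := geometric_small (e^-1 * (4 * rsq x)) q01 (exprn_gt0 2 re0).
  exists (op (s N) x); exists N => // n /= Nn.
  rewrite -ball_normE /= -(ltr_pXn2r (n:=2)) // ?nnegrE ?normr_ge0 ?ltW // hs_normE dot_rsq.
  rewrite er -rmorphXn /= ltcR (le_lt_trans _ (hN N _)) // -!mulrA.
  apply: le_trans (low _) _; rewrite ler_wpM2l ?invr_ge0 ?(ltW e0) //.
  rewrite linearB /= !sTE opprB [X in rsq X]addrC addrA subrK.
  have h1 := sa_contraction_exp N x cT.
  have h2 := sa_contraction_exp n x cT.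
  have h3 : q ^+ n * rsq x <= q ^+ N * rsq x.
    by rewrite ler_wpM2r ?rsq_ge0 // ler_wiXn2l // ltW.
  have := rsq_ge0 (op (T ^+ n) x + op (T ^+ N) x); rewrite rsqB rsqD.
  lra.
have scvg x : cvg ((fun n => op (s n) x) @ \oo) by exact: cauchy_cvg.
pose L x := lim ((fun n => op (s n) x) @ \oo).
have LP x : (fun n => op (s n) x) @ \oo --> L x by exact: scvg.
have L_linear : linear L.
  move=> k x y; apply: cvg_lim; first exact: norm_hausdorff.
  have -> : (fun n => op (s n) (k *: x + y)) =
            (fun n => k *: op (s n) x + op (s n) y).
    by apply/funext => n; rewrite linearP.
  by apply: cvgD; [apply: cvgZr; exact: LP|exact: LP].
have LE x : op (1 - T) (L x) = x.
  have h1 : (fun n => op (1 - T) (op (s n) x)) @ \oo --> op (1 - T) (L x).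
    by apply: cvg_comp (LP x) _; exact: vn_op_continuous.
  apply: (cvg_unique _ h1); first exact: norm_hausdorff.
  apply: (geometric_cvg (C := rsq x) q01) => n.
  rewrite sTE opprB addrC subrK hs_normE dot_rsq lecR mulrC.
  exact: sa_contraction_exp.
have Lbound x : rsq (L x) <= e^-1 * rsq x by rewrite -[X in _ * rsq X]LE.
have Ldiff n x : rsq (L x - op (s n) x) <= e^-1 * rsq x * q ^+ n.
  apply: le_trans (low _) _; rewrite linearB /= LE sTE opprB addrC subrK.
  by rewrite -mulrA ler_wpM2l ?invr_ge0 ?(ltW e0) // mulrC sa_contraction_exp.
pose Llin : {linear H -> H} := HB.pack L (GRing.isLinear.Build _ _ _ _ L L_linear).
have Lcont : continuous Llin.
  apply: bounded_linear_continuous; apply/linear_boundedP.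
  exists (Num.sqrt e^-1)%:C; split; first by rewrite complex_real.
  move=> r er x; rewrite (@le_trans _ _ ((Num.sqrt e^-1)%:C * `|x|)) //.
    rewrite !norm_rsq -rmorphM /= lecR -sqrtrM ?invr_ge0 ?(ltW e0) //.
    exact/ler_wsqrtr/Lbound.
  by rewrite ler_wpM2r // ltW.
have LW : wot_lim op (s @ \oo) Llin.
  move=> x y; apply: (@geometric_cvg _ R[i]^o (2 * (e^-1 * rsq x) * rsq y) q
    (fun n => dot (op (s n) x) y) (dot (L x) y)) => // n.
  rewrite -linearBl /=.
  apply: (@le_trans _ _ ((Num.sqrt (2 * rsq (L x - op (s n) x) * rsq y))%:C ^+ 2)).
    by rewrite lerXn2r ?nnegrE ?normr_ge0 ?ler0c ?sqrtr_ge0 // dot_norm_le.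
  rewrite -rmorphXn /= lecR sqr_sqrtr ?mulr_ge0 ?rsq_ge0 //.
  rewrite [leRHS]mulrAC ler_wpM2r ?rsq_ge0 // -mulrA ler_wpM2l //.
have [a aL] := vn_op_closed _ Lcont LW.
exists a; split.
- by apply: vn_op_inj => x; rewrite vn_opM aL vn_op1; exact: LE.
- apply: vn_op_inj => x; rewrite vn_opM aL vn_op1 /=.
  apply/eqP; rewrite -subr_eq0; apply/eqP/rsq_eq0/eqP.
  rewrite eq_le rsq_ge0 andbT (le_trans (low _)) // linearB /= LE subrr.
  by rewrite /rsq rdot0l mulr0.
- move=> N [[N1 ND NZ NM] _ Ncl] NT.
  apply: (Ncl (s @ \oo)).
    exists 0%N => // n _ /=; rewrite /s.
    have N0 : N 0 by rewrite -(scale0r (1 : A)); exact: NZ.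
    have NX k : N (T ^+ k).
      by elim: k => [|k IHk]; rewrite ?expr0 // exprS; exact: NM.
    by elim/big_ind: _.
  by move=> x y; rewrite aL; exact: LW.
Qed.
End Neumann.

Section StrictlyPositive.
Variables (R : realType) (A : von_neumann_algebra R).
Local Notation op := (@vn_op R A).
Implicit Types (a b P T : A).

Definition strictly_positive P : Prop :=
  selfadjoint P /\
  exists2 e : R, 0 < e & forall x, e * rsq x <= rdot (op P x) x.

Lemma strictly_positive_pos P : strictly_positive P -> vn_positive P.
Proof.
move=> [saP [e e0 he]]; apply: posP => // x.
by rewrite (le_trans _ (he x)) // mulr_ge0 ?rsq_ge0 // ltW.
Qed.

(** This is P^2 <= K P, proved without the square root of P: the form of P is
    nonnegative at x - K^-1 P x, where K bounds P from above. *)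
Lemma positive_sq_le P : selfadjoint P -> vn_positive P ->
  exists2 K : R, 0 < K & forall x, rsq (op P x) <= K * rdot (op P x) x.
Proof.
move=> saP posP; have [C C0 hC] := op_bounded P.
have K0 : 0 < (C + 1) / 2 by lra.
exists ((C + 1) / 2) => // x; move: K0; set K := (C + 1) / 2 => K0.
have hK y : rdot (op P y) y <= K * rsq y.
  have := hC y; have := rsq_ge0 (op P y - y); rewrite rsqB /K; lra.
have := pos_rdot (x - K^-1%:C *: op P x) posP.
rewrite linearB linearZ /= rdotBl !rdotBr !rdotZr !rdotZl -/(rsq _).
rewrite (sa_rdot (op P x) _ saP) -/(rsq _).
have := hK (op P x).
set u := rsq _; set v := rdot _ x; set w := rdot _ _ => h1 h2.
have {h2} : K^-1 * u <= v.
  have : K^-1 * (K^-1 * w) <= K^-1 * u.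
    by rewrite ler_wpM2l ?invr_ge0 ?(ltW K0) // ler_pdivrMl.
  lra.
by rewrite ler_pdivrMl.
Qed.

(** |x|^2 is bounded by |P x|^2 as P has a bounded inverse, and |P x|^2 by the
    form of P at x. *)
Lemma unit_strictly_positive P : selfadjoint P -> vn_positive P ->
  P \is a GRing.unit -> strictly_positive P.
Proof.
move=> saP posP uP; split => //.
have [K K0 hK] := positive_sq_le saP posP.
have [D D0 hD] := op_bounded P^-1.
exists (K^-1 * D^-1); first by rewrite mulr_gt0 ?invr_gt0.
move=> x; rewrite -mulrA ler_pdivrMl // (le_trans _ (hK x)) // ler_pdivrMl //.
by have := hD (op P x); rewrite -vn_opM mulVr // vn_op1.
Qed.

(** With K as in P^2 <= K P and e a lower bound of P, the operator
    T = 1 - P / (K + e) satisfies T^2 <= 1 - e / (K + e). *)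
Lemma strictly_positive_contraction P : strictly_positive P ->
  exists M : R, exists q : R, exists T : A,
    [/\ 0 < M, sa_contraction q T & P = M%:C *: (1 - T)].
Proof.
move=> spP; have [saP [e e0 he]] := spP.
have posP := strictly_positive_pos spP.
have [K K0 hK] := positive_sq_le saP posP.
pose M := K + e; have M0 : 0 < M by rewrite addr_gt0.
pose T := 1 - M^-1%:C *: P.
have M0C : M%:C != 0 :> R[i] by rewrite fmorph_eq0 gt_eqF.
exists M, (1 - e / M), T; split => //; last first.
  rewrite /T opprB addrC subrK scalerA fmorphV divff //.
  by rewrite scale1r.
split; first by rewrite subr_ge0 ler_pdivrMr // mul1r lerDr (ltW K0) /= ltrBlDr ltrDl divr_gt0.
  by apply: saB; [exact: sa1 | exact: saZ].
move=> x; rewrite /T opB vn_op1 vn_opZ rsqB rdotZr rsqZ (rdotC x).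
have h1 := hK x; have h2 := he x.
move: h1 h2; set u := rsq (op P x); set v := rdot _ _; set w := rsq x => h1 h2.
have v0 : 0 <= v by rewrite /v pos_rdot.
have h3 : M^-1 ^+ 2 * u <= M^-1 * v.
  rewrite expr2 -mulrA ler_wpM2l ?invr_ge0 ?(ltW M0) // ler_pdivrMl //.
  by rewrite (le_trans h1) // ler_wpM2r // lerDl ltW.
have h4 : M^-1 * (e * w) <= M^-1 * v.
  by rewrite ler_wpM2l ?invr_ge0 ?(ltW M0).
have -> : (1 - e / M) * w = w - M^-1 * (e * w) by ring.
lra.
Qed.

Lemma strictly_positive_unit P : strictly_positive P ->
  P \is a GRing.unit /\ forall N, vn_subalgebra N -> N P -> N P^-1.
Proof.
move=> spP; have [M [q [T [M0 cT PE]]]] := strictly_positive_contraction spP.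
have M0C : M%:C != 0 :> R[i] by rewrite fmorph_eq0 gt_eqF.
have [a [ha1 ha2 haN]] := neumann cT.
have h1 : M%:C^-1 *: a * P = 1.
  by rewrite PE -scalerAl -scalerAr scalerA mulVf // scale1r.
have h2 : P * (M%:C^-1 *: a) = 1.
  by rewrite PE -scalerAl -scalerAr scalerA mulfV // scale1r.
have uP : P \is a GRing.unit by apply/unitrP; exists (M%:C^-1 *: a).
split => // N vN NP; have [[N1 ND NZ NM] _ _] := vN.
have -> : P^-1 = M%:C^-1 *: a by apply: (mulrI uP); rewrite divrr.
apply: (NZ); apply: haN => //.
have -> : T = 1 + (- M%:C^-1) *: P.
  by rewrite PE scalerA mulNr mulVf // scaleN1r opprB addrC subrK.
by apply: ND => //; exact: NZ.
Qed.

Lemma strictly_positiveV P : strictly_positive P -> strictly_positive P^-1.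
Proof.
move=> spP; have [uP _] := strictly_positive_unit spP.
have saP := proj1 spP; have saV := saV uP saP.
apply: unit_strictly_positive; rewrite ?unitrV //.
apply: posP => // x.
have {2}-> : x = op P (op P^-1 x) by rewrite -vn_opM divrr // vn_op1.
by rewrite rdotC pos_rdot //; exact: strictly_positive_pos.
Qed.

Lemma strictly_positiveD P a : strictly_positive P ->
  selfadjoint a -> vn_positive a -> strictly_positive (P + a).
Proof.
move=> [saP [e e0 he]] saa pa; split; first exact: saD.
exists e => // x; rewrite vn_opD rdotDl (le_trans (he x)) // lerDl.
exact: pos_rdot.
Qed.

End StrictlyPositive.

(** * The trace *)
Section State.
Variables (R : realType) (A : wstar_probability_space R).
Local Notation phi := (wps_state A).
Local Notation star := (@vn_star R A).
Local Notation op := (@vn_op R A).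
Implicit Types (a b P T : A).

(** The state is given as nonnegative on elements b* b; normality extends this
    to positive operators, since 0 and a form a directed set with supremum a. This
    avoids extracting a square root of a. *)
Lemma state_ge0 a : selfadjoint a -> vn_positive a -> 0 <= phi a.
Proof.
move=> saa pa.
have vn_le_refl (b : A) : vn_le b b.
  by move=> x; rewrite subrr op0 linear0l.
have le0a : vn_le 0 a by rewrite /vn_le subr0.
have [] := @wps_state_normal R A [set b | b = 0 \/ b = a] a.
- by move=> b [->|->] //; rewrite /selfadjoint -(subrr (1 : A)) starB star1.
- split; first by exists a; right.
  move=> b c Db Dc; exists a; first by right.
  by move: Db Dc => [->|->] [->|->].
- split; first by move=> b [->|->].
  by move=> t; apply; right.
move=> ub _; rewrite -(raddf0 phi); apply: ub.
by exists 0 => //; left.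
Qed.

Lemma state_le a b : selfadjoint a -> selfadjoint b ->
  (forall x, rdot (op a x) x <= rdot (op b x) x) -> phi a <= phi b.
Proof.
move=> saa sab h; rewrite -subr_ge0 -raddfB; apply: state_ge0.
  exact: saB.
by apply: posP; [exact: saB|move=> x; rewrite opB rdotBl subr_ge0].
Qed.

Lemma state_scal (k : R[i]) : phi (k%:A) = k.
Proof. by rewrite linearZ /= wps_state1 mulr1. Qed.

Lemma state_sa a : selfadjoint a -> phi a = (complex.Re (phi a))%:C.
Proof.
move=> saa; have [C C0 hC] := op_bounded a.
pose k := (C + 1) / 2.
have : phi a <= phi (k%:C%:A).
  apply: state_le => //; first exact: saZ (sa1 A).
  move=> x; rewrite vn_opZ vn_op1 rdotZl -/(rsq x) /k.
  have := hC x; have := rsq_ge0 (op a x - x); rewrite rsqB; lra.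
rewrite state_scal lecE /= => /andP[/eqP im0 _].
by apply: eq_realC; rewrite -im0.
Qed.

Lemma state_gt0 P : strictly_positive P -> 0 < complex.Re (phi P).
Proof.
move=> [saP [e e0 he]].
have : phi (e%:C%:A) <= phi P.
  apply: state_le => //; first exact: saZ (sa1 A).
  by move=> x; rewrite vn_opZ vn_op1 rdotZl; exact: he.
by rewrite state_scal (state_sa saP) lecR; exact: lt_le_trans.
Qed.

Lemma state_star_Re a : complex.Re (phi (star a)) = complex.Re (phi a).
Proof.
have sa' : selfadjoint ('i *: a - 'i *: star a : A).
  rewrite /selfadjoint starB !starZ starK.
  rewrite [Num.conj _](_ : _ = - 'i); last first.
    by apply/eqP; rewrite eq_complex /= oppr0 !eqxx.
  by rewrite !scaleNr opprK addrC.
have := congr1 (@complex.Im R) (state_sa sa'); rewrite linearB !linearZ /=.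
case: (phi a) => u v; case: (phi (star a)) => u' v' /=; lra.
Qed.

Lemma state_CS a b :
  complex.Re (phi (star a * b)) ^+ 2 <=
  complex.Re (phi (star a * a)) * complex.Re (phi (star b * b)).
Proof.
apply: discriminant_le => t.
have := wps_state_positive (a + t%:C *: b); rewrite lecE => /andP[_] h.
rewrite starD starZ [Num.conj _]conjc_real mulrDl !mulrDr -!scalerAl -!scalerAr in h.
rewrite !linearD !linearZ /= ?ReD ?ReZ in h.
have := state_star_Re (star b * a); rewrite starM starK => e.
by move: h; rewrite e /=; lra.
Qed.

Lemma sa_contraction_expr_le q T n x : sa_contraction q T ->
  rdot (op (T ^+ (n + n)) x) x <= q ^+ n * rsq x.
Proof.
move=> cT; have [_ saT _] := cT.
rewrite exprD vn_opM (sa_rdot _ _ (saX n saT)).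
exact: sa_contraction_exp.
Qed.

(** This bounds the moments of X about a large point M, and makes their
    generating series converge up to that point. *)
Lemma state_sa_contraction q T n : sa_contraction q T ->
  complex.Re (phi (T ^+ n)) ^+ 2 <= q ^+ n.
Proof.
move=> cT; have [_ saT _] := cT.
have h : complex.Re (phi (T ^+ (n + n))) <= q ^+ n.
  have : phi (T ^+ (n + n)) <= phi ((q ^+ n)%:C%:A).
    apply: state_le; [exact: saX|exact: saZ (sa1 A)|].
    move=> x; rewrite vn_opZ vn_op1 rdotZl.
    exact: sa_contraction_expr_le.
  by rewrite state_scal lecE => /andP[].
apply: le_trans h.
have := state_CS 1 (T ^+ n).
by rewrite star1 !mul1r wps_state1 (saX n saT) -exprD mul1r.
Qed.

Lemma algebra_generated_closed a : unital_subalgebra (algebra_generated a).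
Proof.
split.
- by move=> B [[]].
- by move=> b c hb hc B BB; have [[_ BD _ _] _] := BB; apply: BD; [exact: hb|exact: hc].
- by move=> k b hb B BB; have [[_ _ BZ _] _] := BB; apply: (BZ); exact: hb.
- by move=> b c hb hc B BB; have [[_ _ _ BM] _] := BB; apply: BM; [exact: hb|exact: hc].
Qed.

Lemma algebra_generated_self a : algebra_generated a a.
Proof. by move=> B [_]; apply. Qed.

(** P^-1 need not be a polynomial in P, but it differs from a partial sum of the
    Neumann series by P^-1 T^k, whose contribution is geometrically small by the
    Cauchy-Schwarz inequality. Freeness, an assertion about polynomials, thus
    reaches X^-1 and Y^-1. *)
Lemma state_inv_annihilates P a : strictly_positive P ->
  (forall f, algebra_generated P f -> phi (f * a) = 0) -> phi (P^-1 * a) = 0.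
Proof.
move=> spP h.
suff Re0 b : (forall f, algebra_generated P f -> phi (f * b) = 0) ->
    complex.Re (phi (P^-1 * b)) = 0.
  have := Re0 _ h.
  have : forall f, algebra_generated P f -> phi (f * ('i *: a)) = 0.
    by move=> f /h e; rewrite -scalerAr linearZ /= e mulr0.
  move=> /Re0; rewrite -scalerAr linearZ /=.
  by case: (phi _) => u v /= e1 e2; apply/eqP; rewrite eq_complex /=; apply/andP; split; apply/eqP; lra.
move=> {}h; have [M [q [T [M0 cT PE]]]] := strictly_positive_contraction spP.
have M0C : M%:C != 0 :> R[i] by rewrite fmorph_eq0 gt_eqF.
have [uP _] := strictly_positive_unit spP.
have [q01 saT _] := cT; have saP := proj1 spP.
have [B1 BD BZ BM] := algebra_generated_closed P.
have BT : algebra_generated P T.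
  have -> : T = 1 + (- M%:C^-1) *: P.
    by rewrite PE scalerA mulNr mulVf // scaleN1r opprB addrC subrK.
  by apply: (BD) => //; apply: (BZ); exact: algebra_generated_self.
have BX k : algebra_generated P (T ^+ k).
  by elim: k => [|k IHk]; rewrite ?expr0 // exprS; exact: BM.
pose s k : A := \sum_(j < k) T ^+ j.
have sE k : P^-1 = M%:C^-1 *: s k + P^-1 * T ^+ k.
  apply: (mulrI uP); rewrite divrr // mulrDr mulrA divrr // mul1r.
  rewrite PE -scalerAl -scalerAr scalerA mulfV // scale1r.
  by rewrite /s -opprB mulNr -subrX1 opprB subrK.
have Bs k : algebra_generated P (M%:C^-1 *: s k).
  apply: (BZ); rewrite /s; elim/big_ind: _ => //.
  by rewrite -(scale0r (1 : A)); exact: BZ.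
have hk k : phi (P^-1 * b) = phi (P^-1 * T ^+ k * b).
  by rewrite {1}(sE k) mulrDl linearD /= h // add0r.
pose C : R := complex.Re (phi (P^-1 * P^-1)) * complex.Re (phi (star b * b)).
have bound k : complex.Re (phi (P^-1 * b)) ^+ 2 <= C * q ^+ k.
  rewrite (hk k) /C.
  have saV' := saV uP saP.
  have := state_CS (T ^+ k * P^-1) b.
  rewrite starM saV' (saX k saT) => /le_trans; apply.
  rewrite mulrAC ler_wpM2r //.
    by have := wps_state_positive b; rewrite lecE => /andP[].
  have : phi (P^-1 * T ^+ k * (T ^+ k * P^-1)) <= phi ((q ^+ k)%:C *: (P^-1 * P^-1)).
    rewrite -mulrA [_ * (_ * P^-1)]mulrA -exprD mulrA.
    have sa2 : selfadjoint (P^-1 * P^-1 : A) by rewrite /selfadjoint starM saV'.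
    apply: state_le; [|exact: saZ|].
      by have := sa_conj P^-1 (saX (k + k) saT); rewrite saV'.
    move=> x; rewrite vn_opZ rdotZl !vn_opM !(sa_rdot _ x saV').
    exact: sa_contraction_expr_le.
  by rewrite linearZ /= lecE => /andP[_]; rewrite ReZ mulrC.
apply/eqP; rewrite -sqrf_eq0 eq_le sqr_ge0 andbT leNgt; apply/negP => pos.
have [N hN] := geometric_small C q01 pos.
by have := lt_le_trans (hN N (leqnn _)) (bound N); rewrite ltxx.
Qed.
End State.

(** * Subordination for free elements *)
Section CourseOfValues.
Variables (T : Type) (x0 : T) (G : seq T -> T).

(** Recursion on all the previous terms: G receives the list of terms 0 to n - 1
    and returns term n. *)
Definition course_seq n := iter n (fun s => rcons s (G s)) [::].
Definition course n := G (course_seq n).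

Lemma course_seqE n : course_seq n = mkseq course n.
Proof.
by elim: n => //= n IHn; rewrite mkseqS -IHn.
Qed.

Lemma courseE n : course n = G (mkseq course n).
Proof. by rewrite {1}/course course_seqE. Qed.

End CourseOfValues.

Section Subordination.
Variables (R : realType) (A : wstar_probability_space R).
Local Notation phi := (wps_state A).
Local Notation K := (R[i]).
Implicit Types (a Z : A) (k : fps K).

Definition fps_lift k : fps A := fps_map (@GRing.in_alg K A) k.
HB.instance Definition _ := GRing.RMorphism.copy fps_lift (fps_map (@GRing.in_alg K A)).
Definition fps_state (f : fps A) : fps K := fps_map phi f.

Lemma fps_liftE k (f : fps A) n :
  (fps_lift k * f) n = \sum_(i < n.+1) k i *: f (n - i)%N.
Proof. by rewrite fpsME; apply: eq_bigr => i _ /=; rewrite -scalerAl mul1r. Qed.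

Lemma fps_liftC k (f : fps A) : fps_lift k * f = f * fps_lift k.
Proof.
apply: fpsP => n; rewrite fps_liftE fpsME (reindex_inj rev_ord_inj) /=.
apply: eq_bigr => i _; rewrite subSS -scalerAr mulr1 subKn //.
by rewrite -ltnS.
Qed.

Fact fps_state_zmod : zmod_morphism fps_state.
Proof. by move=> f g; apply: fpsP => n /=; rewrite raddfB. Qed.
HB.instance Definition _ :=
  GRing.isZmodMorphism.Build (fps A) (fps K) fps_state fps_state_zmod.

Lemma fps_stateE (f : fps A) n : fps_state f n = phi (f n).
Proof. by []. Qed.

Lemma fps_state_lift k (f : fps A) : fps_state (fps_lift k * f) = k * fps_state f.
Proof.
apply: fpsP => n; rewrite fps_stateE fps_liftE fpsME linear_sum /=.
by apply: eq_bigr => i _; rewrite linearZ.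
Qed.

Lemma fps_stateX (f : fps A) : fps_state (fps_X * f) = fps_X * fps_state f.
Proof.
apply: fpsP => -[|n]; first by rewrite fps_stateE !fps_XM0 linear0.
by rewrite fps_stateE !fps_XMS.
Qed.

Lemma fps_stateC a : fps_state (fps_C a) = fps_C (phi a).
Proof. by apply: fpsP => n /=; rewrite raddfMn. Qed.

Lemma fps_stateMC (f g : fps A) : fps_state (f * g) = fps_state (g * f).
Proof.
apply: fpsP => n; rewrite !fps_stateE !fpsME !linear_sum /=.
rewrite [RHS](reindex_inj rev_ord_inj) /=.
apply: eq_bigr => i _; rewrite wps_state_tracial subSS subKn //.
by rewrite -ltnS.
Qed.

(** This is u (z - Z) if k(u) = u z, so that its inverse is the resolvent of Z at z
    divided by u. *)
Definition pencil k Z : fps A := fps_lift k - fps_X * fps_C Z.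

Lemma pencil0 k Z : k 0%N = 1 -> pencil k Z 0%N = 1.
Proof.
by move=> k0; rewrite fpsDE fpsNE fps_XM0 subr0 /= k0 scale1r.
Qed.

Lemma pencil_mulS k Z (f : fps A) n : k 0%N = 1 ->
  (pencil k Z * f) n.+1 =
  f n.+1 + \sum_(i < n.+1) k i.+1 *: f (n - i)%N - Z * f n.
Proof.
move=> k0; rewrite mulrBl fpsDE fpsNE fps_liftE -mulrA fps_XMS fps_CM.
rewrite big_ord_recl /= k0 scale1r subn0.
by congr (_ + _ - _); apply: eq_bigr => i _; rewrite /bump add1n subSS.
Qed.

Lemma pencil_inv_algebra k Z (f : fps A) : k 0%N = 1 -> pencil k Z * f = 1 ->
  forall n, algebra_generated Z (f n).
Proof.
move=> k0 hf; have [B1 BD BZ BM] := algebra_generated_closed Z.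
have f0 : f 0%N = 1.
  have := congr1 (fun x : fps A => x 0%N) hf.
  by rewrite fpsM0E pencil0 // mul1r.
elim/ltn_ind => -[|n] IHn; first by rewrite f0.
have := congr1 (fun x : fps A => x n.+1) hf; rewrite pencil_mulS // fps1E /=.
move=> /eqP; rewrite subr_eq0 => /eqP e.
have -> : f n.+1 = Z * f n + (-1) *: \sum_(i < n.+1) k i.+1 *: f (n - i)%N.
  by rewrite -e scaleN1r addrK.
apply: (BD); first by apply: (BM); [exact: algebra_generated_self|exact: IHn].
apply: (BZ); elim/big_ind: _ => //.
  by rewrite -(scale0r (1 : A)); exact: BZ.
by move=> i _; apply: (BZ); apply: IHn; rewrite ltnS leq_subr.
Qed.

(** The condition that r has mean 1 determines k from r, and the condition that r
    inverts the pencil determines r from k; both are solved together, one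
    coefficient at a time. The coefficients of k are the free cumulants of Z. *)
Lemma pencil_exists Z : exists k, exists r : fps A,
  [/\ k 0%N = 1, pencil k Z * r = 1, r * pencil k Z = 1 & fps_state r = 1].
Proof.
(* s lists r 0, ..., r n, and the sum contains the coefficients of k. *)
pose G (s : seq A) := if size s is n.+1 then
  Z * nth 0 s n - \sum_(i < n.+1) phi (Z * nth 0 s i) *: nth 0 s (n - i)%N
  else 1.
have [r [r0 rS]] : exists r : fps A, r 0%N = 1 /\ forall n,
    r n.+1 = Z * r n - \sum_(i < n.+1) phi (Z * r i) *: r (n - i)%N.
  exists (Fps (course G)); split=> [|n]; first by rewrite /= courseE.
  rewrite /= courseE /G size_mkseq nth_mkseq //; congr (_ - _).
  apply: eq_bigr => i _.
  by rewrite !nth_mkseq // ltnS leq_subr.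
pose k := Fps (fun n => if n is m.+1 then phi (Z * r m) else 1).
have pr : pencil k Z * r = 1.
  apply: fpsP => -[|n]; first by rewrite fpsM0E pencil0 // mul1r r0.
  by rewrite pencil_mulS // rS subrK subrr.
exists k, r; split => //.
  have [g [g1 g2]] := fps_inv_exists (pencil0 Z (erefl : k 0%N = 1)).
  have -> : r = g by rewrite -[r]mul1r -g2 -mulrA pr mulr1.
  exact: g2.
apply: fpsP; elim/ltn_ind => -[|n] IHn.
  by rewrite fps_stateE r0 wps_state1.
rewrite fps_stateE rS linearB linear_sum /=.
rewrite big_ord_recr /= subnn linearZ r0 wps_state1 /= mulr1.
rewrite big1 ?add0r ?subrr // => i _; rewrite linearZ /=.
have := IHn (n - i)%N; rewrite ltnS leq_subr => /(_ isT).
rewrite fps_stateE => ->.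
by rewrite fps1E subn_eq0 leqNgt ltn_ord mulr0.
Qed.

Section Free.
Variable Z : bool -> A.
Implicit Types b c d : bool.
Let B b := algebra_generated (Z b).
Hypothesis free : free_subalgebras B.

(** Sums are allowed because the coefficients of a product of series are sums of
    words. *)
Inductive alternating : bool -> A -> Prop :=
| alternating0 b : alternating b 0
| alternatingD b e f : alternating b e -> alternating b f -> alternating b (e + f)
| alternating1 b x : B b x -> phi x = 0 -> alternating b x
| alternatingM b x e : B b x -> phi x = 0 -> alternating (~~ b) e ->
    alternating b (x * e).

(** Freeness kills each single word. The induction carries a word w that may
    precede e, so that each letter peeled off e is moved to the end of w. *)
Lemma state_alternating b e : alternating b e -> phi e = 0.
Proof.
pose prefix (b : bool) (w : A) := exists n, exists i : nat -> bool, exists a : nat -> A,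
  [/\ forall j, (j < n)%N -> B (i j) (a j) /\ phi (a j) = 0,
      forall j, (j < n)%N -> i j <> i j.+1, i n = b & w = \prod_(0 <= j < n) a j].
have prefixS c w x : prefix c w -> B c x -> phi x = 0 ->
    prefix (~~ c) (w * x) /\ phi (w * x) = 0.
  move=> [n [i [a [ha hi ic ->]]]] Bx phix.
  pose a' j := if j == n then x else a j.
  pose i' j := if j == n.+1 then ~~ c else i j.
  have wE : \prod_(0 <= j < n) a j * x = \prod_(0 <= j < n.+1) a' j.
    rewrite big_nat_recr //= /a' eqxx; congr (_ * _).
    by apply: eq_big_nat => j /andP[_ jn]; rewrite ltn_eqF.
  have ha' j : (j < n.+1)%N -> B (i' j) (a' j) /\ phi (a' j) = 0.
    rewrite /i' /a' ltnS => jn; rewrite ltn_eqF ?ltnS //.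
    case: eqVneq => [->|neq]; first by rewrite ic.
    by apply: ha; rewrite ltn_neqAle neq.
  have hi' j : (j < n.+1)%N -> i' j <> i' j.+1.
    rewrite /i' ltnS => jn; rewrite ltn_eqF ?ltnS // eqSS.
    case: eqVneq => [->|neq]; first by rewrite ic; case: (c).
    by apply: hi; rewrite ltn_neqAle neq.
  split; first by exists n.+1, i', a'; split => //; rewrite /i' eqxx.
  rewrite wE; apply: (free (i := i')) => j jn; first exact: ha'.
  by apply: hi'; rewrite ltnS ltnW.
suff main w : alternating b e -> prefix b w -> phi (w * e) = 0.
  move=> h; have := main 1 h; rewrite mul1r; apply.
  by exists 0%N, (fun=> b), (fun=> 0); split => //; rewrite big_nil.
move=> h; elim: h w => {b e}
  [b|b e f _ IHe _ IHf|b x Bx phix|b x e Bx phix _ IHe] w pw.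
- by rewrite mulr0 linear0.
- by rewrite mulrDr linearD /= IHe // IHf // addr0.
- exact: (prefixS _ _ _ pw Bx phix).2.
- by rewrite mulrA; apply: IHe; exact: (prefixS _ _ _ pw Bx phix).1.
Qed.

Lemma state_mul_alternating b p e : B b p -> alternating (~~ b) e -> phi (p * e) = 0.
Proof.
move=> Bp ae; have [B1 BD BZ BM] := algebra_generated_closed (Z b).
have -> : p = (p + (- phi p) *: 1) + (phi p)%:A.
  by rewrite scaleNr subrK.
rewrite mulrDl -scalerAl mul1r linearD linearZ /=.
rewrite (state_alternating ae) mulr0 addr0.
apply: (@state_alternating b); apply: alternatingM => //.
  by apply: (BD) => //; exact: BZ.
by rewrite linearD linearZ /= wps_state1 mulr1 subrr.
Qed.

Variables (k : bool -> fps K) (r : bool -> fps A).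
Hypothesis k0 : forall b, k b 0%N = 1.
Hypothesis pr : forall b, pencil (k b) (Z b) * r b = 1.
Hypothesis rp : forall b, r b * pencil (k b) (Z b) = 1.
Hypothesis sr : forall b, fps_state (r b) = 1.

(** Let a and c be the inverse pencils of Z b and Z (~~ b), and x = a - 1,
    y = c - 1, which are centred. Since the pencil of the sum is the sum of the two
    pencils minus 1, a E^-1 c = 1 - x y, that is E = c N a with
    N = (1 - x y)^-1. Expanding, c N = 1 + a (y N), where y N consists of centred
    alternating words that start in the algebra of Z (~~ b). By traciality the
    second term contributes phi ((a f a) (y N)) = 0. *)
Lemma subordination b (E : fps A) :
  E * pencil (k b + k (~~ b) - 1) (Z b + Z (~~ b)) = 1 ->
  forall f, B b f -> forall n, phi (f * E n) = phi (f * r b n).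
Proof.
move=> ED f Bf; have [B1 BD BZ BM] := algebra_generated_closed (Z b).
set D := pencil _ _ in ED.
pose P c := pencil (k c) (Z c).
have DE : D = P b + P (~~ b) - 1.
  rewrite /D /P /pencil rmorphB rmorphD rmorph1 /= raddfD mulrDr.
  by rewrite opprD [in RHS]addrACA [RHS]addrAC.
pose a := r b; pose c := r (~~ b); pose xo := a - 1; pose yo := c - 1.
have aDc : a * D * c = 1 - xo * yo.
  rewrite DE mulrBr mulr1 mulrDr rp mulrBl mulrDl mul1r -mulrA pr mulr1.
  rewrite /xo /yo mulrBl mulrBr mul1r !mulr1 !opprB.
  by rewrite [RHS]addrA [1 + _]addrC subrK addrA.
have r00 d : r d 0%N = 1.
  have := congr1 (fun x : fps A => x 0%N) (pr d).
  by rewrite fpsM0E pencil0 // mul1r.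
have xo0 : xo 0%N = 0 by rewrite fpsDE fpsNE r00 fps1E subrr.
have yo0 : yo 0%N = 0 by rewrite fpsDE fpsNE r00 fps1E subrr.
have [N [WN NW]] : exists N, (1 - xo * yo) * N = 1 /\ N * (1 - xo * yo) = 1.
  by apply: fps_inv_exists; rewrite fpsDE fpsNE fpsM0E xo0 mul0r subr0.
have EE : E = c * N * a.
  have h : a * (D * (c * N)) = 1 by rewrite !mulrA aDc.
  have h2 : D * (c * N) = P b by rewrite -[LHS]mul1r -(pr b) -mulrA h mulr1.
  by rewrite -[RHS]mul1r -ED -!mulrA [c * _]mulrA [D * _]mulrA h2 pr mulr1.
have NE : N = 1 + xo * yo * N.
  by rewrite -[X in X + _]WN mulrBl mul1r subrK.
have hB d m : B d (r d m) by exact: pencil_inv_algebra (pr d) m.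
have yoN n : alternating (~~ b) ((yo * N) n).
  have hBo d m : B d ((r d - 1) m) /\ phi ((r d - 1) m) = 0.
    have [C1 CD CZ CM] := algebra_generated_closed (Z d).
    have phir : phi (r d m) = (m == 0)%:R.
      by have := congr1 (fun x : fps K => x m) (sr d).
    rewrite fpsDE fpsNE fps1E -scaler_nat -scaleNr; split.
      by apply: (CD); [exact: hB|exact: CZ].
    by rewrite linearD linearZ /= phir wps_state1 mulr1 subrr.
  elim/ltn_ind: n => n IHn.
  rewrite NE mulrDr mulr1 fpsDE; apply: alternatingD.
    by apply: alternating1; case: (hBo (~~ b) n).
  rewrite -!mulrA fpsME; elim/big_ind: _; [exact: alternating0|exact: alternatingD|].
  move=> [[|i] ni] _.
    by rewrite (_ : yo _ = 0) ?mul0r; [exact: alternating0|exact: yo0].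
  have [h1 h2] := hBo (~~ b) i.+1.
  apply: alternatingM => //; rewrite negbK fpsME.
  elim/big_ind: _; [exact: alternating0|exact: alternatingD|].
  move=> j _; have [h3 h4] := hBo b j.
  by apply: alternatingM => //; apply: IHn => /=; have := ni; set m := nat_of_ord j; lia.
have main : fps_state (fps_C f * E) = fps_state (fps_C f * a).
  have cN : c * N = 1 + a * (yo * N).
    rewrite [a](_ : _ = 1 + xo); last by rewrite /xo addrC subrK.
    rewrite mulrDl mul1r addrCA !mulrA -NE /yo mulrBl mul1r.
    by rewrite subrK.
  (* The trace moves a to the left, which gives a f + (a f a) (y N), as c N = 1 + a (y N). *)
  rewrite EE cN mulrA fps_stateMC !mulrDr !mulr1 raddfD /=.
  rewrite fps_stateMC -[RHS]addr0; congr (_ + _).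
  rewrite [a * _](_ : _ = (a * fps_C f * a) * (yo * N)); last by rewrite !mulrA.
  apply: fpsP => n; rewrite fps_stateE fpsME linear_sum big1 // => i _.
  apply: (@state_mul_alternating b); last exact: yoN.
  rewrite fpsME; elim/big_ind: _ => //.
    by rewrite -(scale0r (1 : A)); exact: BZ.
  move=> j _; apply: (BM); last exact: hB.
  by rewrite fps_MC; apply: (BM) => //; exact: hB.
by move=> n; have := congr1 (fun x : fps K => x n) main; rewrite !fps_stateE !fps_CM.
Qed.

End Free.
End Subordination.
Arguments fps_lift {R A} k.

Section Pencil.
Variables (R : realType) (A : wstar_probability_space R).
Local Notation phi := (wps_state A).
Local Notation K := (R[i]).
Local Notation u := (@fps_X K).
Variables (k : fps K) (Z : A) (r : fps A).
Hypothesis k0 : k 0%N = 1.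
Hypothesis pr : pencil k Z * r = 1.

(** This is phi (B (z - Z)^-1) z = phi B + phi (B Z (z - Z)^-1) in terms of the
    series. *)
Lemma fps_state_pencil (B : A) :
  k * fps_state (fps_C B * r) =
  fps_C (phi B) + u * fps_state (fps_C (B * Z) * r).
Proof.
have -> : fps_C (B * Z) = fps_C B * fps_C Z by rewrite rmorphM.
rewrite -fps_state_lift -fps_stateX -fps_stateC -raddfD /=; congr fps_state.
rewrite -[X in X + _]mulr1 -pr /pencil mulrBl mulrBr -!mulrA.
rewrite [fps_X * (fps_C B * _)]mulrA fps_XC -[_ * fps_X * _]mulrA subrK.
by rewrite !mulrA fps_liftC.
Qed.

Hypothesis sr : fps_state r = 1.

Lemma pencil_coef : k 1%N = phi Z /\ k 2%N = phi (Z * Z) - phi Z * phi Z.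
Proof.
have kE : k = 1 + u * fps_state (fps_C Z * r).
  have := fps_state_pencil 1.
  by rewrite wps_state1 !rmorph1 !mul1r sr mulr1.
have r0 : r 0%N = 1.
  have := congr1 (fun x : fps A => x 0%N) pr.
  by rewrite fpsM0E pencil0 // mul1r.
have k1 : k 1%N = phi Z.
  by rewrite kE fpsDE fps1E add0r fps_XMS fps_stateE fps_CM r0 mulr1.
split => //.
have r1 : r 1%N = Z - (phi Z)%:A.
  have := congr1 (fun x : fps A => x 1%N) pr.
  rewrite pencil_mulS // big_ord1 /= subn0 r0 mulr1 k1 => /eqP.
  by rewrite subr_eq0 => /eqP; exact: (canRL (addrK _)).
rewrite [k in LHS]kE fpsDE fps1E add0r fps_XMS fps_stateE fps_CM r1.
by rewrite mulrBr linearB -scalerAr linearZ /= mulr1.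
Qed.

(** With th = 1 / (z - xi), the moment series of Z - xi at th equals
    (z - xi) times the Cauchy transform u of Z at z, which is k - u xi. *)
Lemma pencil_comp (xi : K) (th : fps K) : th 0%N = 0 ->
  th * (k - u * fps_C xi) = u ->
  fps_comp th (Fps (fun n => phi ((Z - xi%:A) ^+ n))) = k - u * fps_C xi.
Proof.
move=> th0; set g := k - _ => thg.
set xs := Fps _; pose T := Z - xi%:A.
pose a := fps_lift g * r.
have aE : a = 1 + fps_lift th * (fps_C T * a).
  have liftu : fps_lift u = fps_X :> fps A.
    by apply: fpsP => n /=; rewrite scaler_nat.
  have liftC : fps_lift (fps_C xi) = fps_C xi%:A :> fps A.
    by apply: fpsP => n /=; case: (n == 0%N); rewrite ?mulr1n // !mulr0n scale0r.
  rewrite /a [fps_C T * _]mulrA -[fps_C T * fps_lift g]fps_liftC !mulrA -rmorphM thg.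
  rewrite -pr /pencil /T /g rmorphB rmorphM !rmorphB /= liftu liftC -mulrDl; congr (_ * _).
  rewrite mulrBr.
  by rewrite addrA subrK.
pose e j := fps_state (fps_C (T ^+ j) * a) - fps_comp th (iter j (@fps_shift K) xs).
have itE j n : iter j (@fps_shift K) xs n = phi (T ^+ (j + n)).
  by elim: j n => // j IHj n /=; rewrite IHj addnS.
have eE j : e j = th * e j.+1.
  rewrite /e {1}aE mulrDr mulr1 raddfD /= fps_stateC (fps_compE th0) itE addn0.
  rewrite [fps_C _ * (fps_lift _ * _)]mulrA -fps_liftC -mulrA fps_state_lift.
  rewrite mulrA -(rmorphM (@fps_C A)) -exprSr mulrBr. by rewrite opprD addrACA subrr add0r.
have := fps_comp_unique th0 eE; rewrite /e expr0 rmorph1 mul1r /a fps_state_lift sr mulr1.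
by move=> /eqP; rewrite subr_eq0 => /eqP.
Qed.

End Pencil.

(** * The regressions and their elimination *)
Section FormalAlgebra.
Variable K : fieldType.
Local Notation u := (@fps_X K).
Local Notation C := (@fps_C K).

(** The series a, q' are the means of X^-1 and Y^-1 against the resolvents of X
    and Y, and b, c' are those of U and U^2 against the resolvent of S. Elimination
    of a, q', b and c' leaves two relations between k1 and k = k1 + k2 - 1, of which
    I1 and I2 are the cleared forms. Combined, they factor through C s1 + u,
    an invertible series; dividing by it gives Q. *)
Lemma regression_quadratic (k1 k2 a b q' c' : fps K) (p q s1 s2 c d : K) :
  k1 0%N = 1 -> k2 0%N = 1 -> s1 != 0 -> q != 0 ->
  p = c + s1 -> q = s1 + d * s2 ->
  k1 * a = C p + u -> a = C c + b -> (k1 + k2 - 1) * b = C s1 + u ->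
  k2 * q' = C q + u -> q' = b + C d * c' ->
  (k1 + k2 - 1) * c' = C s2 + u * b ->
  k2 * (C q - C (c * d - 1) * u) = C q + u /\
  C (c * d - 1) * u * k1 ^+ 2 - C q * k1 ^+ 2
    - C (2 * (c * d - 1) + 1) * u * k1 + C q * k1
    + C (c * d + d * s1) * u + C d * u ^+ 2 = 0.
Proof.
move=> k10 k20 s10 q0 pE qE h1 h2 h3 h4 h5 h6.
set k := k1 + k2 - 1 in h3 h6 *.
have k0 : k 0%N = 1 by rewrite fpsDE fpsDE fpsNE k10 k20 fps1E addrK.
have CpE : C p = C c + C s1 by rewrite pE rmorphD.
have CqE : C q = C s1 + C d * C s2 by rewrite qE rmorphD rmorphM.
have k2E : k2 = k + 1 - k1 by rewrite /k; ring.
have I1 : k ^+ 2 * (C q + u) = k2 * ((C q + u) * k + C d * u * (C s1 + u)).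
  have -> : (C q + u) * k + C d * u * (C s1 + u) =
     k * (k * b) + C d * (k * (k * c')).
    have e : k * (C s2 + u * b) = k * C s2 + u * (C s1 + u) by rewrite mulrDr mulrCA h3.
    rewrite h3 h6 e CqE; ring.
  rewrite -h4 h5; ring.
have I2 : k * (C p + u) = k1 * (C c * k + C s1 + u).
  rewrite -h1 h2 -addrA -h3; ring.
have Q : k ^+ 2 * (C q + u) = C c * C d * k ^+ 2 * u + k * (C q + u) +
    C d * u * (C s1 + u).
  apply: (@fps_cancel _ (C s1 + u)).
    by rewrite fpsDE /= mulr1n addr0.
  have e1 : (k + 1 - k1) * (C c * k + C s1 + u) = C c * k ^+ 2 + C s1 + u.
    rewrite mulrBl -I2 CpE; ring.
  have : k ^+ 2 * (C q + u) * (C c * k + C s1 + u) =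
     (C c * k ^+ 2 + C s1 + u) * ((C q + u) * k + C d * u * (C s1 + u)).
    by rewrite I1 k2E -e1; ring.
  move=> /eqP; rewrite -subr_eq0 => /eqP e2; apply/eqP; rewrite -subr_eq0.
  by apply/eqP; rewrite -e2; ring.
have cdE : C (c * d - 1) = C c * C d - 1 by rewrite rmorphB rmorphM rmorph1.
have W : k2 * (C q - C (c * d - 1) * u) = C q + u.
  apply: (@fps_cancel _ (k ^+ 2)).
    by rewrite expr2 fpsM0E k0 mulr1 oner_neq0.
  rewrite I1; rewrite mulrCA; congr (_ * _).
  have -> : k ^+ 2 * (C q - C (c * d - 1) * u) =
    k ^+ 2 * (C q + u) - C c * C d * k ^+ 2 * u by rewrite cdE; ring.
  by rewrite Q; ring.
split => //.
set w := C q - C (c * d - 1) * u in W *.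
apply: (@fps_cancel _ w).
  by rewrite fpsDE fpsNE fpsM0E /= mulr0 oppr0 addr0 mulr1n.
rewrite mulr0.
have kw : k * w = k1 * w + C c * C d * u.
  rewrite /k mulrBl mulrDl W /w cdE; ring.
have e : w * (k ^+ 2 * (C q + u) - (C c * C d * k ^+ 2 * u + k * (C q + u) +
    C d * u * (C s1 + u))) = 0 by rewrite Q subrr mulr0.
have {e} : (k * w) ^+ 2 - (k * w) * (C q + u) - C d * u * (C s1 + u) * w = 0.
  by rewrite -[RHS]e /w cdE; ring.
rewrite kw => e; rewrite -[RHS]oppr0 -[in RHS]e.
have -> : C (2 * (c * d - 1) + 1) = 2 * (C c * C d) - 1.
  have -> : 2 * (c * d - 1) + 1 = 2 * (c * d) - 1 by ring.
  by rewrite rmorphB !rmorphM rmorph1 rmorph_nat.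
have -> : C (c * d + d * s1) = C c * C d + C d * C s1.
  by rewrite rmorphD !rmorphM.
rewrite /w cdE; ring.
Qed.

End FormalAlgebra.

Section Regression.
Variables (R : realType) (A : wstar_probability_space R).
Local Notation phi := (wps_state A).
Local Notation K := (R[i]).
Implicit Types (a Z : A).

Lemma vn_generated_closed a : vn_subalgebra (vn_generated a).
Proof.
split.
- split.
  + by move=> B [[[]]].
  + by move=> b c hb hc B BB; have [[[_ BD _ _] _ _] _] := BB; apply: BD; [exact: hb|exact: hc].
  + by move=> k b hb B BB; have [[[_ _ BZ _] _ _] _] := BB; apply: BZ; exact: hb.
  + by move=> b c hb hc B BB; have [[[_ _ _ BM] _ _] _] := BB; apply: BM; [exact: hb|exact: hc].
- by move=> b hb B BB; have [[_ Bs _] _] := BB; apply: Bs; exact: hb.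
- move=> F b PF FN lim B BB; have [[_ _ Bcl] _] := BB.
  apply: Bcl lim => //; apply: filterS FN => c; exact.
Qed.

Lemma vn_generated_self a : vn_generated a a.
Proof. by move=> B [_]; apply. Qed.

Lemma algebra_generated_sub (N : set A) a :
  unital_subalgebra N -> N a -> algebra_generated a `<=` N.
Proof. by move=> uN Na b; apply; split => // _ ->. Qed.

Lemma state_sq_gt0 a : a <> 0 -> selfadjoint a -> 0 < complex.Re (phi (a * a)).
Proof.
move=> a0 saa; have h := wps_state_positive a; rewrite saa in h.
rewrite lt_neqAle; move: (h); rewrite lecE => /andP[/eqP im0 ->]; rewrite andbT.
apply/eqP => e; apply: a0; apply: wps_state_faithful; rewrite saa.
by apply/eqP; rewrite eq_complex /= -e im0 /= !eqxx.
Qed.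

Lemma state_var_gt0 a : vn_nondegenerate a -> selfadjoint a ->
  0 < complex.Re (phi (a * a) - phi a * phi a).
Proof.
move=> nda saa; pose m := phi a.
have mr : m = (complex.Re m)%:C by exact: state_sa.
have sab : selfadjoint (a - (complex.Re m)%:C%:A) by apply: saB => //; exact: saZ (sa1 A).
have : a - (complex.Re m)%:C%:A <> 0.
  by move=> /eqP; rewrite subr_eq0 => /eqP e; apply: nda; exists (complex.Re m)%:C.
move=> /state_sq_gt0 /(_ sab).
rewrite -mr mulrBl !mulrBr -!scalerAr -!scalerAl !mulr1 !mul1r.
rewrite !linearB !linearZ /= wps_state1 -/m mulr1. lra.
Qed.

Variables (X Y : A).
Hypothesis (X_selfadjoint : selfadjoint X) (Y_selfadjoint : selfadjoint Y).
Hypothesis (X_positive : vn_positive X) (Y_positive : vn_positive Y).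
Hypothesis (X_invertible : X \is a GRing.unit) (Y_invertible : Y \is a GRing.unit).
Let S := X + Y.
Let U := S^-1.
Let V := X^-1 - S^-1.
Variables (E : {linear A -> A}) (c d : K).
Hypothesis E_cond_exp : is_cond_exp (vn_generated U) E.
Hypothesis (E_V : E V = c%:A) (E_Vinv : E V^-1 = d%:A).

Let spX : strictly_positive X. Proof. exact: unit_strictly_positive. Qed.
Let spY : strictly_positive Y. Proof. exact: unit_strictly_positive. Qed.
Let spS : strictly_positive S. Proof. exact: strictly_positiveD. Qed.
Let uS : S \is a GRing.unit. Proof. by have [] := strictly_positive_unit spS. Qed.

(** V = X^-1 Y S^-1, because S - X = Y. *)
Lemma invV : V^-1 = S * Y^-1 * S - S.
Proof.
have -> : V = X^-1 * (Y * S^-1).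
  have YE : Y = S - X by rewrite /S addrC addKr.
  by rewrite {1}YE mulrBl divrr // mulrBr mulr1 mulrA mulVr // mul1r.
rewrite !invrM ?unitrMl ?unitrV // !invrK.
have XE : X = S - Y by rewrite /S addrK.
by rewrite {1}XE mulrBr (mulrVK Y_invertible).
Qed.

(** S is the inverse of U, and von Neumann algebras contain the inverses of their
    strictly positive elements. *)
Lemma algebra_generated_inv_sub : algebra_generated S `<=` vn_generated U.
Proof.
have [uN _ _] := vn_generated_closed U.
apply: algebra_generated_sub => //.
have [_ h] := strictly_positive_unit (strictly_positiveV spS).
by have := h _ (vn_generated_closed U) (@vn_generated_self U); rewrite invrK.
Qed.

Lemma cond_exp_scalar W k a : E W = k%:A -> vn_generated U a ->
  phi (W * a) = k * phi a.
Proof.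
move=> EW Na; have [[N1 _ _ _] _ _] := vn_generated_closed U.
rewrite -(cond_exp_state E_cond_exp) -[W * a]mul1r mulrA.
by rewrite (cond_exp_bimodule E_cond_exp) // EW mul1r -scalerAl mul1r linearZ.
Qed.

Lemma regression_X a : algebra_generated S a ->
  phi (X^-1 * a) = c * phi a + phi (U * a).
Proof.
move=> /algebra_generated_inv_sub Na; rewrite -(cond_exp_scalar E_V Na) -linearD /=.
by rewrite -mulrDl /V subrK.
Qed.

(** The regression of V^-1 = S Y^-1 S - S is applied to U a U, and the two factors
    S cancel by traciality. *)
Lemma regression_Y a : algebra_generated S a ->
  phi (Y^-1 * a) = phi (U * a) + d * phi (U * U * a).
Proof.
move=> /algebra_generated_inv_sub Na; have [[_ _ _ NM] _ _] := vn_generated_closed U.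
have NU := @vn_generated_self U.
have Na' : vn_generated U (U * a * U) by apply: (NM) => //; exact: NM.
have := cond_exp_scalar E_Vinv Na'; rewrite invV mulrBl linearB /=.
rewrite /U !mulrA !(mulrK uS) (divrr uS) mul1r => e.
rewrite [phi (Y^-1 * a)](_ : _ = phi (S * Y^-1 * a * S^-1)); last first.
  by rewrite wps_state_tracial !mulrA mulVr // mul1r.
move/eqP: e; rewrite subr_eq => /eqP ->.
by rewrite addrC (wps_state_tracial a) (wps_state_tracial (_ * a)) mulrA.
Qed.

End Regression.

(** * Equations for the moment series *)
Section RealMoments.
Variables (R : realType) (A : wstar_probability_space R).
Local Notation phi := (wps_state A).
Local Notation K := (R[i]).
Local Notation RC := (real_complex R).

Definition moments (a : A) : fps R := Fps (fun n => complex.Re (phi (a ^+ n))).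

Lemma momentsC a : selfadjoint a ->
  Fps (fun n => phi (a ^+ n)) = fps_map RC (moments a).
Proof. by move=> saa; apply: fpsP => n; rewrite [LHS]state_sa //; exact: saX. Qed.

Lemma fps_map_real_inj : injective (fps_map RC).
Proof.
move=> f g e; apply: fpsP => n.
by have /= [] := congr1 (fun x : fps K => x n) e.
Qed.

(** The substitution that turns equations for k into equations for the moments:
    th is a uniformizer, so nothing is lost. *)
Lemma pencil_substitution (k : fps K) (Z : A) (r : fps A) (xi : R) :
  k 0%N = 1 -> pencil k Z * r = 1 -> fps_state r = 1 -> selfadjoint Z ->
  exists th t : fps K, [/\ th = fps_X * t, t 0%N = 1,
    fps_comp th (fps_map RC (moments (Z - xi%:C%:A))) = k - fps_X * fps_C xi%:C &
    th * (k - fps_X * fps_C xi%:C) = fps_X].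
Proof.
move=> k0 pr sr saZ'; set g := k - _.
have g0 : g 0%N = 1 by rewrite fpsDE fpsNE fps_XM0 subr0.
have [t [gt tg]] := fps_inv_exists g0.
have t0 : t 0%N = 1.
  by have := congr1 (fun x : fps K => x 0%N) gt; rewrite fpsM0E g0 mul1r.
have thg : fps_X * t * g = fps_X by rewrite -mulrA tg mulr1.
exists (fps_X * t), t; split => //.
rewrite -momentsC; last by apply: saB => //; exact: saZ (sa1 A).
by apply: (pencil_comp pr sr _ thg); rewrite fps_XM0.
Qed.

End RealMoments.

Section RealSubstitution.
Variables (R : realType) (th : fps R[i]).
Hypothesis th0 : th 0%N = 0.

(** Moments are real while the pencils are complex, so the scalars are extended
    before substituting. *)
Definition real_subst of th 0%N = 0 := fun f : fps R =>
  fps_comp th (fps_map (real_complex R) f).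

Fact real_subst_zmod : zmod_morphism (real_subst th0).
Proof. by move=> f g; rewrite /real_subst rmorphB raddfB. Qed.
Fact real_subst_monoid : monoid_morphism (real_subst th0).
Proof.
have [c1 cM] := fps_comp_monoid th0.
by split=> [|f g]; rewrite /real_subst ?rmorph1 // rmorphM cM.
Qed.
HB.instance Definition _ := GRing.isZmodMorphism.Build (fps R) (fps R[i])
  (real_subst th0) real_subst_zmod.
HB.instance Definition _ := GRing.isMonoidMorphism.Build (fps R) (fps R[i])
  (real_subst th0) real_subst_monoid.

Lemma real_substC c : real_subst th0 (fps_C c) = fps_C c%:C.
Proof. by rewrite /real_subst fps_map_C fps_compC. Qed.
Lemma real_substX : real_subst th0 fps_X = th.
Proof. by rewrite /real_subst fps_map_X fps_compX. Qed.

Lemma real_subst_inj (t : fps R[i]) : th = fps_X * t -> t 0%N != 0 ->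
  injective (real_subst th0).
Proof.
move=> thE t0 f g; rewrite /real_subst thE => /(fps_comp_inj t0).
exact: fps_map_real_inj.
Qed.

End RealSubstitution.

Section EquationMorphism.
Variables (P Q : comNzRingType) (f : {rmorphism P -> Q}).

(** At xi = 0 this is the quadratic equation of the moment series x. For the
    moments about xi, with u = 1 / (z - xi), the factor h is z u. *)
Definition shifted_equation (D : comNzRingType) (kap q kap' cs d u xi x : D) : D :=
  let h := 1 + xi * u in
  kap * u * x ^+ 2 * h ^+ 2 - q * x * h ^+ 2 - kap' * u * x * h + q * h
    + cs * u + d * u ^+ 2 * x.

Lemma shifted_equation_morph kap q kap' cs d u xi x :
  f (shifted_equation kap q kap' cs d u xi x) =
  shifted_equation (f kap) (f q) (f kap') (f cs) (f d) (f u) (f xi) (f x).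
Proof.
by rewrite /shifted_equation !(rmorphD, rmorphN, rmorphM, rmorphXn, rmorph1).
Qed.

End EquationMorphism.

Section MomentEquations.
Variables (R : realType) (A : wstar_probability_space R).
Local Notation phi := (wps_state A).
Local Notation K := (R[i]).
Local Notation RC := (real_complex R).
Variables (X Y : A).
Hypothesis (X_selfadjoint : selfadjoint X) (Y_selfadjoint : selfadjoint Y).
Hypothesis (X_positive : vn_positive X) (Y_positive : vn_positive Y).
Hypothesis (X_invertible : X \is a GRing.unit) (Y_invertible : Y \is a GRing.unit).
Hypothesis XY_free : freely_independent X Y.
Hypothesis Y_nondegenerate : vn_nondegenerate Y.
Let S := X + Y.
Let U := S^-1.
Let V := X^-1 - S^-1.
Variables (E : {linear A -> A}) (c d : R).
Hypothesis E_cond_exp : is_cond_exp (vn_generated U) E.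
Hypothesis (E_V : E V = c%:C%:A) (E_Vinv : E V^-1 = d%:C%:A).

Local Notation u := (@fps_X _).
Local Notation C := (@fps_C _).

(** The constants are q = phi (Y^-1) and s1 = phi (S^-1). The relation for k2 gives
    q phi(Y) = 1 + kappa and q Var(Y) = kappa phi(Y), so that kappa > 0; the linear
    coefficient of the quadratic for k1 gives d s1 = q phi(X), so that d > 0. *)
Lemma moment_equations :
  exists q s1 : R, [/\ 0 < q, 0 < c * d - 1, 0 < d,
   moments Y * (C q - C (c * d - 1) * u * moments Y) = C q + u * moments Y &
   forall xi : R,
     shifted_equation (C (c * d - 1)) (C q) (C (2 * (c * d - 1) + 1)) (C (c * d + d * s1))
       (C d) u (C xi) (moments (X - xi%:C%:A)) = 0].
Proof.
have spX : strictly_positive X by exact: unit_strictly_positive.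
have spY : strictly_positive Y by exact: unit_strictly_positive.
have spS : strictly_positive S by exact: strictly_positiveD.
have [uS _] := strictly_positive_unit spS.
have spU : strictly_positive U by exact: strictly_positiveV.
pose Z b := if b then X else Y.
have freeZ : free_subalgebras (fun b => algebra_generated (Z b)).
  move: XY_free; rewrite /freely_independent /Z; congr free_subalgebras.
  by apply/funext => -[].
have [k1 [r1 [k10 pr1 rp1 sr1]]] := pencil_exists X.
have [k2 [r2 [k20 pr2 rp2 sr2]]] := pencil_exists Y.
pose k b := if b then k1 else k2.
pose r b := if b then r1 else r2.
have k0 b : k b 0%N = 1 by case: b.
have pr b : pencil (k b) (Z b) * r b = 1 by case: b.
have rp b : r b * pencil (k b) (Z b) = 1 by case: b.
have sr b : fps_state (r b) = 1 by case: b.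
pose kS := k1 + k2 - 1.
have kS0 : kS 0%N = 1 by rewrite fpsDE fpsDE fpsNE k10 k20 fps1E addrK.
have [F [DF FD]] := fps_inv_exists (pencil0 S kS0).
have algF := pencil_inv_algebra kS0 DF.
have subX f : algebra_generated X f -> forall n, phi (f * F n) = phi (f * r1 n).
  exact: (subordination freeZ k0 pr rp sr (b := true)).
have subY f : algebra_generated Y f -> forall n, phi (f * F n) = phi (f * r2 n).
  apply: (subordination freeZ k0 pr rp sr (b := false)) => /=.
  by rewrite -[k2 + k1]addrC -[Y + X]addrC.
have subXV n : phi (X^-1 * F n) = phi (X^-1 * r1 n).
  apply/eqP; rewrite -subr_eq0 -raddfB -mulrBr; apply/eqP.
  apply: state_inv_annihilates => // f /subX h.
  by rewrite mulrBr raddfB /= h subrr.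
have subYV n : phi (Y^-1 * F n) = phi (Y^-1 * r2 n).
  apply/eqP; rewrite -subr_eq0 -raddfB -mulrBr; apply/eqP.
  apply: state_inv_annihilates => // f /subY h.
  by rewrite mulrBr raddfB /= h subrr.
have sF : fps_state F = 1.
  rewrite -sr1; apply: fpsP => n; rewrite !fps_stateE.
  have [B1 _ _ _] := algebra_generated_closed X.
  by have := subX 1 B1 n; rewrite !mul1r.
have regX := regression_X X_selfadjoint Y_selfadjoint X_positive Y_positive
  X_invertible E_cond_exp E_V.
have regY := regression_Y X_selfadjoint Y_selfadjoint X_positive Y_positive
  X_invertible Y_invertible E_cond_exp E_Vinv.
pose p := phi X^-1; pose q := phi Y^-1; pose s1 := phi U; pose s2 := phi (U * U).
have [S1 _ _ _] := algebra_generated_closed S.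
have pE : p = c%:C + s1.
  by have := regX 1 S1; rewrite !mulr1 wps_state1 mulr1.
have qE : q = s1 + d%:C * s2 by have := regY 1 S1; rewrite !mulr1.
have q_gt0 := state_gt0 (strictly_positiveV spY).
have s1_gt0 := state_gt0 spU.
have qR : q = (complex.Re q)%:C by rewrite /q {1}state_sa //; exact: (strictly_positiveV spY).1.
have s1R : s1 = (complex.Re s1)%:C by rewrite /s1 {1}state_sa //; exact: spU.1.
have [W XQ] :
  k2 * (fps_C q - fps_C (c%:C * d%:C - 1) * fps_X) = fps_C q + fps_X /\
  fps_C (c%:C * d%:C - 1) * fps_X * k1 ^+ 2 - fps_C q * k1 ^+ 2 -
       fps_C (2 * (c%:C * d%:C - 1) + 1) * fps_X * k1 + fps_C q * k1 +
       fps_C (c%:C * d%:C + d%:C * s1) * fps_X + fps_C d%:C * fps_X ^+ 2 = 0.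
  have q0 : q != 0.
    by rewrite qR fmorph_eq0 gt_eqF.
  have s10 : s1 != 0.
    by rewrite s1R fmorph_eq0 gt_eqF.
  apply: (@regression_quadratic K k1 k2
    (fps_state (fps_C X^-1 * r1)) (fps_state (fps_C U * F))
    (fps_state (fps_C Y^-1 * r2)) (fps_state (fps_C (U * U) * F))
    p q s1 s2 c%:C d%:C) => //.
  - by rewrite (fps_state_pencil pr1) mulVr // rmorph1 mul1r sr1 mulr1.
  - apply: fpsP => n; rewrite fpsDE !fps_stateE !fps_CM -subXV regX //.
    by have := congr1 (fun x : fps K => x n) sF; rewrite fps_stateE => ->; rewrite /= mulr_natr.
  - by rewrite (fps_state_pencil DF) mulVr // rmorph1 mul1r sF mulr1.
  - by rewrite (fps_state_pencil pr2) mulVr // rmorph1 mul1r sr2 mulr1.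
  - apply: fpsP => n; rewrite fpsDE fps_CM !fps_stateE !fps_CM -subYV.
    exact: regY.
  - by rewrite (fps_state_pencil DF) -mulrA mulVr // mulr1.
have [x1E _] := pencil_coef k10 pr1 sr1.
have [y1E y2E] := pencil_coef k20 pr2 sr2.
have x1R := state_sa X_selfadjoint.
have y1R := state_sa Y_selfadjoint.
have x1_gt0 := state_gt0 spX.
have y1_gt0 := state_gt0 spY.
have var_gt0 := state_var_gt0 Y_nondegenerate Y_selfadjoint.
set q' := complex.Re q in q_gt0 qR.
set s1' := complex.Re s1 in s1_gt0 s1R.
set kap := c * d - 1.
have kapC : c%:C * d%:C - 1 = kap%:C by rewrite /kap rmorphB rmorphM rmorph1.
clearbody kap.
have W1 n : k2 n.+1 * q - k2 n * kap%:C = (n == 0%N)%:R.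
  have := congr1 (fun x : fps K => x n.+1) W.
  rewrite mulrBr mulrA -fps_XC fpsDE fpsNE fps_MC fps_XMS fps_MC kapC => ->.
  by rewrite fpsDE /= mulr0n add0r eqSS.
have kap_eq1 : complex.Re (phi Y) * q' = 1 + kap.
  have := W1 0%N; rewrite y1E k20 mul1r y1R qR -rmorphM /= => /eqP.
  rewrite subr_eq => /eqP e; apply: complexI.
  by rewrite e; apply/eqP; rewrite eq_complex /= addr0 !eqxx.
have kap_eq2 : complex.Re (phi (Y * Y) - phi Y * phi Y) * q' = kap * complex.Re (phi Y).
  have := W1 1%N; rewrite y1E y2E => /eqP; rewrite subr_eq add0r => /eqP.
  move=> /(congr1 (@complex.Re R)); rewrite qR mulrC ReZ mulrC => ->.
  by rewrite mulrC ReZ.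
have kap_gt0 : 0 < kap.
  by rewrite -(pmulr_lgt0 _ y1_gt0) -kap_eq2 mulr_gt0.
have d_gt0 : 0 < d.
  have sq1 : (k1 ^+ 2) 1%N = phi X + phi X.
    by rewrite expr2 fpsME big_ord_recl big_ord1 /= k10 x1E mul1r mulr1.
  have sq0 : (k1 ^+ 2) 0%N = 1 by rewrite expr2 fpsM0E k10 mul1r.
  have := congr1 (fun x : fps K => x 1%N) XQ.
  rewrite expr2 -!mulrA !(fpsDE, fpsNE) !fps_CM !fps_XMS -expr2 sq0 sq1 k10 x1E /=.
  rewrite mulr0 addr0 !mulr1 kapC => e.
  have {}e : d%:C * s1 = q * phi X.
    apply/eqP; rewrite -subr_eq0 -[X in _ == X]e -kapC; apply/eqP; ring.
  have : d * s1' = q' * complex.Re (phi X).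
    by apply: complexI; rewrite !rmorphM /= -s1R -qR -x1R.
  by move=> e'; rewrite -(pmulr_lgt0 _ s1_gt0) e' mulr_gt0.
exists q', s1'; split => //.
- have [th [t [thE t0 cy thg]]] := pencil_substitution 0 k20 pr2 sr2 Y_selfadjoint.
  rewrite rmorph0 scale0r subr0 rmorph0 mulr0 subr0 in cy thg.
  have th0 : th 0%N = 0 by rewrite thE fps_XM0.
  apply: (real_subst_inj (th0 := th0) thE); first by rewrite t0 oner_eq0.
  rewrite !(rmorphM, rmorphB, rmorphD) /= !real_substC !real_substX.
  by rewrite [real_subst th0 (moments Y)]cy -mulrA thg -qR -kapC.
move=> xi; set x := moments _.
have [th [t [thE t0 cx thg]]] := pencil_substitution xi k10 pr1 sr1 X_selfadjoint.
have th0 : th 0%N = 0 by rewrite thE fps_XM0.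
apply: (real_subst_inj (th0 := th0) thE); first by rewrite t0 oner_eq0.
rewrite shifted_equation_morph /= !real_substC !real_substX.
rewrite [real_subst th0 x]cx rmorph0.
set g := k1 - _ in cx thg *.
have g0 : g 0%N = 1 by rewrite fpsDE fpsNE fps_XM0 subr0.
apply: (@fps_cancel _ g); first by rewrite g0 oner_eq0.
have -> : (2 * kap + 1)%:C = 2 * kap%:C + 1 :> K.
  by rewrite rmorphD rmorphM /= rmorph1 rmorph_nat.
have -> : (c * d + d * s1')%:C = c%:C * d%:C + d%:C * s1 :> K.
  by rewrite rmorphD !rmorphM /= -s1R.
rewrite mulr0 -[RHS]XQ kapC -qR.
have -> : k1 = g * (1 + C xi%:C * th).
  by rewrite mulrDr mulr1 mulrCA [g * th]mulrC thg [C _ * _]mulrC subrK.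
rewrite -thg /shifted_equation; ring.
Qed.
End MomentEquations.

(** * Evaluation of convergent series *)
Section Evaluation.
Variable R : realType.
Implicit Types (f g : fps R) (s m t C : R).

Definition fps_eval s f : R := limn (series (fun n => f n * s ^+ n)).

(** The ratio t is explicit because products lose some of it: a series of ratio
    t^2 has a square of ratio t. *)
Definition geometric_bound m t C f := forall n, `|f n| * m ^+ n <= C * t ^+ n.

Lemma geometric_sum_le t n : 0 <= t < 1 -> \sum_(i < n) t ^+ i <= (1 - t)^-1.
Proof.
move=> /andP[t0 t1]; rewrite -[leRHS]mul1r ler_pdivlMr ?subr_gt0 //.
rewrite mulrC -opprB mulNr -subrX1 opprB; have := exprn_ge0 n t0; lra.
Qed.

Lemma mulSn_expr_le t n : 0 <= t < 1 -> n.+1%:R * t ^+ n <= (1 - t)^-1.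
Proof.
move=> t01; have /andP[t0 t1] := t01.
apply: le_trans (geometric_sum_le n.+1 t01).
rewrite mulr_natl -[n.+1 in leLHS]card_ord -sumr_const; apply: ler_sum => i _.
by rewrite ler_wiXn2l ?(ltW t1) // -ltnS.
Qed.

Variables m : R.
Hypothesis m0 : 0 < m.

Lemma geometric_bound_norm t C f s n : `|s| <= m -> geometric_bound m t C f ->
  `|f n * s ^+ n| <= C * t ^+ n.
Proof.
move=> sm hf; apply: le_trans (hf n); rewrite normrM normrX ler_wpM2l //.
by rewrite lerXn2r // nnegrE ltW.
Qed.

Section Class.
Variables (t : R) (s : R).
Hypothesis t01 : 0 <= t < 1.
Hypothesis sm : `|s| <= m.

Lemma geometric_bound_cvg C f : geometric_bound m t C f ->
  cvgn (series (fun n => f n * s ^+ n)).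
Proof.
move=> hf; have /andP[t0 t1] := t01.
apply: normed_cvg; apply: (@series_le_cvg _ _ (geometric C t)).
- by move=> n; exact: normr_ge0.
- by move=> n; apply: le_trans (geometric_bound_norm n sm hf); exact: normr_ge0.
- by move=> n; exact: geometric_bound_norm.
- by apply: is_cvg_geometric_series; rewrite ger0_norm.
Qed.

Lemma fps_eval_norm_le C f : geometric_bound m t C f ->
  `|fps_eval s f| <= C / (1 - t).
Proof.
move=> hf; have /andP[t0 t1] := t01.
have C0 : 0 <= C by have := hf 0%N; rewrite !expr0 !mulr1; apply: le_trans.
have cf := geometric_bound_cvg hf.
rewrite /fps_eval -lim_norm //; apply: limr_le; first exact: is_cvg_norm.
apply: nearW => n; apply: le_trans (ler_norm_sum _ _ _) _.
rewrite big_mkord; apply: (@le_trans _ _ (\sum_(i < n) C * t ^+ i)).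
  by apply: ler_sum => i _; exact: geometric_bound_norm.
by rewrite -mulr_sumr ler_wpM2l // geometric_sum_le.
Qed.

Lemma fps_evalD C C' f g : geometric_bound m t C f -> geometric_bound m t C' g ->
  fps_eval s (f + g) = fps_eval s f + fps_eval s g.
Proof.
move=> hf hg; rewrite /fps_eval -limD; try exact: geometric_bound_cvg.
congr (limn _); apply/funext => n; rewrite fctE /series -big_split.
by apply: eq_bigr => i _; rewrite mulrDl.
Qed.

Lemma fps_evalZ C c f : geometric_bound m t C f ->
  fps_eval s (fps_C c * f) = c * fps_eval s f.
Proof.
move=> hf; apply: cvg_lim => //.
have -> : series (fun n => (fps_C c * f) n * s ^+ n) =
    (fun n => c *: series (fun n => f n * s ^+ n) n).
  apply/funext => n; rewrite /series scaler_sumr.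
  by apply: eq_bigr => i _; rewrite fps_CM -mulrA.
by apply: cvgZr; exact: (geometric_bound_cvg hf).
Qed.

Lemma fps_evalX C f : geometric_bound m t C f ->
  fps_eval s (fps_X * f) = s * fps_eval s f.
Proof.
move=> hf; apply: cvg_lim => //; rewrite -cvg_shiftS.
have -> : [sequence series (fun n => (fps_X * f) n * s ^+ n) n.+1]_n =
    (fun n => s *: series (fun n => f n * s ^+ n) n).
  apply/funext => n.
  rewrite -[LHS]/(\sum_(0 <= k < n.+1) (fps_X * f) k * s ^+ k) /series.
  rewrite big_nat_recl // fps_XM0 mul0r add0r.
  rewrite scaler_sumr; apply: eq_bigr => i _.
  by rewrite fps_XMS exprS mulrCA.
by apply: cvgZr; exact: (geometric_bound_cvg hf).
Qed.

End Class.

Lemma fps_evalC s c : fps_eval s (fps_C c) = c.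
Proof.
apply: cvg_lim => //; rewrite -cvg_shiftS.
rewrite [X in X @ _ --> _](_ : _ = fun=> c); first exact: cvg_cst.
apply/funext => n; rewrite /= /series /= big_nat_recl // mulr1n expr0 mulr1.
by rewrite big1 ?addr0 // => i _; rewrite mulr0n mul0r.
Qed.

Lemma geometric_boundD t C C' f g :
  geometric_bound m t C f -> geometric_bound m t C' g ->
  geometric_bound m t (C + C') (f + g).
Proof.
move=> hf hg n; rewrite fpsDE mulrDl (le_trans _ (lerD (hf n) (hg n))) //.
by rewrite -mulrDl ler_wpM2r ?ler_normD // exprn_ge0 // ltW.
Qed.

Lemma geometric_boundZ t C c f : geometric_bound m t C f ->
  geometric_bound m t (`|c| * C) (fps_C c * f).
Proof.
by move=> hf n; rewrite fps_CM normrM -!mulrA ler_wpM2l.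
Qed.

Lemma geometric_bound_iter_shift t C f j : geometric_bound m t C f ->
  geometric_bound m t (C * (t / m) ^+ j) (iter j (@fps_shift R) f).
Proof.
move=> hf n.
have -> : iter j (@fps_shift R) f n = f (j + n)%N.
  by elim: j n => // j IHj n /=; rewrite IHj addnS.
rewrite expr_div_n -mulrA mulrAC mulrA ler_pdivlMr ?exprn_gt0 //.
rewrite -!mulrA -!exprD [(n + j)%N]addnC; exact: hf.
Qed.

Lemma geometric_boundC t c : 0 < t -> geometric_bound m t `|c| (fps_C c).
Proof.
move=> t0 [|n] /=; first by rewrite mulr1n !expr0.
by rewrite mulr0n normr0 mul0r mulr_ge0 // exprn_ge0 // ltW.
Qed.

Lemma geometric_boundX t C f : 0 < t -> geometric_bound m t C f ->
  geometric_bound m t (C * m / t) (fps_X * f).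
Proof.
move=> t0 hf; have C0 : 0 <= C by have := hf 0%N; rewrite !expr0 !mulr1; apply: le_trans.
move=> [|n].
  by rewrite fps_XM0 normr0 mul0r mulr_ge0 ?exprn_ge0 ?divr_ge0 ?mulr_ge0 // ltW.
rewrite fps_XMS !exprS.
have -> : C * m / t * (t * t ^+ n) = m * (C * t ^+ n).
  by field; rewrite gt_eqF.
by rewrite mulrCA ler_wpM2l ?(ltW m0).
Qed.

Lemma geometric_bound_weaken t t' C f : 0 <= t -> t <= t' -> geometric_bound m t C f ->
  geometric_bound m t' C f.
Proof.
move=> t0 tt' hf n; apply: le_trans (hf n) _.
have C0 : 0 <= C by have := hf 0%N; rewrite !expr0 !mulr1; apply: le_trans.
by rewrite ler_wpM2l // lerXn2r // nnegrE // (le_trans t0).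
Qed.

Lemma geometric_boundM t C C' f g : 0 <= t < 1 ->
  geometric_bound m (t ^+ 2) C f -> geometric_bound m (t ^+ 2) C' g ->
  geometric_bound m t (C * C' / (1 - t)) (f * g).
Proof.
move=> t01 hf hg n; have /andP[t0 t1] := t01.
have C0 : 0 <= C by have := hf 0%N; rewrite !expr0 !mulr1; apply: le_trans.
have C'0 : 0 <= C' by have := hg 0%N; rewrite !expr0 !mulr1; apply: le_trans.
rewrite fpsME; apply: (@le_trans _ _ (\sum_(i < n.+1) C * C' * (t ^+ 2) ^+ n)).
  apply: (@le_trans _ _ ((\sum_(i < n.+1) `|f i * g (n - i)%N|) * m ^+ n)).
    by rewrite ler_wpM2r ?ler_norm_sum // exprn_ge0 // ltW.
  rewrite mulr_suml; apply: ler_sum => i _.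
  have : (i <= n)%N by rewrite -ltnS.
  move: (nat_of_ord i) => j jn; rewrite -{2 3}(subnKC jn).
  rewrite !exprD normrM mulrACA [C * C' * _]mulrACA.
  by rewrite ler_pM // mulr_ge0 // exprn_ge0 // ltW.
rewrite sumr_const card_ord -mulr_natl.
have -> : n.+1%:R * (C * C' * (t ^+ 2) ^+ n) =
   C * C' * (n.+1%:R * t ^+ n) * t ^+ n.
  rewrite expr2 exprMn; ring.
rewrite ler_wpM2r ?exprn_ge0 //.
by rewrite ler_wpM2l ?mulr_ge0 // mulSn_expr_le.
Qed.

(** Multiplicativity without rearranging double series: the defect D j for the
    j-th shift of f satisfies D j = s D (j + 1), so that D 0 = s^j D j, and this
    tends to 0. *)
Lemma fps_evalM t C C' f g s : 0 < t < 1 -> `|s| <= m ->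
  geometric_bound m (t ^+ 2) C f -> geometric_bound m (t ^+ 2) C' g ->
  fps_eval s (f * g) = fps_eval s f * fps_eval s g.
Proof.
move=> /andP[t0 t1] sm hf hg.
have t01 : 0 <= t < 1 by rewrite ltW.
have tt01 : 0 <= t ^+ 2 < 1 by rewrite sqr_ge0 expr_lt1 // ltW.
have tt0 : 0 < t ^+ 2 by rewrite exprn_gt0.
pose F j := iter j (@fps_shift R) f.
pose D j := fps_eval s (F j * g) - fps_eval s (F j) * fps_eval s g.
have hF j := geometric_bound_iter_shift j hf.
have DS j : D j = s * D j.+1.
  rewrite /D [F j]fps_decomp -/(F j.+1).
  set c := F j 0%N.
  have h1 := geometric_boundM t01 (hF j.+1) hg.
  have h2 : geometric_bound m t C' g.
    by apply: geometric_bound_weaken hg; [exact: ltW|rewrite ler_piMr // ltW].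
  rewrite mulrDl -mulrA.
  rewrite (fps_evalD t01 sm (geometric_boundZ c h2) (geometric_boundX t0 h1)).
  rewrite (fps_evalD tt01 sm (geometric_boundC c tt0) (geometric_boundX tt0 (hF j.+1))).
  rewrite (fps_evalZ t01 sm _ h2) (fps_evalX t01 sm h1).
  rewrite (fps_evalX tt01 sm (hF j.+1)) fps_evalC.
  ring.
have DN j : D 0%N = s ^+ j * D j.
  by elim: j => [|j ->]; rewrite ?mul1r // exprSr -mulrA -DS.
have C0 : 0 <= C by have := hf 0%N; rewrite !expr0 !mulr1; apply: le_trans.
have [B hB] : exists B, forall j, `|D 0%N| <= B * (t ^+ 2) ^+ j.
  pose B1 := C' / (1 - t) / (1 - t); pose B2 := (1 - t ^+ 2)^-1 * `|fps_eval s g|.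
  exists (C * (B1 + B2)) => j.
  have h1 := fps_eval_norm_le t01 sm (geometric_boundM t01 (hF j) hg).
  have h2 := fps_eval_norm_le tt01 sm (hF j).
  have h3 : `|D j| <= C * (t ^+ 2 / m) ^+ j * (B1 + B2).
    rewrite /D (le_trans (ler_normB _ _)) // mulrDr normrM lerD //.
      by rewrite (le_trans h1) // /B1 !mulrA.
    by rewrite /B2 mulrA ler_wpM2r.
  rewrite (DN j) normrM normrX (le_trans (ler_wpM2l _ h3)) ?exprn_ge0 //.
  have -> : C * (B1 + B2) * (t ^+ 2) ^+ j =
    m ^+ j * (C * (t ^+ 2 / m) ^+ j * (B1 + B2)).
    rewrite expr_div_n; field; by rewrite expf_neq0 // gt_eqF.
  rewrite ler_wpM2r ?(le_trans _ h3) //.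
  by rewrite lerXn2r // nnegrE ltW.
apply/eqP; rewrite -subr_eq0 -/(D 0%N) -normr_le0 leNgt; apply/negP => pos.
have [N hN] := geometric_small B tt01 pos.
by have := le_lt_trans (hB N) (hN N (leqnn _)); rewrite ltxx.
Qed.

Lemma expr_lipschitz s s' n : `|s| <= m -> `|s'| <= m ->
  m * `|s ^+ n - s' ^+ n| <= `|s - s'| * (n%:R * m ^+ n).
Proof.
move=> sm s'm; rewrite subrXX normrM mulrCA ler_wpM2l //.
case: n => [|n]; first by rewrite big_ord0 normr0 mulr0 mul0r.
rewrite exprS mulrCA ler_wpM2l ?(ltW m0) //.
apply: le_trans (ler_norm_sum _ _ _) _.
rewrite mulr_natl -[n.+1 in leRHS]card_ord -sumr_const; apply: ler_sum => i _.
have : (i <= n)%N by rewrite -ltnS.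
move: (nat_of_ord i) => j jn; rewrite -[in leRHS](subnK jn) exprD normrM !normrX /=.
by rewrite ler_pM // ?exprn_ge0 // lerXn2r // nnegrE ltW.
Qed.

Lemma fps_eval_lipschitz t C f s s' : 0 < t < 1 ->
  geometric_bound m (t ^+ 2) C f -> `|s| <= m -> `|s'| <= m ->
  `|fps_eval s f - fps_eval s' f| <= C / (1 - t) / (1 - t) / m * `|s - s'|.
Proof.
move=> /andP[t0 t1] hf sm s'm.
have t01 : 0 <= t < 1 by rewrite ltW.
have tt01 : 0 <= t ^+ 2 < 1 by rewrite sqr_ge0 expr_lt1 // ltW.
have C0 : 0 <= C by have := hf 0%N; rewrite !expr0 !mulr1; apply: le_trans.
have c1 := geometric_bound_cvg tt01 sm hf.
have c2 := geometric_bound_cvg tt01 s'm hf.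
rewrite /fps_eval -limB // -lim_norm; last exact: is_cvgB.
apply: limr_le; first by apply: is_cvg_norm; exact: is_cvgB.
apply: nearW => n; rewrite fctE /series -sumrB (le_trans (ler_norm_sum _ _ _)) //.
rewrite big_mkord.
apply: (@le_trans _ _ (\sum_(i < n) (C / (1 - t) / m * `|s - s'|) * t ^+ i)).
  apply: ler_sum => i _; rewrite -mulrBr normrM.
  set k := nat_of_ord i.
  have h1 := expr_lipschitz k sm s'm.
  have h2 : `|f k| * `|s ^+ k - s' ^+ k| * m <= `|s - s'| * (k%:R * (C * (t ^+ 2) ^+ k)).
    rewrite -mulrA [_ * m]mulrC (le_trans (ler_wpM2l _ h1)) //.
    rewrite mulrCA ler_wpM2l // mulrCA ler_wpM2l //; exact: hf.
  have h3 : k%:R * t ^+ k <= (1 - t)^-1.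
    apply: le_trans (mulSn_expr_le k t01); rewrite ler_wpM2r ?exprn_ge0 ?(ltW t0) //.
    by rewrite ler_nat.
  rewrite -(ler_pM2r m0) (le_trans h2) //.
  have -> : C / (1 - t) / m * `|s - s'| * t ^+ k * m = `|s - s'| * (C * t ^+ k / (1 - t)).
    by field; apply/andP; split; rewrite gt_eqF // subr_gt0.
  rewrite ler_wpM2l // exprAC expr2.
  have -> : k%:R * (C * (t ^+ k * t ^+ k)) = C * t ^+ k * (k%:R * t ^+ k) by ring.
  by rewrite ler_wpM2l // mulr_ge0 // exprn_ge0 // ltW.
rewrite -mulr_sumr.
have -> : C / (1 - t) / (1 - t) / m * `|s - s'| = C / (1 - t) / m * `|s - s'| * (1 - t)^-1.
  by ring.
rewrite ler_wpM2l ?geometric_sum_le // !mulr_ge0 // ?invr_ge0 ?(ltW m0) //.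
by rewrite subr_ge0 ltW.
Qed.

Lemma fps_eval_continuous t C f : 0 < t < 1 ->
  geometric_bound m (t ^+ 2) C f ->
  {within `[- m, m], continuous (fun s => fps_eval s f)}.
Proof.
move=> t01 hf; apply/subspace_continuousP => s /=.
rewrite in_itv /= -ler_norml => sm.
pose L := `|C / (1 - t) / (1 - t) / m| + 1.
have L0 : 0 < L by rewrite ltr_wpDl.
apply/cvgrPdist_lt => e e0; rewrite near_withinE.
apply/nbhs_ballP; exists (e / L); first by rewrite /= divr_gt0.
move=> s' /= ss'; rewrite in_itv /= -ler_norml => s'm.
apply: le_lt_trans (fps_eval_lipschitz t01 hf sm s'm) _.
apply: (@le_lt_trans _ _ (L * `|s - s'|)).
  by rewrite ler_wpM2r // /L (le_trans (ler_norm _)) // lerDl.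
by rewrite mulrC -ltr_pdivlMr.
Qed.

End Evaluation.

(** * Position of the spectrum of X *)
Section Discriminant.
Variables (R : realType) (m t : R).
Hypotheses (m0 : 0 < m) (t01 : 0 < t < 1).
Implicit Types (f g : fps R) (s l : R).

Definition evaluates s f l : Prop :=
  (exists C, geometric_bound m t C f) /\ fps_eval s f = l.

Let t0 : 0 < t. Proof. by case/andP: t01. Qed.
Let t01' : 0 <= t < 1. Proof. by case/andP: t01 => /ltW -> ->. Qed.

Lemma evaluatesD s f g l l' : `|s| <= m ->
  evaluates s f l -> evaluates s g l' -> evaluates s (f + g) (l + l').
Proof.
move=> sm [[C hf] <-] [[C' hg] <-]; split; last exact: (fps_evalD m0 t01' sm hf hg).
by exists (C + C'); exact: geometric_boundD.
Qed.

Lemma evaluatesZ s c f l : `|s| <= m ->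
  evaluates s f l -> evaluates s (fps_C c * f) (c * l).
Proof.
move=> sm [[C hf] <-]; split; last exact: (fps_evalZ m0 t01' sm c hf).
by exists (`|c| * C); exact: geometric_boundZ.
Qed.

Lemma evaluatesX s f l : `|s| <= m ->
  evaluates s f l -> evaluates s (fps_X * f) (s * l).
Proof.
move=> sm [[C hf] <-]; split; last exact: (fps_evalX m0 t01' sm hf).
by exists (C * m / t); exact: geometric_boundX.
Qed.

Lemma evaluatesC s c : evaluates s (fps_C c) c.
Proof.
split; last exact: fps_evalC.
by exists `|c|; exact: geometric_boundC.
Qed.

Lemma evaluates_affine s M f l : `|s| <= m -> evaluates s f l ->
  evaluates s ((1 + fps_C M * fps_X) * f) ((1 + M * s) * l).
Proof.
move=> sm hf; rewrite !mulrDl !mul1r -!mulrA; apply: evaluatesD => //.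
by apply: evaluatesZ => //; exact: evaluatesX.
Qed.

Lemma shifted_equation_eval (kap q k' cs d M C s : R) (x : fps R) : `|s| <= m ->
  geometric_bound m (t ^+ 2) C x ->
  shifted_equation (fps_C kap) (fps_C q) (fps_C k') (fps_C cs) (fps_C d) fps_X (fps_C M) x = 0 ->
  shifted_equation kap q k' cs d s M (fps_eval s x) = 0.
Proof.
move=> sm hx eqn; set e := fps_eval s x.
have ex : evaluates s x e.
  split=> //; exists C; apply: geometric_bound_weaken hx; first by rewrite sqr_ge0.
  by rewrite ler_piMr ?(ltW t0) //; case/andP: t01 => _ /ltW.
have ex2 : evaluates s (x * x) (e * e).
  split; last exact: (fps_evalM m0 t01 sm hx hx).
  by exists (C * C / (1 - t)); exact: geometric_boundM.
pose h := 1 + fps_C M * @fps_X R; pose u := @fps_X R.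
pose T1 := fps_C kap * (u * (h * (h * (x * x)))).
pose T2 := fps_C (- q) * (h * (h * x)).
pose T3 := fps_C (- k') * (u * (h * x)).
pose T4 := fps_C q * (h * fps_C 1).
pose T5 := fps_C cs * (u * fps_C 1).
pose T6 := fps_C d * (u * (u * x)).
have TE : T1 + T2 + T3 + T4 + T5 + T6 = 0.
  rewrite -eqn /shifted_equation /T1 /T2 /T3 /T4 /T5 /T6 !rmorphN rmorph1 -/h -/u; ring.
have h1 : evaluates s T1 (kap * (s * ((1 + M * s) * ((1 + M * s) * (e * e))))).
  by apply: evaluatesZ => //; apply: evaluatesX => //; do 2 apply: evaluates_affine => //.
have h2 : evaluates s T2 (- q * ((1 + M * s) * ((1 + M * s) * e))).
  by apply: evaluatesZ => //; do 2 apply: evaluates_affine => //.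
have h3 : evaluates s T3 (- k' * (s * ((1 + M * s) * e))).
  by apply: evaluatesZ => //; apply: evaluatesX => //; apply: evaluates_affine.
have h4 : evaluates s T4 (q * ((1 + M * s) * 1)).
  by apply: evaluatesZ => //; apply: evaluates_affine => //; exact: evaluatesC.
have h5 : evaluates s T5 (cs * (s * 1)).
  by apply: evaluatesZ => //; apply: evaluatesX => //; exact: evaluatesC.
have h6 : evaluates s T6 (d * (s * (s * e))).
  by apply: evaluatesZ => //; do 2 apply: evaluatesX => //.
have [_] := evaluatesD sm (evaluatesD sm (evaluatesD sm (evaluatesD sm
  (evaluatesD sm h1 h2) h3) h4) h5) h6.
have -> : (0 : R) = fps_eval s (fps_C 0) by rewrite fps_evalC.
rewrite TE -(rmorph0 (@fps_C R)) => ->; rewrite /shifted_equation; ring.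
Qed.

End Discriminant.

(** For w <= 0 the point s = 1 / (w - M) lies in the disc of convergence of the
    moments about M, where 1 + M s = s w, and D w is the square of F s up to the
    factor s^4, F being the derivative of the quadratic at the solution. As
    F 0 = - q < 0 < F (- 1 / M), there is a zero of F strictly between. *)
Lemma discriminant_root_ge0 (R : realType) (kap q k' cs d M t C : R) (x : fps R) :
  0 < kap -> 0 < q -> 0 < d -> 0 < M -> 0 < t < 1 ->
  geometric_bound M^-1 (t ^+ 2) C x ->
  shifted_equation (fps_C kap) (fps_C q) (fps_C k') (fps_C cs) (fps_C d) fps_X (fps_C M) x = 0 ->
  let D w := (q * w ^+ 2 + k' * w - d) ^+ 2 - 4 * kap * w ^+ 2 * (q * w + cs) in
  (exists2 r, 0 < r & D (- r) = 0) /\ (forall w, w <= 0 -> 0 <= D w).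
Proof.
move=> kap0 q0 d0 M0 t01 hx eqn D.
have m0 : 0 < M^-1 by rewrite invr_gt0.
pose e s := fps_eval s x.
pose F s := 2 * kap * s * (1 + M * s) ^+ 2 * e s -
  (q * (1 + M * s) ^+ 2 + k' * s * (1 + M * s) - d * s ^+ 2).
have FE s w : `|s| <= M^-1 -> 1 + M * s = s * w -> F s ^+ 2 = s ^+ 4 * D w.
  move=> sm hw; have := shifted_equation_eval m0 t01 sm hx eqn.
  rewrite -/(e s) /F /D /shifted_equation hw => h.
  transitivity (4 * kap * s * (s * w) ^+ 2 * (kap * s * e s ^+ 2 * (s * w) ^+ 2 - q * e s * (s * w) ^+ 2 -
     k' * s * e s * (s * w) + q * (s * w) + cs * s + d * s ^+ 2 * e s) +
     ((q * (s * w) ^+ 2 + k' * s * (s * w) - d * s ^+ 2) ^+ 2 -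
      4 * kap * s * (s * w) ^+ 2 * (q * (s * w) + cs * s))).
    ring.
  rewrite h; ring.
split; last first.
  move=> w w0; pose s := (w - M)^-1.
  have wM : w - M < 0 by lra.
  have s0 : s < 0 by rewrite invr_lt0.
  have sw : 1 + M * s = s * w.
    by rewrite /s; field; rewrite lt_eqF.
  have sm : `|s| <= M^-1.
    by rewrite ltr0_norm // /s -invrN lef_pV2 ?posrE //; lra.
  have h := FE _ _ sm sw.
  have : 0 <= s ^+ 4 * D w by rewrite -h sqr_ge0.
  by rewrite pmulr_rge0 // exprn_even_gt0 //= lt_eqF.
have cF : {within `[- M^-1, 0], continuous F}.
  have cid : {within `[- M^-1, 0], continuous (@id R)}.
    by apply: continuous_subspaceT => z; exact: cvg_id.
  have ce : {within `[- M^-1, 0], continuous e}.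
    apply: continuous_subspaceW (fps_eval_continuous m0 t01 hx).
    by apply: subset_itvl; rewrite bnd_simp ltW.
  have c1 : {within `[- M^-1, 0], continuous (fun s : R => 2 * kap * s * (1 + M * s) ^+ 2)}.
    apply: continuous_subspaceT => z; rewrite /continuous_at.
    under eq_fun do rewrite expr2; rewrite expr2.
    by repeat first [exact: cvg_cst | exact: cvg_id | apply: cvgD | apply: cvgM | apply: cvgN].
  have c2 : {within `[- M^-1, 0], continuous
      (fun s : R => q * (1 + M * s) ^+ 2 + k' * s * (1 + M * s) - d * s ^+ 2)}.
    apply: continuous_subspaceT => z; rewrite /continuous_at.
    under eq_fun do rewrite !expr2; rewrite !expr2.
    by repeat first [exact: cvg_cst | exact: cvg_id | apply: cvgD | apply: cvgM | apply: cvgN].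
  rewrite /F => z; apply: cvgB; last exact: c2.
  by apply: cvgM; [exact: c1|exact: ce].
have F0 : F 0 = - q by rewrite /F; ring.
have Fm : F (- M^-1) = d * M^-1 ^+ 2.
  have hM : 1 + M * - M^-1 = 0 by rewrite mulrN divff ?gt_eqF // subrr.
  by rewrite /F hM; ring.
have dM0 : 0 < d * M^-1 ^+ 2 by rewrite mulr_gt0 // exprn_gt0.
have M10 : - M^-1 <= 0 by rewrite oppr_le0 ltW.
have [|s s_in Fs] := @IVT R F (- M^-1) 0 0 M10 cF.
  by rewrite F0 Fm ge_min le_max oppr_le0 (ltW q0) (ltW dM0) orbT.
move: s_in; rewrite in_itv /= => /andP[s1 s2].
have s_neq0 : s != 0.
  by apply/eqP => e0; move: Fs; rewrite e0 F0; lra.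
have s_neqm : s != - M^-1.
  by apply/eqP => e0; move: Fs; rewrite e0 Fm; lra.
have s0 : s < 0 by rewrite lt_neqAle s_neq0.
have sm : - M^-1 < s by rewrite lt_neqAle eq_sym s_neqm.
pose w := M + s^-1.
have Ms : -1 < M * s by rewrite -ltr_pdivrMl // mulrN1.
have sw : 1 + M * s = s * w by rewrite /w mulrDr divff // addrC mulrC.
have w0 : w < 0.
  have : 0 < s * w by rewrite -sw; lra.
  by rewrite nmulr_rgt0.
exists (- w); first by rewrite oppr_gt0.
rewrite opprK; have sn : `|s| <= M^-1 by rewrite ler_norml s1 /= (le_trans s2) // ltW.
have := FE _ _ sn sw; rewrite Fs expr0n /= => /esym/eqP.
by rewrite mulf_eq0 expf_eq0 /= (negPf s_neq0) => /eqP.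
Qed.

(** A function that does not change sign at a zero has no linear term there. Here
    e is the distance to the double root of the discriminant. *)
Lemma linear_coef_eq0 (R : realType) (r c1 c2 c3 c4 : R) : 0 < r ->
  (forall e, e <= r -> 0 <= e * (c1 + e * (c2 + e * (c3 + e * c4)))) -> c1 = 0.
Proof.
move=> r0 h.
pose K := `|c2| + `|c3| + `|c4| + 1.
have K0 : 0 < K by rewrite ltr_wpDl // !addr_ge0.
have bound e : `|e| <= 1 -> `|e * (c2 + e * (c3 + e * c4))| <= `|e| * K.
  move=> e1; rewrite normrM ler_wpM2l //.
  have h1 : `|c3 + e * c4| <= `|c3| + `|c4|.
    by rewrite (le_trans (ler_normD _ _)) // lerD2l normrM ler_piMl.
  have h2 : `|c2 + e * (c3 + e * c4)| <= `|c2| + (`|c3| + `|c4|).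
    by rewrite (le_trans (ler_normD _ _)) // lerD2l (le_trans _ h1) // normrM ler_piMl.
  by rewrite (le_trans h2) // /K; lra.
apply/eqP; apply/negPn/negP => c10.
have c1n : 0 < `|c1| by rewrite normr_gt0.
pose e := Num.min r (Num.min 1 (`|c1| / (2 * K))).
have e0 : 0 < e by rewrite !lt_min r0 ltr01 divr_gt0 // mulr_gt0.
have er : e <= r by rewrite ge_min lexx.
have e1 : e <= 1 by rewrite !ge_min lexx orbT.
have eK : e * K <= `|c1| / 2.
  have : e <= `|c1| / (2 * K) by rewrite !ge_min lexx !orbT.
  by rewrite ler_pdivlMr ?mulr_gt0 // => h'; rewrite ler_pdivlMr //; lra.
have [c1p|c1m] := ltP 0 c1.
- have := h (- e); have -> : - e <= r by lra.
  move=> /(_ isT); have := bound (- e); rewrite normrN (gtr0_norm e0) => /(_ e1).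
  rewrite (gtr0_norm c1p) in eK; set G := (- e) * (c2 + _) => hG.
  rewrite nmulr_rge0 ?oppr_lt0 //; have := ler_norm (- G); rewrite normrN; lra.
- have c1m' : c1 < 0 by rewrite lt_neqAle c10.
  have := h e er; have := bound e; rewrite (gtr0_norm e0) => /(_ e1).
  rewrite (ltr0_norm c1m') in eK; set G := e * (c2 + _) => hG.
  rewrite pmulr_rge0 //; have := ler_norm G; lra.
Qed.

(** The parameters lam and be are replaced by rho and gam, which turn out to be
    (a + b) / 2 and sqrt (a b). The root -r determines v, and then
    D w = al^2 (w + r)^2 (w^2 - 2 rho w + gam^2) + 2 al key w (w + r). As -r is a
    double root, key = 0; with the definitions of rho and gam, this is the system
    for the endpoints. It forces gam < rho, so that a and b are real. *)
Lemma gig_endpoints (R : realType) (lam al be v r : R) : 0 < al -> 0 < be -> 0 < r ->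
  let D w := (al * w ^+ 2 + (1 + lam) * w - be) ^+ 2 - 4 * w ^+ 2 * (al * w + v) in
  D (- r) = 0 -> (forall w, w <= 0 -> 0 <= D w) ->
  exists a b, free_gig_endpoints (- lam) al be a b /\
    forall w, D w = (al * w + be / Num.sqrt (a * b)) ^+ 2 * ((w - a) * (w - b)).
Proof.
move=> al0 be0 r0 D Dr Dge.
pose rho := r - (lam - 1) / al; pose gam := be / (al * r).
have alr0 : 0 < al * r by rewrite mulr_gt0.
have gam0 : 0 < gam by rewrite divr_gt0.
have lamE : lam = 1 + al * (r - rho) by rewrite /rho; field; rewrite gt_eqF.
have beE : be = al * r * gam by rewrite /gam; field; apply/andP; split; rewrite gt_eqF.
clearbody rho gam; subst lam be.
pose P := al * (rho - gam) - 2.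
have vE : v = al * r + P ^+ 2 / 4.
  have e : D (- r) = 4 * r ^+ 2 * (al * r + P ^+ 2 / 4 - v) by rewrite /D /P; field.
  move: Dr; rewrite e => /eqP; rewrite mulf_eq0 gt_eqF ?mulr_gt0 ?exprn_gt0 //=.
  by rewrite subr_eq0 => /eqP.
pose key := al * (rho - gam) * (r + gam) - 2 * gam.
have DE w : D w = (al * w + al * r) ^+ 2 * (w ^+ 2 - 2 * rho * w + gam ^+ 2) +
    2 * al * key * w * (w + r).
  by rewrite /D vE /P /key; field.
have key0 : key = 0.
  have : - (2 * al * r * key) = 0.
    apply: (@linear_coef_eq0 R r _ (2 * al * key + al ^+ 2 * (r ^+ 2 + 2 * rho * r + gam ^+ 2))
      (- (2 * al ^+ 2 * (r + rho))) (al ^+ 2) r0) => e er.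
    have : 0 <= D (e - r) by apply: Dge; lra.
    rewrite DE; congr (0 <= _); ring.
  move=> /eqP; rewrite oppr_eq0 mulf_eq0 gt_eqF ?mulr_gt0 //= => /eqP.
  by [].
have keyE : al * (rho - gam) * (r + gam) = 2 * gam.
  by apply/eqP; rewrite -subr_eq0; apply/eqP.
have rhogam : gam < rho.
  have : 0 < al * (rho - gam) * (r + gam) by rewrite keyE mulr_gt0.
  by rewrite pmulr_lgt0 ?addr_gt0 // pmulr_rgt0 // subr_gt0.
have rho0 : 0 < rho by apply: lt_trans rhogam.
pose del := Num.sqrt (rho ^+ 2 - gam ^+ 2).
have del2 : del ^+ 2 = rho ^+ 2 - gam ^+ 2.
  by rewrite sqr_sqrtr // subr_ge0 lerXn2r // ?nnegrE ?(ltW gam0) ?(ltW rho0) // ltW.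
have del0 : 0 < del.
  by rewrite sqrtr_gt0 subr_gt0 ltr_pXn2r // ?nnegrE ltW.
have delrho : del < rho.
  rewrite -(ltr_pXn2r (n:=2)) // ?nnegrE ?(ltW del0) ?(ltW rho0) // del2.
  by rewrite ltrBlDr ltrDl exprn_gt0.
have abE : (rho - del) * (rho + del) = gam ^+ 2.
  by rewrite -subr_sqr del2; ring.
have sab : Num.sqrt ((rho - del) * (rho + del)) = gam.
  by rewrite abE sqrtr_sqr gtr0_norm.
exists (rho - del), (rho + del); split.
  split.
  - by rewrite subr_gt0.
  - lra.
  - have -> : 2 * (rho - del) * (rho + del) = 2 * gam ^+ 2 by rewrite -abE; ring.
    rewrite sab.
    have -> : rho - del + (rho + del) = 2 * rho by ring.
    transitivity (- (key / gam)); last by rewrite key0 mul0r oppr0.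
    by rewrite /key; field; rewrite gt_eqF.
  - rewrite sab.
    have -> : rho - del + (rho + del) = 2 * rho by ring.
    by field; rewrite gt_eqF.
move=> w; rewrite sab mulfK ?gt_eqF //.
have -> : (w - (rho - del)) * (w - (rho + del)) = w ^+ 2 - 2 * rho * w + gam ^+ 2.
  rewrite -abE; ring.
by rewrite DE key0 mulr0 !mul0r addr0.
Qed.

(** * Integrals of the square root on a segment *)

(** Stated pointwise, the rules of differentiation unify with explicit expressions
    in the variable. *)
Section DeriveRules.
Variable R : realType.
Implicit Types (f g : R -> R) (x df dg : R).

Lemma is_derive_fun_add f g x df dg : is_derive x 1 f df -> is_derive x 1 g dg ->
  is_derive x 1 (fun y => f y + g y) (df + dg).
Proof. by move=> hf hg; exact: is_deriveD. Qed.

Lemma is_derive_fun_opp f x df : is_derive x 1 f df ->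
  is_derive x 1 (fun y => - f y) (- df).
Proof. by move=> hf; exact: is_deriveN. Qed.

Lemma is_derive_fun_id x : is_derive x 1 (fun y : R => y) 1.
Proof. exact: is_derive_id. Qed.

Lemma is_derive_fun_cst (c : R) x : is_derive x 1 (fun _ : R => c) 0.
Proof. exact: is_derive_cst. Qed.

Lemma is_derive_fun_mul f g x df dg : is_derive x 1 f df -> is_derive x 1 g dg ->
  is_derive x 1 (fun y => f y * g y) (df * g x + f x * dg).
Proof.
move=> hf hg; apply: (is_derive_eq (is_deriveM hf hg)).
by rewrite addrC /GRing.scale /= [g x * _]mulrC.
Qed.

Lemma is_derive_fun_exp n x : is_derive x 1 (fun y : R => y ^+ n) (n%:R * x ^+ n.-1).
Proof.
have := is_deriveX n (is_derive_id x (1 : R)); rewrite exprfctE => h.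
apply: (is_derive_eq h).
by rewrite /GRing.scale /= mulr1.
Qed.

Lemma is_derive_fun_inv f x df : f x != 0 -> is_derive x 1 f df ->
  is_derive x 1 (fun y => (f y)^-1) (- df / f x ^+ 2).
Proof.
move=> fx0 hf; apply: (is_derive_eq (is_deriveV fx0 hf)).
by rewrite /GRing.scale /= mulNr mulrC -mulNr.
Qed.

Lemma is_derive_fun_comp f g x df dg : is_derive (g x) 1 f df -> is_derive x 1 g dg ->
  is_derive x 1 (fun y => f (g y)) (df * dg).
Proof. by move=> hf hg; apply: (is_derive_eq (is_derive1_comp hf hg)). Qed.

End DeriveRules.

Local Notation dAdd := is_derive_fun_add.
Local Notation dMul := is_derive_fun_mul.
Local Notation dOpp := is_derive_fun_opp.
Local Notation dId := is_derive_fun_id.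
Local Notation dCst := is_derive_fun_cst.
Local Notation dInv := is_derive_fun_inv.
Local Notation dComp := is_derive_fun_comp (only parsing).

(** Convergence of asin up to the endpoints of its domain, where it is not
    differentiable: it is the continuous inverse of sin on a compact segment. *)
Lemma asin_cvg (R : realType) (T : Type) (F : set_system T) (f : T -> R) (l : R) :
  Filter F -> -1 <= l <= 1 -> (\forall x \near F, -1 <= f x <= 1) ->
  f x @[x --> F] --> l -> asin (f x) @[x --> F] --> asin l.
Proof.
move=> FF hl hf fl.
have ca : {within `[-1, 1], continuous (@asin R)}.
  have := @segment_can_le_continuous R (- (pi / 2)) (pi / 2) (@sin R) (@asin R).
  rewrite sinN sin_pihalf; apply.
  - by have := pi_gt0 R; lra.
  - by apply: continuous_subspaceT; exact: continuous_sin.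
  - exact: sinK.
move/subspace_continuousP: ca => /(_ l); rewrite /= in_itv /= => /(_ hl) ca.
apply: cvg_comp ca => A; rewrite nbhs_simpl /within /= => hA.
have := fl _ hA; rewrite nbhs_simpl /=.
apply: filterS2 hf => x hx; apply; by rewrite /= in_itv.
Qed.

Section Integrals.
Variables (R : realType) (a b : R).
Hypotheses (a0 : 0 < a) (ab : a < b).
Local Notation leb := (@lebesgue_measure R).

Definition segment_integral (f : R -> R) : R := \int[leb]_(x in `[a, b]) f x.

Lemma segment_FTC (f F : R -> R) :
  {in `[a, b]%R, continuous f} ->
  (forall x, a < x < b -> is_derive x 1 F (f x)) ->
  F x @[x --> a^'+] --> F a -> F x @[x --> b^'-] --> F b ->
  segment_integral f = F b - F a.
Proof.
move=> cf dF Fa Fb; rewrite /segment_integral /Rintegral.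
rewrite (@continuous_FTC2 R f F) //.
- apply: continuous_in_subspaceT => x; rewrite inE; exact: cf.
- split => // x; rewrite in_itv => /dF h; exact: ex_derive.
- by move=> x; rewrite in_itv => /dF h; rewrite derive1E derive_val.
Qed.

Let rho : R := (a + b) / 2.
Let del : R := (b - a) / 2.
Let g : R := Num.sqrt (a * b).
Let P (x : R) : R := (x - a) * (b - x).
Let s (x : R) : R := Num.sqrt (P x).

Let b0 : 0 < b. Proof. exact: lt_trans ab. Qed.
Let del0 : 0 < del. Proof. by rewrite divr_gt0 // subr_gt0. Qed.
Let g0 : 0 < g. Proof. by rewrite sqrtr_gt0 mulr_gt0. Qed.
Let g2 : g ^+ 2 = a * b. Proof. by rewrite sqr_sqrtr // mulr_ge0 // ltW. Qed.
Let P_gt0 x : a < x < b -> 0 < P x.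
Proof. by move=> /andP[h1 h2]; rewrite mulr_gt0 // subr_gt0. Qed.
Let s_gt0 x : a < x < b -> 0 < s x.
Proof. by move=> /P_gt0 h; rewrite sqrtr_gt0. Qed.
Let s2 x : a < x < b -> s x ^+ 2 = P x.
Proof. by move=> /P_gt0 h; rewrite sqr_sqrtr // ltW. Qed.

Let dP (x : R) : is_derive x 1 P (2 * (rho - x)).
Proof.
apply: (is_derive_eq (dMul (dAdd (dId x) (dCst (- a) x))
  (dAdd (dCst b x) (dOpp (dId x))))).
by rewrite /rho /=; field.
Qed.

Let ds (x : R) : a < x < b -> is_derive x 1 s ((rho - x) / s x).
Proof.
move=> h; have hs := s_gt0 h.
apply: (is_derive_eq (dComp (is_derive1_sqrt (P_gt0 h)) (dP x))).
by rewrite -/(s x); field; rewrite gt_eqF.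
Qed.

(** The derivatives of the two arcsines are 1 / s and sqrt (a b) / (x s);
    antiderivatives of s / x and of s are combinations of them and of s. *)
Let th1 (x : R) : R := asin ((x - rho) / del).
Let th2 (x : R) : R := asin ((rho * x - a * b) / (del * x)).

Let range1 (x : R) : a < x < b -> -1 < (x - rho) / del < 1.
Proof.
move=> /andP[h1 h2].
rewrite ltr_pdivlMr // ltr_pdivrMr // mulN1r mul1r /rho /del.
by apply/andP; split; lra.
Qed.

Let dth1 (x : R) : a < x < b -> is_derive x 1 th1 (s x)^-1.
Proof.
move=> h; have hs := s_gt0 h.
have h1s : 1 - ((x - rho) / del) ^+ 2 = (s x / del) ^+ 2.
  by rewrite [RHS]expr_div_n s2 // /P /del /rho; field; rewrite gt_eqF ?subr_gt0.
have h2s := range1 h.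
apply: (is_derive_eq (@is_derive_fun_comp _ (@asin R) (fun y => (y - rho) / del) x _ _
  (is_derive1_asin h2s) (dMul (dAdd (dId x) (dCst (- rho) x)) (dCst del^-1 x)))).
have sd0 : 0 < s x / del by exact: divr_gt0.
rewrite h1s sqrtr_sqr (gtr0_norm sd0).
by field; rewrite !gt_eqF.
Qed.

Let cos2 (x : R) : a < x < b ->
  1 - ((rho * x - a * b) / (del * x)) ^+ 2 = (g * s x / (del * x)) ^+ 2.
Proof.
move=> h; have /andP[h1 h2] := h.
have x0 : 0 < x by apply: lt_trans h1.
rewrite [RHS]expr_div_n [(g * s x) ^+ 2]exprMn s2 // g2 /P /del /rho; field.
by rewrite !gt_eqF ?subr_gt0.
Qed.

Let cos2_gt0 (x : R) : a < x < b -> 0 < g * s x / (del * x).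
Proof.
move=> h; have hs := s_gt0 h; have /andP[h1 h2] := h.
by rewrite divr_gt0 // mulr_gt0 //; apply: lt_trans h1.
Qed.

Let range2 (x : R) : a < x < b -> -1 < (rho * x - a * b) / (del * x) < 1.
Proof.
move=> h.
rewrite -ltr_norml -(ltr_pXn2r (n:=2)) ?nnegrE // expr1n -normrX ger0_norm ?sqr_ge0 //.
by rewrite -subr_gt0 cos2 // exprn_gt0 // cos2_gt0.
Qed.

Let dth2 (x : R) : a < x < b -> is_derive x 1 th2 (g / (x * s x)).
Proof.
move=> h; have hs := s_gt0 h; have /andP[h1 h2] := h.
have x0 : 0 < x by apply: lt_trans h1.
have dx0 : del * x != 0 by rewrite gt_eqF // mulr_gt0.
apply: (is_derive_eq (@is_derive_fun_comp _ (@asin R)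
  (fun y => (rho * y - a * b) / (del * y)) x _ _
  (is_derive1_asin (range2 h)) (dMul (dAdd (dMul (dCst rho x) (dId x)) (dCst (- (a * b)) x))
    (dInv dx0 (dMul (dCst del x) (dId x)))))).
rewrite cos2 // sqrtr_sqr (gtr0_norm (cos2_gt0 h)).
have -> : g / (x * s x) = a * b / (g * x * s x).
  by rewrite -g2; field; rewrite !gt_eqF.
by field; rewrite !gt_eqF.
Qed.

Let P_continuous : continuous P.
Proof.
move=> x; rewrite /continuous_at /P.
by repeat first [exact: cvg_cst | exact: cvg_id | apply: cvgB | apply: cvgM].
Qed.

Let s_continuous : continuous s.
Proof.
by move=> x; apply: continuous_comp; [exact: P_continuous|exact: sqrt_continuous].
Qed.

Let near_a : \forall x \near a^'+, a < x < b.
Proof.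
by near=> x; apply/andP; split; near: x; [exact: nbhs_right_gt|exact: nbhs_right_lt].
Unshelve. all: by end_near. Qed.

Let near_b : \forall x \near b^'-, a < x < b.
Proof.
by near=> x; apply/andP; split; near: x; [exact: nbhs_left_gt|exact: nbhs_left_lt].
Unshelve. all: by end_near. Qed.

Let h1_continuous (c : R) : (x - rho) / del @[x --> c] --> (c - rho) / del.
Proof.
by repeat first [exact: cvg_cst | exact: cvg_id | apply: cvgB | apply: cvgM].
Qed.

Let h2_continuous (c : R) : 0 < c ->
  (rho * x - a * b) / (del * x) @[x --> c] --> (rho * c - a * b) / (del * c).
Proof.
move=> c0; apply: cvgM.
  by repeat first [exact: cvg_cst | exact: cvg_id | apply: cvgB | apply: cvgM].
apply: cvgV; first by rewrite gt_eqF // mulr_gt0.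
by apply: cvgM; [exact: cvg_cst|exact: cvg_id].
Qed.

Let h1a : (a - rho) / del = -1.
Proof. by rewrite /rho /del; field; rewrite gt_eqF ?subr_gt0. Qed.
Let h1b : (b - rho) / del = 1.
Proof. by rewrite /rho /del; field; rewrite gt_eqF ?subr_gt0. Qed.
Let h2a : (rho * a - a * b) / (del * a) = -1.
Proof. by rewrite /rho /del; field; rewrite !gt_eqF ?subr_gt0. Qed.
Let h2b : (rho * b - a * b) / (del * b) = 1.
Proof. by rewrite /rho /del; field; rewrite !gt_eqF ?subr_gt0. Qed.

Let itvlt (y : R) : -1 < y < 1 -> -1 <= y <= 1.
Proof. by move=> /andP[/ltW -> /ltW ->]. Qed.

Let th1_a : th1 x @[x --> a^'+] --> th1 a.
Proof.
apply: asin_cvg; first by rewrite h1a; lra.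
  by apply: filterS near_a => x /range1/itvlt.
apply: cvg_at_right_filter; exact: h1_continuous.
Qed.
Let th1_b : th1 x @[x --> b^'-] --> th1 b.
Proof.
apply: asin_cvg; first by rewrite h1b; lra.
  by apply: filterS near_b => x /range1/itvlt.
apply: cvg_at_left_filter; exact: h1_continuous.
Qed.
Let th2_a : th2 x @[x --> a^'+] --> th2 a.
Proof.
apply: asin_cvg; first by rewrite h2a; lra.
  by apply: filterS near_a => x /range2/itvlt.
apply: cvg_at_right_filter; exact: h2_continuous.
Qed.
Let th2_b : th2 x @[x --> b^'-] --> th2 b.
Proof.
apply: asin_cvg; first by rewrite h2b; lra.
  by apply: filterS near_b => x /range2/itvlt.
apply: cvg_at_left_filter; exact: h2_continuous.
Qed.

Let asin1 : asin (1 : R) = pi / 2.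
Proof.
rewrite -[in LHS]sin_pihalf sinK // in_itv /= lexx andbT.
by have := pi_gt0 R; lra.
Qed.
Let asinN1 : asin (-1 : R) = - (pi / 2).
Proof.
rewrite -[in LHS]sin_pihalf -sinN sinK // in_itv /= lexx /=.
by have := pi_gt0 R; lra.
Qed.

Let sa0 : s a = 0. Proof. by rewrite /s /P subrr mul0r sqrtr0. Qed.
Let sb0 : s b = 0. Proof. by rewrite /s /P subrr mulr0 sqrtr0. Qed.

Lemma integral_sqrt_div :
  segment_integral (fun x => s x / x) = pi * (rho - g).
Proof.
pose F x := s x + (rho * th1 x + - (g * th2 x)).
transitivity (F b - F a); last first.
  by rewrite /F sa0 sb0 /th1 /th2 h1a h1b h2a h2b asin1 asinN1; field.
apply: segment_FTC.
- move=> x; rewrite in_itv /= => /andP[ax _]; apply: cvgM; first exact: s_continuous.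
  by apply: cvgV; [rewrite gt_eqF // (lt_le_trans a0)|exact: cvg_id].
- move=> x h; have hs := s_gt0 h; have /andP[ax _] := h.
  have x0 : 0 < x by apply: lt_trans ax.
  apply: (is_derive_eq (dAdd (ds h) (dAdd (dMul (dCst rho x) (dth1 h))
    (dOpp (dMul (dCst g x) (dth2 h)))))).
  have -> : s x / x = P x / (x * s x) by rewrite -s2 //; field; rewrite !gt_eqF.
  transitivity ((2 * rho * x - x ^+ 2 - g ^+ 2) / (x * s x)).
    by field; rewrite !gt_eqF.
  by rewrite g2 /P /rho; field; rewrite !gt_eqF.
- apply: cvgD; first by apply: cvg_at_right_filter; exact: s_continuous.
  by apply: cvgD; [|apply: cvgN]; apply: cvgM; [exact: cvg_cst|exact: th1_a|exact: cvg_cst|exact: th2_a].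
- apply: cvgD; first by apply: cvg_at_left_filter; exact: s_continuous.
  by apply: cvgD; [|apply: cvgN]; apply: cvgM; [exact: cvg_cst|exact: th1_b|exact: cvg_cst|exact: th2_b].
Qed.

Lemma integral_sqrt : segment_integral s = pi * (rho ^+ 2 - a * b) / 2.
Proof.
pose F x := ((x - rho) * s x + del ^+ 2 * th1 x) / 2.
transitivity (F b - F a); last first.
  by rewrite /F sa0 sb0 /th1 h1a h1b asin1 asinN1 /rho /del; field.
apply: segment_FTC.
- by move=> x _; exact: s_continuous.
- move=> x h; have hs := s_gt0 h.
  apply: (is_derive_eq (dMul (dAdd (dMul (dAdd (dId x) (dCst (- rho) x)) (ds h))
    (dMul (dCst (del ^+ 2) x) (dth1 h))) (dCst 2^-1 x))).
  transitivity ((s x ^+ 2 - (x - rho) ^+ 2 + del ^+ 2) / (2 * s x)).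
    by field; rewrite gt_eqF.
  have -> : - (x - rho) ^+ 2 = P x - del ^+ 2 by rewrite /P /rho /del; field.
  by rewrite addrA subrK s2 // -(s2 h); field; rewrite gt_eqF.
- apply: cvgM; last exact: cvg_cst.
  apply: cvgD; apply: cvgM.
  + by apply: cvgB; [apply: cvg_at_right_filter; exact: cvg_id|exact: cvg_cst].
  + by apply: cvg_at_right_filter; exact: s_continuous.
  + exact: cvg_cst.
  + exact: th1_a.
- apply: cvgM; last exact: cvg_cst.
  apply: cvgD; apply: cvgM.
  + by apply: cvgB; [apply: cvg_at_left_filter; exact: cvg_id|exact: cvg_cst].
  + by apply: cvg_at_left_filter; exact: s_continuous.
  + exact: cvg_cst.
  + exact: th1_b.
Qed.

(** The exponents start at -2, so that both terms of the densities are covered. *)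
Definition root_moment k := segment_integral (fun x => x ^+ k * s x / x ^+ 2).

Lemma segment_integrable (f : R -> R) : {in `[a, b]%R, continuous f} ->
  leb.-integrable `[a, b] (EFin \o f).
Proof.
move=> cf; apply: continuous_compact_integrable; first exact: segment_compact.
by apply: continuous_in_subspaceT => x; rewrite inE; exact: cf.
Qed.

Lemma segment_integralD (f h : R -> R) (c d : R) :
  {in `[a, b]%R, continuous f} -> {in `[a, b]%R, continuous h} ->
  segment_integral (fun x => c * f x + d * h x) =
  c * segment_integral f + d * segment_integral h.
Proof.
move=> cf ch.
have cZ (e : R) (l : R -> R) : {in `[a, b]%R, continuous l} ->
    {in `[a, b]%R, continuous (fun x : R => e * l x)}.
  by move=> cl x xab; apply: cvgM; [exact: cvg_cst|exact: cl].
rewrite /segment_integral RintegralD //; try exact/segment_integrable/cZ.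
by rewrite !RintegralZl //; exact: segment_integrable.
Qed.

Lemma root_moment_continuous k :
  {in `[a, b]%R, continuous (fun x : R => x ^+ k * s x / x ^+ 2)}.
Proof.
move=> x; rewrite in_itv /= => /andP[ax _].
have x0 : 0 < x by exact: lt_le_trans ax.
apply: cvgM; first by apply: cvgM; [exact: exprn_continuous|exact: s_continuous].
by apply: cvgV; [rewrite expf_neq0 // gt_eqF|exact: exprn_continuous].
Qed.

Lemma eq_segment_integral (f h : R -> R) :
  (forall x, a <= x <= b -> f x = h x) -> segment_integral f = segment_integral h.
Proof.
by move=> fh; apply: eq_Rintegral => x; rewrite inE /= in_itv; exact: fh.
Qed.

Lemma root_moment1 : root_moment 1 = pi * (rho - g).
Proof.
rewrite -integral_sqrt_div; apply: eq_segment_integral => x /andP[ax _].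
by rewrite -/(s x); field; rewrite gt_eqF // (lt_le_trans a0).
Qed.

Lemma root_moment2 : root_moment 2 = pi * (rho ^+ 2 - a * b) / 2.
Proof.
rewrite -integral_sqrt; apply: eq_segment_integral => x /andP[ax _].
by rewrite -/(s x); field; rewrite gt_eqF // (lt_le_trans a0).
Qed.

(** The integral of the derivative of x^(k-1) s(x)^3 is 0, as s vanishes at both
    ends. *)
Lemma root_moment_rec k :
  (k%:R + 2) * root_moment k.+2 =
  (2 * k%:R + 1) * rho * root_moment k.+1 - (k%:R - 1) * (a * b) * root_moment k.
Proof.
pose f j (x : R) : R := x ^+ j * s x / x ^+ 2.
have cf j := @root_moment_continuous j.
have cD : {in `[a, b]%R, continuous (fun x : R =>
    (2 * k%:R + 1) * rho * f k.+1 x + (- (k%:R - 1) * (a * b)) * f k x)}.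
  move=> x xab.
  by apply: cvgD; apply: cvgM; [exact: cvg_cst|exact: cf|exact: cvg_cst|exact: cf].
suff : segment_integral (fun x => - (k%:R + 2) * f k.+2 x + 1 *
    ((2 * k%:R + 1) * rho * f k.+1 x + (- (k%:R - 1) * (a * b)) * f k x)) = 0.
  rewrite !segment_integralD //; try exact: cf.
  rewrite -!/(root_moment _); lra.
pose F (x : R) := x ^+ k * x^-1 * (P x * s x).
transitivity (F b - F a); last by rewrite /F sa0 sb0 !mulr0 subrr.
apply: segment_FTC.
- by move=> x xab; apply: cvgD; apply: cvgM; [exact: cvg_cst|exact: cf|exact: cvg_cst|exact: cD].
- move=> x h; have hs := s_gt0 h; have /andP[ax _] := h.
  have x0 : 0 < x by apply: lt_trans ax.
  have x0' : x != 0 by rewrite gt_eqF.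
  apply: (is_derive_eq (dMul (dMul (is_derive_fun_exp k x) (dInv x0' (dId x)))
    (dMul (dP x) (ds h)))).
  have -> : k%:R * x ^+ k.-1 = k%:R * x ^+ k / x.
    by case: (k) => [|j]; rewrite ?mul0r // exprSr mulrA mulfK.
  have -> : P x * ((rho - x) / s x) = s x * (rho - x).
    by rewrite -(s2 h); field; rewrite gt_eqF.
  rewrite /f !exprS /P /rho; field; rewrite x0' //=.
- apply: cvgM; last by apply: cvg_at_right_filter; apply: cvgM; [exact: P_continuous|exact: s_continuous].
  apply: cvg_at_right_filter; apply: cvgM; first exact: exprn_continuous.
  by apply: cvgV; [rewrite gt_eqF|exact: cvg_id].
- apply: cvgM; last by apply: cvg_at_left_filter; apply: cvgM; [exact: P_continuous|exact: s_continuous].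
  apply: cvg_at_left_filter; apply: cvgM; first exact: exprn_continuous.
  by apply: cvgV; [rewrite gt_eqF|exact: cvg_id].
Qed.

(** At k = 0 the recurrence gives the moment of exponent -2 from the next two. *)
Lemma root_moment0 : root_moment 0 = pi * (rho - g) / g.
Proof.
have := root_moment_rec 0; rewrite root_moment1 root_moment2 -g2.
rewrite mulr0n mulr0 !add0r mul1r => e.
have : g ^+ 2 * root_moment 0 = g * (pi * (rho - g)) by lra.
move=> h; apply: (mulfI (lt0r_neq0 (exprn_gt0 2 g0))); rewrite h.
by field; rewrite gt_eqF.
Qed.

End Integrals.

(** * Laws with a density on a segment *)
Section Density.
Variables (R : realType) (f : R -> R).
Hypothesis f_ge0 : forall x, 0 <= f x.
Hypothesis mf : measurable_fun [set: R] f.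
Local Notation leb := (@lebesgue_measure R).
Hypothesis f_int1 : (\int[leb]_x (f x)%:E = 1)%E.

(** The hypotheses on f are arguments, so that the probability structure can be
    inferred from the term. *)
Definition density_measure of (forall x, 0 <= f x) & measurable_fun [set: R] f
    & (\int[leb]_x (f x)%:E = 1)%E :=
  fun V : set (measurableTypeR R) => (\int[leb]_(x in V) (f x)%:E)%E.

Local Notation nu := (density_measure f_ge0 mf f_int1).

Let nu0 : nu set0 = 0%E. Proof. by rewrite /density_measure integral_set0. Qed.

Let nu_ge0 V : (0 <= nu V)%E.
Proof. by rewrite /density_measure integral_ge0 //= => x _; rewrite lee_fin. Qed.

Let nu_additive : semi_sigma_additive nu.
Proof.
move=> /= F mF tF mUF; rewrite /density_measure; apply: cvg_toP.
  apply: ereal_nondecreasing_is_cvgn => m n mn.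
  apply: lee_sum_nneg_natr => // k _ _; apply: integral_ge0 => /= x Fkx.
  by rewrite lee_fin.
rewrite ge0_integral_bigcup//=.
- apply: (measurable_funS measurableT) => //; apply/measurable_EFinP; exact: mf.
- by move=> x _; rewrite lee_fin.
Qed.

HB.instance Definition _ := isMeasure.Build _ _ _ nu nu0 nu_ge0 nu_additive.

Let nu_setT : nu [set: _] = 1%E. Proof. exact: f_int1. Qed.

HB.instance Definition _ := @Measure_isProbability.Build _ _ R nu nu_setT.

Lemma density_dominated : nu `<< leb.
Proof.
apply/null_content_dominatesP => V mV V0; rewrite /= /density_measure.
apply: null_set_integral => //; apply: (measurable_funS measurableT) => //.
by apply/measurable_EFinP; exact: mf.
Qed.

Local Notation derivative := (Radon_Nikodym (charge_of_finite_measure nu) leb).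

Let mfE V : measurable V -> measurable_fun V (EFin \o f).
Proof.
by move=> mV; apply/measurable_EFinP; apply: (measurable_funS measurableT).
Qed.

Let derivative_integrable V : measurable V -> leb.-integrable V derivative.
Proof.
move=> mV; apply: (integrableS measurableT mV (@subsetT _ _)).
by apply: Radon_Nikodym_integrable; exact: density_dominated.
Qed.

Lemma density_derivative V : measurable V -> ae_eq leb V derivative (EFin \o f).
Proof.
move=> mV; apply: integral_ae_eq => //; [exact: derivative_integrable|exact: mfE|].
by move=> W _ mW; rewrite -Radon_Nikodym_integral //; exact: density_dominated.
Qed.

Lemma integral_density (h : R -> \bar R) (V : set R) : measurable V ->
  nu.-integrable V h ->
  (\int[nu]_(x in V) h x = \int[leb]_(x in V) (h x * (f x)%:E))%E.
Proof.
move=> mV hi; have mh := measurable_int _ hi.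
rewrite -(Radon_Nikodym_change_of_variables density_dominated mV hi).
apply: ae_eq_integral => //.
- apply: emeasurable_funM => //.
  exact: measurable_int (derivative_integrable mV).
- by apply: emeasurable_funM => //; exact: mfE.
- by apply: ae_eqe_mul2l; exact: density_derivative.
Qed.
End Density.

Section SegmentLaw.
Variables (R : realType) (a b A B : R).
Hypotheses (a0 : 0 < a) (ab : a < b) (A0 : 0 <= A) (B0 : 0 <= B).
Local Notation leb := (@lebesgue_measure R).

Definition segment_density (x : R) : R :=
  (2 * pi)^-1 * Num.sqrt ((x - a) * (b - x)) * (A / x + B / x ^+ 2).

Definition segment_moment n : R :=
  (A * root_moment a b n.+1 + B * root_moment a b n) / (2 * pi).

Let f : R -> R := segment_density \_ `[a, b].

Let dens_continuous : {in `[a, b]%R, continuous segment_density}.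
Proof.
move=> x xab; have := xab; rewrite in_itv /= => /andP[ax _].
have x0 : x != 0 by rewrite gt_eqF // (lt_le_trans a0).
have sc : continuous (fun x : R => Num.sqrt ((x - a) * (b - x))).
  move=> y; apply: continuous_comp; last exact: sqrt_continuous.
  by repeat first [exact: cvg_cst | exact: cvg_id | apply: cvgB | apply: cvgM].
apply: cvgM; first by apply: cvgM; [exact: cvg_cst|exact: sc].
by apply: cvgD; apply: cvgM; [exact: cvg_cst|apply: cvgV => //; exact: cvg_id|exact: cvg_cst|
  apply: cvgV; [rewrite expf_neq0|exact: exprn_continuous]].
Qed.

Let dens_ge0 x : `[a, b]%classic x -> 0 <= segment_density x.
Proof.
rewrite /= in_itv /= => /andP[ax _]; have x0 : 0 <= x by rewrite (le_trans (ltW a0)).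
rewrite /segment_density mulr_ge0 //.
  by rewrite mulr_ge0 ?sqrtr_ge0 // invr_ge0 mulr_ge0 // pi_ge0.
by rewrite addr_ge0 // divr_ge0 // exprn_ge0.
Qed.

Let f_ge0 x : 0 <= f x.
Proof. by apply: restrict_ge0 => y; exact: dens_ge0. Qed.

Let mf : measurable_fun [set: R] f.
Proof.
apply/measurable_restrict => //; rewrite setTI.
apply: subspace_continuous_measurable_fun => //.
by apply: continuous_in_subspaceT => x; rewrite inE; exact: dens_continuous.
Qed.

Let integral_f (S : set R) : (\int[leb]_(x in S) (f x)%:E =
  \int[leb]_(x in S `&` `[a, b]) (segment_density x)%:E)%E.
Proof. by rewrite integral_mkcondr restrict_EFin. Qed.

Let segment_integral_pow n :
  segment_integral a b (fun x => x ^+ n * segment_density x) = segment_moment n.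
Proof.
rewrite /segment_moment mulrDl ![_ * _ / (2 * pi)]mulrAC -segment_integralD //.
- apply: eq_segment_integral => x /andP[ax _].
  have x0 : x != 0 by rewrite gt_eqF // (lt_le_trans a0).
  rewrite /segment_density [x ^+ n.+1]exprS.
  have p0 : (pi : R) != 0 by rewrite gt_eqF // pi_gt0.
  move: p0; move: (pi : R) => p p0.
  by field; rewrite x0 p0.
- exact: root_moment_continuous.
- exact: root_moment_continuous.
Qed.

Let integral_pow n :
  (\int[leb]_(x in `[a, b]) (x ^+ n * segment_density x)%:E = (segment_moment n)%:E)%E.
Proof.
rewrite -segment_integral_pow /segment_integral /Rintegral fineK //.
apply: integrable_fin_num => //; apply: segment_integrable => x xab.
by apply: cvgM; [exact: exprn_continuous|exact: dens_continuous].
Qed.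

Hypothesis mass1 : segment_moment 0 = 1.

Let f_int1 : (\int[leb]_x (f x)%:E = 1)%E.
Proof.
rewrite integral_f setTI -mass1 -integral_pow.
by apply: eq_integral => x _; rewrite expr0 mul1r.
Qed.

(** The integral of t^n against nu is first restricted to the segment, which
    carries nu and on which the integrand is bounded. *)
Lemma segment_law : exists nu : probability (measurableTypeR R) R,
  [/\ forall S : set (measurableTypeR R), measurable S ->
        nu S = (\int[leb]_(x in S `&` `[a, b]%classic) (segment_density x)%:E)%E,
      nu (~` `[a, b]%classic) = 0%E &
      forall n, \int[nu]_t (t ^+ n) = segment_moment n].
Proof.
pose nu : probability (measurableTypeR R) R := density_measure f_ge0 mf f_int1.
have nuE (S : set (measurableTypeR R)) : measurable S ->
    nu S = (\int[leb]_(x in S `&` `[a, b]%classic) (segment_density x)%:E)%E.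
  by move=> mS; rewrite -integral_f.
have nuC : nu (~` `[a, b]%classic) = 0%E.
  by rewrite nuE ?setICl ?integral_set0 //; exact: measurableC.
exists nu; split => // n.
rewrite /Rintegral.
have mX (D : set R) : measurable D -> measurable_fun D (fun x : R => (x ^+ n)%:E).
  move=> mD; apply/measurable_EFinP; exact: measurable_funX.
rewrite (_ : integral _ _ _ = (segment_moment n)%:E) //.
transitivity (\int[nu]_(x in `[a, b]%classic) (x ^+ n)%:E)%E.
  rewrite [RHS]integral_mkcond; apply: ae_eq_integral => //.
  - exact: mX.
  - by apply/(measurable_restrict _ _ _) => //; rewrite ?setTI; exact: mX.
  - exists (~` `[a, b]%classic); split => //; first exact: measurableC.
    move=> x /= hx xab; apply: hx => _.
    by rewrite patchE mem_set.
rewrite integral_density //.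
  rewrite -integral_pow; apply: eq_integral => x xab.
  by rewrite -EFinM /f patchE xab.
apply/integrableP; split; first exact: mX.
apply: (@le_lt_trans _ _ (\int[nu]_(x in `[a, b]%classic) (b ^+ n)%:E)%E).
  apply: ge0_le_integral => //=.
  - by apply/measurable_EFinP; apply: measurableT_comp; [exact: normr_measurable|exact: measurable_funX].
  - move=> x; rewrite in_itv /= => /andP[ax xb].
    have x0 : 0 <= x by rewrite (le_trans (ltW a0)).
    by rewrite lee_fin ger0_norm ?exprn_ge0 // lerXn2r // nnegrE // (le_trans x0).
rewrite integral_cst //.
apply: (@le_lt_trans _ _ ((b ^+ n)%:E * 1)%E).
  rewrite lee_wpmul2l ?probability_le1 //.
  by rewrite lee_fin exprn_ge0 // ltW // (lt_trans a0).
by rewrite mule1 ltry.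
Qed.
End SegmentLaw.

(** * Moment series of the densities *)
Section FormalDerivative.
Variable R : comNzRingType.
Implicit Types f g : fps R.

Definition fps_deriv f : fps R := Fps (fun n => n.+1%:R * f n.+1).

Lemma fps_derivE f n : fps_deriv f n = n.+1%:R * f n.+1.
Proof. by []. Qed.

Lemma fps_derivB f g : fps_deriv (f - g) = fps_deriv f - fps_deriv g.
Proof. by apply: fpsP => n; rewrite fpsDE fpsNE !fps_derivE fpsDE fpsNE mulrBr. Qed.

Lemma fps_derivM f g : fps_deriv (f * g) = fps_deriv f * g + f * fps_deriv g.
Proof.
apply: fpsP => n; rewrite fps_derivE fpsDE !fpsME mulr_sumr.
transitivity (\sum_(i < n.+2) (i%:R * f i * g (n.+1 - i)%N +
    f i * ((n.+1 - i)%:R * g (n.+1 - i)%N))).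
  apply: eq_bigr => i _; have : (i <= n.+1)%N by rewrite -ltnS.
  move: (nat_of_ord i) => j jn; rewrite -{1}(subnKC jn) natrD; ring.
rewrite big_split /=; congr (_ + _).
  rewrite big_ord_recl /= mulr0n !mul0r add0r.
  by apply: eq_bigr => i _; rewrite /bump add1n subSS.
rewrite big_ord_recr /= subnn mul0r mulr0 addr0.
apply: eq_bigr => i _; rewrite subSn //.
by rewrite -ltnS.
Qed.

End FormalDerivative.

(** The lowest nonzero coefficient of W would survive in Q W' and not in Q' W. *)
Lemma fps_ode_unique (R : numFieldType) (Q W : fps R) :
  Q 0%N = 1 -> W 0%N = 0 -> Q * fps_deriv W = fps_deriv Q * W -> W = 0.
Proof.
move=> Q0 W0 e; apply: fpsP; elim/ltn_ind => -[|n] IHn; first exact: W0.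
have := congr1 (fun f : fps R => f n) e; rewrite !fpsME.
rewrite [RHS]big1 => [|i _]; last first.
  by rewrite IHn ?mulr0 // ltnS leq_subr.
rewrite big_ord_recl Q0 mul1r subn0 fps_derivE big1 ?addr0 => [|i _]; last first.
  rewrite fps_derivE IHn ?mulr0 //.
  by have := ltn_ord i; rewrite /= /bump /=; lia.
by move=> /eqP; rewrite mulf_eq0 pnatr_eq0 /= => /eqP.
Qed.

Section RootSeries.
Variables (R : realType) (a b : R).
Hypotheses (a0 : 0 < a) (ab : a < b).
Local Notation u := (@fps_X R).
Local Notation C := (@fps_C R).
Let rho : R := (a + b) / 2.
Let g : R := Num.sqrt (a * b).

Let g0 : 0 < g. Proof. by rewrite sqrtr_gt0 mulr_gt0 // (lt_trans a0). Qed.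
Let g2 : g ^+ 2 = a * b.
Proof. by rewrite sqr_sqrtr // mulr_ge0 // ltW // (lt_trans a0). Qed.
Let pi0 : (pi : R) != 0. Proof. by rewrite gt_eqF // pi_gt0. Qed.

Let N : fps R := Fps (fun k => root_moment a b k / (2 * pi)).

Let N0 : N 0%N = (rho - g) / (2 * g).
Proof.
rewrite /= root_moment0 // -/rho -/g.
have := pi0; move: (pi : R) => p p0; field.
by rewrite p0 gt_eqF.
Qed.
Let N1 : N 1%N = (rho - g) / 2.
Proof.
rewrite /= root_moment1 // -/rho -/g.
by have := pi0; move: (pi : R) => p p0; field.
Qed.
Let N2 : N 2%N = (rho ^+ 2 - a * b) / 4.
Proof.
rewrite /= root_moment2 // -/rho -/g.
by have := pi0; move: (pi : R) => p p0; field.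
Qed.
Let NS k : (k%:R + 2) * N k.+2 =
  (2 * k%:R + 1) * rho * N k.+1 - (k%:R - 1) * (a * b) * N k.
Proof.
rewrite /=; move: ((2 * pi)^-1) => c.
rewrite mulrA root_moment_rec // -/rho; ring.
Qed.

(** In closed form E is 1 - rho u - 2 u^2 h, where h is the generating series of
    the integrals of x^n s(x) / (2 pi). *)
Let E : fps R := Fps (fun n => if n is k.+2 then -2 * N n else if n is 1 then - rho else 1).

Let ES n : n.+2%:R * E n.+2 = (2 * n%:R + 1) * rho * E n.+1 - (n%:R - 1) * (a * b) * E n.
Proof.
case: n => [|[|n]] /=.
- have := N2 => /= ->; rewrite mulr0n; by field.
- have := NS 1; rewrite /= => h; lra.
- have := NS n.+2; rewrite /= -!natr1 => h; lra.
Qed.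

Let Q : fps R := 1 - C (2 * rho) * u + C (a * b) * u ^+ 2.

Let QM (f : fps R) n : (Q * f) n.+2 = f n.+2 - 2 * rho * f n.+1 + a * b * f n.
Proof.
rewrite /Q mulrDl mulrBl mul1r expr2 -!mulrA fpsDE fpsDE fpsNE !fps_CM.
by rewrite !fps_XMS !mulrA.
Qed.

(** The recurrence for the root moments is 2 Q E' = Q' E, so E^2 and Q solve the
    same linear equation with the same constant coefficient. *)
Lemma root_series_sq : E * E = Q.
Proof.
have dQS n : fps_deriv Q n = (- (2 * rho)) *+ (n == 0%N) + (2 * (a * b)) *+ (n == 1%N).
  rewrite fps_derivE /Q fpsDE fpsDE fpsNE fps1E sub0r !fps_CM expr2.
  case: n => [|[|n]]; rewrite ?fps_XMS /= ?mulr0n ?mulr1n; ring.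
have dQE : fps_deriv Q = - C (2 * rho) + C (2 * (a * b)) * u.
  apply: fpsP => n; rewrite dQS fpsDE fpsNE fps_CM /= mulr_natr.
  by case: (n == 0%N); rewrite ?mulr1n ?mulr0n ?oppr0.
have dQM f : fps_deriv Q * f = C (2 * (a * b)) * (u * f) - C (2 * rho) * f.
  rewrite dQE; ring.
have odeE : C 2 * (Q * fps_deriv E) = fps_deriv Q * E.
  have E1 : E 1%N = - rho by [].
  have E0 : E 0%N = 1 by [].
  apply: fpsP => -[|[|n]]; rewrite dQM fps_CM fpsDE fpsNE !fps_CM.
  - rewrite fpsM0E fps_XM0 {1}/Q !(fpsDE, fpsNE) !fpsM0E fps_derivE E0 E1 /=; ring.
  - have Q1 : Q 1%N = - (2 * rho).
      by rewrite /Q !(fpsDE, fpsNE) !fps_CM expr2 !fps_XMS /=; ring.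
    have Q0 : Q 0%N = 1 by rewrite /Q !(fpsDE, fpsNE) !fpsM0E /=; ring.
    have -> : (Q * fps_deriv E) 1%N = Q 0%N * fps_deriv E 1%N + Q 1%N * fps_deriv E 0%N.
      by rewrite fpsME big_ord_recl big_ord1.
    rewrite Q0 Q1.
    rewrite fps_XMS !fps_derivE (ES 0) E0 E1 mulr0n; ring.
  rewrite QM fps_XMS !fps_derivE (ES n.+1) -!natr1; ring.
apply/eqP; rewrite -subr_eq0; apply/eqP; apply: (@fps_ode_unique _ Q).
- by rewrite /Q !(fpsDE, fpsNE) !fpsM0E /= !mulr0 addr0 subr0.
- by rewrite /Q !(fpsDE, fpsNE) !fpsM0E /= !mulr0 addr0 subr0 mulr1 subrr.
rewrite fps_derivB fps_derivM !mulrBr mulrDr.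
have -> : Q * (fps_deriv E * E) + Q * (E * fps_deriv E) = C 2 * (Q * fps_deriv E) * E.
  by rewrite (rmorph_nat (@fps_C R)); ring.
by rewrite odeE; ring.
Qed.

Let h : fps R := Fps (fun n => N n.+2).

Let EE : E = 1 - C rho * u - C 2 * (u * (u * h)).
Proof.
apply: fpsP => -[|[|n]]; rewrite !(fpsDE, fpsNE) !fps_CM ?fps_XM0 ?fps_XMS ?fps_XM0 /=; ring.
Qed.

Variables (A B : R).
Hypotheses (mass1 : segment_moment a b A B 0 = 1).

Let n : fps R := Fps (segment_moment a b A B).

Let nE : u * n = u + C (B * N 1%N) * (u * u) + (C A + C B * u) * (u * (u * h)).
Proof.
have nN k : n k = A * N k.+1 + B * N k.
  by rewrite /= /segment_moment; ring.
have n0 : A * N 1%N + B * N 0%N = 1 by rewrite -nN.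
have hE j : h j = N j.+2 by [].
have u1 : u 1%N = 1 by [].
have uS j : u j.+2 = 0 by [].
have o j : (1 : fps R) j.+1 = 0 by [].
transitivity (u * (1 + C (B * N 1%N) * u + C A * (u * h) + C B * (u * (u * h)))).
  congr (u * _); apply: fpsP => -[|[|k]]; rewrite nN !fpsDE !fps_CM ?fps_XM0 ?fps_XMS ?fps_XM0.
  - by rewrite n0 /=; ring.
  - by rewrite hE u1 o; ring.
  - by rewrite !hE uS o; ring.
ring.
Qed.

Lemma segment_moments_sq :
  (C A + C (2 + B - A * rho) * u - C (B * g) * u ^+ 2 - C 2 * u * n) ^+ 2 =
  (C A + C B * u) ^+ 2 * (1 - C (2 * rho) * u + C (a * b) * u ^+ 2).
Proof.
rewrite -/Q -root_series_sq EE.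
have -> : C 2 * u * n = C 2 * (u * n) by rewrite mulrA.
rewrite nE N1.
have -> : C (2 + B - A * rho) = 2 + C B - C A * C rho.
  by rewrite rmorphB rmorphD rmorphM rmorph_nat.
have -> : C (B * ((rho - g) / 2)) = C B * (C rho - C g) * C 2^-1.
  by rewrite rmorphM /= [C (_ / 2)]rmorphM /= [C (rho - g)]rmorphB /= mulrA.
rewrite [C (B * g)]rmorphM /=.
have h2 : C 2 * C 2^-1 = 1 by rewrite -rmorphM divff ?pnatr_eq0 // rmorph1.
have c2 : C 2 = 2 by rewrite rmorph_nat.
transitivity ((C A + C B * u) ^+ 2 *
  (1 - C rho * u - C 2 * (u * (u * h))) ^+ 2); last by ring.
have e : C 2 * (C B * (C rho - C g) * C 2^-1) = C B * (C rho - C g).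
  by rewrite mulrCA h2 mulr1.
rewrite [C 2 * (_ + _ + _)]mulrDr [C 2 * (_ + _)]mulrDr [C 2 * (_ * (u * u))]mulrA e c2.
by ring.
Qed.

(** The difference of two solutions is multiplied by a series with constant
    coefficient 4 A, which can be cancelled. *)
Lemma segment_moments_unique (x : fps R) : 0 < A ->
  (C A + C (2 + B - A * rho) * u - C (B * g) * u ^+ 2 - C 2 * u * x) ^+ 2 =
  (C A + C B * u) ^+ 2 * (1 - C (2 * rho) * u + C (a * b) * u ^+ 2) ->
  forall k, x k = segment_moment a b A B k.
Proof.
move=> A0; rewrite -segment_moments_sq => /eqP; rewrite -subr_eq0 => /eqP e k.
suff -> : x = n by [].
apply/eqP; rewrite -subr_eq0; apply/eqP.
pose w := C A + C (2 + B - A * rho) * u - C (B * g) * u ^+ 2.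
have c2 : C 2 = 2 by rewrite rmorph_nat.
have {}e : u * ((C 4 * (w - u * x - u * n)) * (n - x)) = u * 0.
  have -> : C 4 = 4 by rewrite rmorph_nat.
  by rewrite mulr0 -[RHS]e c2 /w; ring.
move/fps_XM_inj: e; rewrite -[RHS](mulr0 (C 4 * (w - u * x - u * n))).
move=> /fps_cancel e; apply/eqP; rewrite -oppr_eq0 opprB; apply/eqP/e.
rewrite fps_CM mulf_neq0 ?pnatr_eq0 //.
rewrite /w !(fpsDE, fpsNE) !fps_CM expr2 !fps_XM0 /= mulr1n !mulr0 !oppr0 !addr0.
by rewrite gt_eqF.
Qed.

End RootSeries.

(** * The free Poisson and the free GIG laws *)
Section Identification.
Variables (R : realType) (a b A B : R).
Hypotheses (a0 : 0 < a) (ab : a < b) (A0 : 0 < A) (B0 : 0 <= B).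
Local Notation u := (@fps_X R).
Local Notation C := (@fps_C R).
Let rho : R := (a + b) / 2.
Let g : R := Num.sqrt (a * b).

Let g0 : 0 < g. Proof. by rewrite sqrtr_gt0 mulr_gt0 // (lt_trans a0). Qed.

Lemma segment_mass : A * (rho - g) + B * (rho - g) / g = 2 ->
  segment_moment a b A B 0 = 1.
Proof.
move=> h; rewrite /segment_moment root_moment0 // root_moment1 // -/rho -/g.
have p0 : (pi : R) != 0 by rewrite gt_eqF // pi_gt0.
transitivity ((A * (rho - g) + B * (rho - g) / g) / 2); last by rewrite h divff.
by move: p0; move: (pi : R) => p p0; field; rewrite p0 gt_eqF.
Qed.

(** The four conditions on the coefficients say that the discriminant of the
    quadratic is (A + B u)^2 (1 - a u) (1 - b u). *)
Lemma quadratic_moments (x : fps R) (w1 w2 v : R) :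
  A * (rho - g) + B * (rho - g) / g = 2 ->
  u * x ^+ 2 = (C A + C w1 * u + C w2 * u ^+ 2) * x - C A - C v * u ->
  w1 = 2 + B - A * rho -> w2 = - (B * g) ->
  w1 ^+ 2 + 2 * A * w2 - 4 * v = B ^+ 2 - 4 * A * B * rho + A ^+ 2 * (a * b) ->
  w1 * w2 = A * B * (a * b) - B ^+ 2 * rho ->
  forall k, x k = segment_moment a b A B k.
Proof.
move=> mass quad w1E w2E h2 h3.
apply: segment_moments_unique => //; first exact: segment_mass.
have Bg : C (B * g) = - C w2 by rewrite w2E rmorphN opprK.
rewrite -/rho -/g -w1E Bg mulNr opprK.
set w := C A + _ + _ in quad *.
have -> : (w - C 2 * u * x) ^+ 2 = w ^+ 2 - C 4 * u * (C A + C v * u).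
  have -> : C A + C v * u = w * x - u * x ^+ 2 by rewrite quad; ring.
  by rewrite !(rmorph_nat (@fps_C R)); ring.
have e1 : 2 * A * w1 - 4 * A = 2 * A * B - 2 * rho * A ^+ 2 by rewrite w1E; ring.
have e4 : w2 ^+ 2 = B ^+ 2 * (a * b).
  rewrite w2E sqrrN exprMn sqr_sqrtr // mulr_ge0 // ltW //; exact: lt_trans ab.
have -> : w ^+ 2 - C 4 * u * (C A + C v * u) = C (A ^+ 2) + C (2 * A * w1 - 4 * A) * u +
    C (w1 ^+ 2 + 2 * A * w2 - 4 * v) * u ^+ 2 + C (2 * (w1 * w2)) * u ^+ 3 + C (w2 ^+ 2) * u ^+ 4.
  rewrite /w !(rmorphB, rmorphD, rmorphXn, rmorphM) /= !rmorph1.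
  ring.
rewrite h2 h3 e1 e4.
rewrite !(rmorphB, rmorphD, rmorphXn, rmorphM) /= !rmorph1.
ring.
Qed.

End Identification.

Section FreePoisson.
Variables (R : realType).
Local Notation leb := (@lebesgue_measure R).

(** For 1 < lam there is no atom, and the law is the case A = al, B = 0. *)
Lemma free_poisson_law (lam al : R) (x : fps R) : 1 < lam -> 0 < al ->
  fps_X * x ^+ 2 = (fps_C al + fps_C (1 - lam) * fps_X) * x - fps_C al ->
  exists nu : probability (measurableTypeR R) R,
    [/\ free_poisson lam (1 / al) nu,
        exists2 K : set R, compact K & nu (~` K) = 0%E &
        forall n, \int[nu]_t (t ^+ n) = x n].
Proof.
move=> lam1 al0 quad; pose gam := 1 / al.
have gam0 : 0 < gam by rewrite divr_gt0.
have lam0 : 0 <= lam by rewrite ltW // (lt_trans ltr01).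
pose r := Num.sqrt lam.
have r2 : r ^+ 2 = lam by rewrite sqr_sqrtr.
have r1 : 1 < r by rewrite -sqrtr1 ltr_sqrt // (lt_trans ltr01).
pose a := gam * (1 - r) ^+ 2; pose b := gam * (1 + r) ^+ 2.
have a0 : 0 < a by rewrite mulr_gt0 // exprn_even_gt0 //= subr_eq0 lt_eqF.
have ab : a < b by rewrite ltr_pM2l //; nra.
have rhoE : (a + b) / 2 = gam * (1 + lam) by rewrite /a /b -r2; field.
have abE : a * b = (gam * (lam - 1)) ^+ 2 by rewrite /a /b -r2; ring.
have gE : Num.sqrt (a * b) = gam * (lam - 1).
  by rewrite abE sqrtr_sqr gtr0_norm // mulr_gt0 // subr_gt0.
have algam : al * gam = 1 by rewrite /gam mul1r divff // gt_eqF.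
have mass : al * ((a + b) / 2 - Num.sqrt (a * b)) +
    0 * ((a + b) / 2 - Num.sqrt (a * b)) / Num.sqrt (a * b) = 2.
  rewrite rhoE gE !mul0r addr0.
  transitivity (2 * (al * gam)); [ring|by rewrite algam mulr1].
have xE := @quadratic_moments R a b al 0 a0 ab al0 x (1 - lam) 0 0 mass.
have {}xE n : x n = segment_moment a b al 0 n.
  apply: xE.
  - by rewrite rmorph0 !mul0r addr0 subr0.
  - rewrite rhoE addr0; transitivity (2 - (al * gam) * (1 + lam)); [rewrite algam|]; ring.
  - by rewrite mul0r oppr0.
  - rewrite abE; transitivity ((al * gam) ^+ 2 * (1 - lam) ^+ 2); [rewrite algam|]; ring.
  - by ring.
have [nu [nuE nuK nuM]] := segment_law a0 ab (ltW al0) (lexx 0) (segment_mass a0 ab mass).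
exists nu; split; last by move=> n; rewrite nuM xE.
  split => // S mS; rewrite nuE //.
  have -> : Num.max 0 (1 - lam) = 0 by apply/max_idPl; lra.
  rewrite mul0e add0e !integral_mkcondr; apply: eq_integral => y _.
  rewrite !patchE /free_poisson_interval -/gam -/r -/a -/b.
  have dE : a < y < b -> segment_density a b al 0 y = free_poisson_density lam gam y.
    move=> /andP[ay yb]; have y0 : 0 < y by exact: lt_trans ay.
    rewrite /segment_density /free_poisson_density mul0r addr0.
    have -> : (y - a) * (b - y) = 4 * lam * gam ^+ 2 - (y - gam * (1 + lam)) ^+ 2.
      by rewrite /a /b -r2; ring.
    rewrite mulrAC; congr (_ * _).
    rewrite /gam; have p0 : (pi : R) != 0 by rewrite gt_eqF // pi_gt0.
    by move: p0; move: (pi : R) => p p0; field; rewrite p0 !gt_eqF.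
  have io : (y \in (`]a, b[%classic : set R)) = (a < y < b).
    by apply/idP/idP; rewrite inE /= in_itv.
  have ic : (y \in (`[a, b]%classic : set R)) = (a <= y <= b).
    by apply/idP/idP; rewrite inE /= in_itv.
  rewrite io ic; have [yi|yo] := boolP (a < y < b).
    by have /andP[/ltW -> /ltW ->] := yi; rewrite dE.
  case: ifPn => // /andP[ay yb].
  have [yE|ya] := eqVneq y a.
    by rewrite /segment_density yE subrr mul0r sqrtr0 mulr0 mul0r.
  have [yE|yb'] := eqVneq y b.
    by rewrite /segment_density yE subrr mulr0 sqrtr0 mulr0 mul0r.
  by move: yo; rewrite !lt_neqAle ay yb yb' eq_sym ya.
by exists `[a, b]%classic => //; exact: segment_compact.
Qed.

End FreePoisson.

Section FreeGig.
Variables (R : realType).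

(** The factorization of D supplied by the double root is the identity between
    discriminants, read off at the points 0, 1, -1 and 2. *)
Lemma free_gig_law (lam al be v r : R) (x : fps R) : 0 < al -> 0 < be -> 0 < r ->
  let D w := (al * w ^+ 2 + (1 + lam) * w - be) ^+ 2 - 4 * w ^+ 2 * (al * w + v) in
  D (- r) = 0 -> (forall w, w <= 0 -> 0 <= D w) ->
  fps_X * x ^+ 2 = (fps_C al + fps_C (1 + lam) * fps_X + fps_C (- be) * fps_X ^+ 2) * x
    - fps_C al - fps_C v * fps_X ->
  exists nu : probability (measurableTypeR R) R,
    [/\ free_gig (- lam) al be nu,
        exists2 K : set R, compact K & nu (~` K) = 0%E &
        forall n, \int[nu]_t (t ^+ n) = x n].
Proof.
move=> al0 be0 r0 D Dr Dge quad.
have [a [b [eqs DE]]] := gig_endpoints al0 be0 r0 Dr Dge.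
have [a0 ab e1 e2] := eqs.
have b0 : 0 < b by exact: lt_trans ab.
set g := Num.sqrt (a * b) in e1 e2 DE.
have g0 : 0 < g by rewrite sqrtr_gt0 mulr_gt0.
have g2 : g ^+ 2 = a * b by rewrite sqr_sqrtr // mulr_ge0 // ltW.
pose B := be / g; have B0 : 0 < B by rewrite divr_gt0.
have beE : be = B * g by rewrite /B divfK // gt_eqF.
have e1' : 1 + lam + al * g - B * ((a + b) / 2) / g = 0.
  rewrite -[RHS]e1 opprK; congr (_ - _).
  rewrite beE -mulrA [2 * a * b](_ : _ = 2 * g ^+ 2); last by rewrite g2 mulrA.
  by field; rewrite gt_eqF.
have mass : al * ((a + b) / 2 - g) + B * ((a + b) / 2 - g) / g = 2.
  have : B * ((a + b) / 2 - g) / g = B * ((a + b) / 2) / g - B by field; rewrite gt_eqF.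
  move: e2; rewrite -/B => e2 ->; lra.
have h0 := DE 0; have h1 := DE 1; have h2 := DE (- 1); have h3 := DE 2.
rewrite /D -/B in h0 h1 h2 h3.
have xE n : x n = segment_moment a b al B n.
  apply: (@quadratic_moments R a b al B a0 ab al0 x (1 + lam) (- be) v mass quad).
  - by move: e2; rewrite -/B; lra.
  - by rewrite beE.
  - lra.
  - lra.
have [nu [nuE nuK nuM]] := segment_law a0 ab (ltW al0) (ltW B0) (segment_mass a0 ab mass).
exists nu; split; last by move=> n; rewrite nuM xE.
  split => //; exists a, b; split => // S mS; rewrite nuE //.
  apply: eq_integral => y _; congr EFin.
  rewrite /segment_density /free_gig_density -/g /B.
  by rewrite [(g * _)^-1]invfM mulrA.
by exists `[a, b]%classic => //; exact: segment_compact.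
Qed.

End FreeGig.

Section Law.
Context {R : realType} {A : wstar_probability_space R}.
Implicit Types (X Y : A).
Local Notation phi := (wps_state A).
Local Notation C := fps_C.
Local Notation u := fps_X.

Lemma moments_sa X n : selfadjoint X -> phi (X ^+ n) = (moments X n)%:C.
Proof. by move=> Xsa; exact: (state_sa (saX n Xsa)). Qed.

Lemma moments_distribution X (law : probability (measurableTypeR R) R -> Prop) :
  selfadjoint X ->
  (exists nu, [/\ law nu, exists2 K : set R, compact K & nu (~` K) = 0%E &
    forall n, \int[nu]_t (t ^+ n) = moments X n]) ->
  distributed_as X law.
Proof.
move=> Xsa [nu [nul nuK nuM]]; exists nu => //; split => // n.
by rewrite nuM; exact: moments_sa.
Qed.

(** X - M is - M T for a contraction T, so that the moments about M grow slower
    than M^n: their squares are at most (q M^2)^n, and q <= t^4. *)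
Lemma moments_strictly_positive_bound X : strictly_positive X ->
  exists M t : R, [/\ 0 < M, 0 < t < 1 &
    geometric_bound M^-1 (t ^+ 2) 1 (moments (X - M%:C%:A))].
Proof.
move=> /strictly_positive_contraction[M [q [T [M0 Tq XE]]]].
have [q01 saT _] := Tq.
have /andP[q0 q1] := q01.
(* Bernoulli's inequality: q = 1 - 4 (1 - t) <= t ^+ 4. *)
pose t := 1 - (1 - q) / 4.
have t0 : 0 < t by rewrite /t; lra.
have t1 : t < 1 by rewrite /t; lra.
have qt : q <= t ^+ 4.
  have -> : q = 1 - 4 * (1 - t) by rewrite /t; field.
  have : 0 <= (1 - t) ^+ 2 by rewrite sqr_ge0.
  have : 0 <= (1 - t ^+ 2) ^+ 2 by rewrite sqr_ge0.
  by rewrite -[4%N]/(2 * 2)%N exprM; nra.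
exists M, t; split; rewrite ?t0 ?t1 // => n.
have -> : X - M%:C%:A = (- M)%:C *: T.
  by rewrite XE scalerBr rmorphN scaleNr addrAC subrr add0r.
rewrite /geometric_bound /= exprZn linearZ /= -rmorphXn /= ReZ normrM normrX normrN.
rewrite (gtr0_norm M0) mul1r mulrAC -exprMn mulfV ?gt_eqF // expr1n mul1r.
have t2n : 0 <= (t ^+ 2) ^+ n by rewrite !exprn_ge0 // ltW.
rewrite -ler_sqr ?nnegrE // real_normK ?num_real //.
apply: le_trans (state_sa_contraction n Tq) _.
have -> : ((t ^+ 2) ^+ n) ^+ 2 = (t ^+ 4) ^+ n by rewrite exprAC -(exprM t 2 2).
by rewrite lerXn2r ?nnegrE ?exprn_ge0 // ltW.
Qed.
End Law.

Theorem theorem4p1 (R : realType) (A : wstar_probability_space R) (X Y : A)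
    (X_selfadjoint : selfadjoint X) (Y_selfadjoint : selfadjoint Y)
    (X_positive : vn_positive X) (Y_positive : vn_positive Y)
    (X_invertible : X \is a GRing.unit) (Y_invertible : Y \is a GRing.unit)
    (XY_free : freely_independent X Y)
    (X_compact : compactly_supported X) (Y_compact : compactly_supported Y)
    (X_nondegenerate : vn_nondegenerate X) (Y_nondegenerate : vn_nondegenerate Y) :
  let U := (X + Y)^-1 in
  let V := X^-1 - (X + Y)^-1 in
  forall (E : {linear A -> A}) (E_cond_exp : is_cond_exp (vn_generated U) E)
    (c d : R) (E_V : E V = c%:C%:A) (E_Vinv : E V^-1 = d%:C%:A),
  exists delta0 : R, 0 < delta0 /\
    let lambda := c * d / (c * d - 1) in
    let alpha := delta0 / (c * d - 1) in
    let beta := d / (c * d - 1) in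
    distributed_as Y (free_poisson lambda (1 / alpha)) /\
    distributed_as X (free_gig (- lambda) alpha beta).
Proof.
move=> U V E E_cond_exp c d E_V E_Vinv.
have [q [s1 [q0 kap0 d0 Yeq Xeq]]] := moment_equations X_selfadjoint Y_selfadjoint
  X_positive Y_positive X_invertible Y_invertible XY_free Y_nondegenerate
  E_cond_exp E_V E_Vinv.
exists q; split=> // lambda alpha beta.
set kap := c * d - 1 in kap0 Yeq Xeq.
rewrite -/kap in lambda alpha beta *.
pose v := (c * d + d * s1) / kap.
have alpha0 : 0 < alpha by rewrite divr_gt0.
have beta0 : 0 < beta by rewrite divr_gt0.
have kapN0 : kap != 0 by rewrite gt_eqF.
have lamE : lambda = 1 + kap^-1.
  have cdE : c * d = kap + 1 by rewrite /kap subrK.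
  by rewrite /lambda cdE mulrDl divff // mul1r.
(* Divided by kap, the coefficients q, d and 1 of the two equations become alpha,
   beta and lambda - 1. *)
have qE : q = kap * alpha by rewrite /alpha mulrCA divff ?mulr1.
have dE : d = kap * beta by rewrite /beta mulrCA divff ?mulr1.
have vE : c * d + d * s1 = kap * v by rewrite /v mulrCA divff ?mulr1.
have iE : 1 = kap * (lambda - 1) by rewrite lamE addrAC subrr add0r divff.
have kE : 2 * kap + 1 = kap * (1 + lambda).
  by rewrite [X in _ + X]iE; ring.
have kapI (f : fps R) : fps_C kap * f = 0 -> f = 0.
  move=> h; have e : fps_C kap^-1 * fps_C kap = 1 by rewrite -rmorphM mulVf // rmorph1.
  by rewrite -[f]mul1r -e -mulrA h mulr0.
split; apply: moments_distribution => //.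
  apply: free_poisson_law => //; first by rewrite lamE ltrDl invr_gt0.
  apply/subr0_eq/kapI; move/esym/eqP: Yeq; rewrite -subr_eq0 => /eqP h.
  clearbody alpha lambda kap.
  rewrite -[RHS]h [q in RHS]qE -[fps_X * moments Y in RHS]mul1r -(rmorph1 (@fps_C R)) [in RHS]iE.
  rewrite !(rmorphM, rmorphB, rmorph1) /=; ring.
have [M [t [M0 t01 bM]]] :=
  moments_strictly_positive_bound (unit_strictly_positive X_selfadjoint X_positive X_invertible).
have [[r r0 Dr] Dge] := discriminant_root_ge0 kap0 q0 d0 M0 t01 bM (Xeq M).
have DE w : (q * w ^+ 2 + (2 * kap + 1) * w - d) ^+ 2
      - 4 * kap * w ^+ 2 * (q * w + (c * d + d * s1)) =
    kap ^+ 2 * ((alpha * w ^+ 2 + (1 + lambda) * w - beta) ^+ 2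
      - 4 * w ^+ 2 * (alpha * w + v)).
  by rewrite vE kE {1 2}qE dE; clearbody kap alpha beta v lambda; ring.
apply: (free_gig_law alpha0 beta0 r0 (v := v)).
- by move: Dr; rewrite DE => /eqP; rewrite mulf_eq0 sqrf_eq0 (negPf kapN0) => /eqP.
- by move=> w /Dge; rewrite DE pmulr_rge0 // exprn_gt0.
apply/subr0_eq/kapI; have h := Xeq 0.
rewrite /shifted_equation scale0r subr0 rmorph0 mul0r addr0 in h.
clearbody alpha beta lambda kap v.
rewrite -[RHS]h vE kE [q in RHS]qE [d in RHS]dE.
rewrite !(rmorphM, rmorphD, rmorphN, rmorph1) /=; ring.
Qed.
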